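(* (1) Let $X$ be a linearly ordered compact ultrametric space with a small similarity structure $\mathrm{Sim}_X$. Then $\Gamma(\mathrm{Sim}_X)\cong D_b(\mathcal P_{\mathrm{Sim}_X},[X])$. (2) Conversely, if $\mathcal P=\langle\Sigma\mid\mathcal R\rangle$ is a tree-like semigroup presentation and $x\in\Sigma$, then there exist a linearly ordered compact ultrametric space $X_{\mathcal P}$ and a small similarity structure $\mathrm{Sim}_{X_{\mathcal P}}$ on it such that $D_b(\mathcal P,x)\cong\Gamma(\mathrm{Sim}_{X_{\mathcal P}})$.
   Context: Balls in a compact ultrametric space $X$ are closed metric balls of positive radius ($X$ itself is a ball). A *finite similarity structure* $\mathrm{Sim}_X$ assigns to each ordered pair of balls $B_1,B_2$ a finite (possibly empty) set $\mathrm{Sim}_X(B_1,B_2)$ of surjective similarities $B_1\to B_2$, closed under identities, inverses, compositions and restrictions to sub-balls. $\Gamma(\mathrm{Sim}_X)$ is the group of homeomorphisms $g$ of $X$ such that every point lies in a ball $B$ with $g(B)$ a ball and $g|_B\in\mathrm{Sim}_X(B,g(B))$. $[B]$ is the class of $B$ under $A\sim B\iff\mathrm{Sim}_X(A,B)\ne\emptyset$. A *linearly ordered ultrametric space* is an ultrametric space with a linear order such that whenever $B_1,B_2$ are disjoint balls and some point of $B_1$ is less than some point of $B_2$, every point of $B_1$ is less than every point of $B_2$. A finite similarity structure on a linearly ordered compact ultrametric space is *small* if $|\mathrm{Sim}_X(B_1,B_2)|\le1$ for all balls and every element of each $\mathrm{Sim}_X(B_1,B_2)$ is order-preserving. $\mathcal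 P_{\mathrm{Sim}_X}=\langle\Sigma\mid\mathcal R\rangle$ has alphabet $\Sigma=\{[B]: B\text{ a ball}\}$ and relations $([B],[B_1][B_2]\cdots[B_n])$ for every ball $B$ having $n\ge1$ maximal proper sub-balls $B_1<\dots<B_n$ (listed in order). A *semigroup presentation* $\langle\Sigma\mid\mathcal R\rangle$ consists of a set $\Sigma$ and $\mathcal R\subseteq\Sigma^+\times\Sigma^+$ (non-empty words). It is *tree-like* if every $(w_1,w_2)\in\mathcal R$ has $|w_1|=1$, $|w_2|>1$, and $(a,w_1),(a,w_2)\in\mathcal R$ implies $w_1=w_2$. *Braided diagrams over $\mathcal P$*: take a frame $\partial[0,1]^2$ (with top, bottom, left-to-right order), a finite set of *transistors* (copies of $[0,1]^2$ with top, bottom, left-to-right orders), and a finite non-empty set of *wires* (copies of $[0,1]$) each labelled by a letter of $\Sigma$. The top end of each wire $W$ is attached to a point $t(W)$ on the bottom of a transistor or on the top of the frame, and its bottom end to a point $b(W)$ on the top of a transistor or on the bottom of the frame, all attachment points distinct. Reading labels of wires attached along the top (resp. bottom) of a transistor $T$ from left to right gives its top label $\ell_t(T)$ (resp. bottom label $\ell_b(T)$); require $(\ell_t(T),\ell_b(T))\in\mathcal R$ or $(\ell_b(T),\ell_t(T))\in\mathcal R$. Write $T_1\preceq T_2$ if some wire has $t(W)\in T_2$ and $b(W)\in T_1$; require the transitive closure of $\preceq$ to be a strict partial order. The top/bottom labels of the diagram are read along the top/bottom of the frame; a $(u,w)$-diagram has top label $u$, bottom label $w$. Two diagrams are equivalent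 if there is a homeomorphism between them preserving labels, frames, tops/bottoms and left-to-right orders. Concatenation $\Delta_1\circ\Delta_2$ of a $(w_1,w_2)$-diagram and a $(w_2,w_3)$-diagram glues the wires at the bottom of $\Delta_1$'s frame to those at the top of $\Delta_2$'s frame in order. A *dipole* is a pair $T_1\,\dot\preceq\,T_2$ such that $\ell_b(T_1)=\ell_t(T_2)$ and the wires attached to the bottom of $T_2$ are, in order, exactly the wires attached to the top of $T_1$; reducing it deletes $T_1,T_2$ and these wires and glues, in order, the wires on top of $T_2$ to the wires at the bottom of $T_1$; the inverse operation inserts a dipole. $D_b(\mathcal P,w)$ is the group of $(w,w)$-diagrams modulo equivalence and insertion/removal of dipoles, under concatenation (the *braided diagram group* ). *)

(* Defs.v *)
From Stdlib Require Import Reals List Arith Relations.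
Import ListNotations.
Open Scope R_scope.

(* An isomorphism between two groups given as (carrier predicate, equality, product).
   Both structures in the theorem are groups; an isomorphism of groups is the same
   as a bijective homomorphism of the underlying multiplications. *)
Definition group_iso {A B : Type}
  (PA : A -> Prop) (eqA : A -> A -> Prop) (opA : A -> A -> A)
  (PB : B -> Prop) (eqB : B -> B -> Prop) (opB : B -> B -> B) : Prop :=
  exists phi : A -> B,
    (forall a, PA a -> PB (phi a)) /\
    (forall a a', PA a -> PA a' -> (eqA a a' <-> eqB (phi a) (phi a'))) /\
    (forall b, PB b -> exists a, PA a /\ eqB (phi a) b) /\
    (forall a a', PA a -> PA a' -> eqB (phi (opA a a')) (opB (phi a) (phi a'))).

Section Metric.
Context {X : Type} (d : X -> X -> R).

Definition is_ultrametric : Prop :=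
  (forall x y, 0 <= d x y) /\
  (forall x y, d x y = 0 <-> x = y) /\
  (forall x y, d x y = d y x) /\
  (forall x y z, d x z <= Rmax (d x y) (d y z)).

Definition is_open (O : X -> Prop) : Prop :=
  forall x, O x -> exists e, 0 < e /\ forall y, d x y < e -> O y.

Definition is_compact_space : Prop :=
  forall U : (X -> Prop) -> Prop,
    (forall O, U O -> is_open O) ->
    (forall x, exists O, U O /\ O x) ->
    exists l : list (X -> Prop),
      (forall O, In O l -> U O) /\ (forall x, exists O, In O l /\ O x).

Definition is_ball (B : X -> Prop) : Prop :=
  exists x r, 0 < r /\ forall y, B y <-> d x y <= r.

Definition subset (A B : X -> Prop) : Prop := forall x, A x -> B x.
Definition disjoint (A B : X -> Prop) : Prop := forall x, A x -> B x -> False.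
Definition image (f : X -> X) (A : X -> Prop) : X -> Prop :=
  fun y => exists x, A x /\ f x = y.

Definition strict_linear_order (lt : X -> X -> Prop) : Prop :=
  (forall x, ~ lt x x) /\
  (forall x y z, lt x y -> lt y z -> lt x z) /\
  (forall x y, lt x y \/ x = y \/ lt y x).

Definition lin_ord_cpt_ultrametric (lt : X -> X -> Prop) : Prop :=
  is_ultrametric /\ is_compact_space /\ strict_linear_order lt /\
  (forall B1 B2, is_ball B1 -> is_ball B2 -> disjoint B1 B2 ->
     (exists x y, B1 x /\ B2 y /\ lt x y) ->
     forall x y, B1 x -> B2 y -> lt x y).

(* surjective similarity B1 -> B2, represented by a map X -> X (only its
   values on B1 matter) *)
Definition is_similarity (B1 B2 : X -> Prop) (f : X -> X) : Prop :=
  (forall x, B1 x -> B2 (f x)) /\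
  (forall y, B2 y -> exists x, B1 x /\ f x = y) /\
  (exists lam, 0 < lam /\ forall x y, B1 x -> B1 y -> d (f x) (f y) = lam * d x y).

Definition agree_on (B : X -> Prop) (f g : X -> X) : Prop := forall x, B x -> f x = g x.

(* Sim B1 B2 f : "f (restricted to B1) is an element of Sim_X(B1,B2)". *)
Definition finite_sim_structure (Sim : (X -> Prop) -> (X -> Prop) -> (X -> X) -> Prop) : Prop :=
  (forall B1 B2 f, Sim B1 B2 f -> is_ball B1 /\ is_ball B2 /\ is_similarity B1 B2 f) /\
  (forall B1 B2 f g, Sim B1 B2 f -> agree_on B1 f g -> Sim B1 B2 g) /\
  (forall B1 B2, exists l : list (X -> X),
      forall f, Sim B1 B2 f -> exists g, In g l /\ agree_on B1 f g) /\
  (forall B, is_ball B -> Sim B B (fun x => x)) /\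
  (forall B1 B2 f, Sim B1 B2 f ->
      exists g, Sim B2 B1 g /\ (forall x, B1 x -> g (f x) = x)) /\
  (forall B1 B2 B3 f g, Sim B1 B2 f -> Sim B2 B3 g -> Sim B1 B3 (fun x => g (f x))) /\
  (forall B1 B2 f B, Sim B1 B2 f -> is_ball B -> subset B B1 ->
      is_ball (image f B) /\ Sim B (image f B) f).

Definition small_sim_structure (lt : X -> X -> Prop)
  (Sim : (X -> Prop) -> (X -> Prop) -> (X -> X) -> Prop) : Prop :=
  finite_sim_structure Sim /\
  (forall B1 B2 f g, Sim B1 B2 f -> Sim B1 B2 g -> agree_on B1 f g) /\
  (forall B1 B2 f, Sim B1 B2 f ->
      forall x y, B1 x -> B1 y -> lt x y -> lt (f x) (f y)).

Definition continuous (f : X -> X) : Prop :=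
  forall x e, 0 < e -> exists del, 0 < del /\ forall y, d x y < del -> d (f x) (f y) < e.

Definition homeomorphism (g : X -> X) : Prop :=
  exists h : X -> X, (forall x, h (g x) = x) /\ (forall y, g (h y) = y) /\
    continuous g /\ continuous h.

Definition in_Gamma (Sim : (X -> Prop) -> (X -> Prop) -> (X -> X) -> Prop) (g : X -> X) : Prop :=
  homeomorphism g /\
  forall x, exists B, is_ball B /\ B x /\ is_ball (image g B) /\ Sim B (image g B) g.

Definition Gamma_eq (f g : X -> X) : Prop := forall x, f x = g x.
Definition Gamma_op (f g : X -> X) : X -> X := fun x => f (g x).

Definition Ball : Type := { B : X -> Prop | is_ball B }.

Section Pres.
Context (lt : X -> X -> Prop) (Sim : (X -> Prop) -> (X -> Prop) -> (X -> X) -> Prop).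

Definition sim_equiv (A B : X -> Prop) : Prop := exists f, Sim A B f.

Definition Cls : Type :=
  { C : (X -> Prop) -> Prop | exists B : Ball, C = (fun A => sim_equiv A (proj1_sig B)) }.

Definition cls (B : Ball) : Cls :=
  exist _ (fun A => sim_equiv A (proj1_sig B)) (ex_intro _ B eq_refl).

Definition proper_subball (B' B : X -> Prop) : Prop :=
  is_ball B' /\ subset B' B /\ ~ subset B B'.

Definition maximal_proper_subball (B' B : X -> Prop) : Prop :=
  proper_subball B' B /\ ~ (exists C, proper_subball B' C /\ proper_subball C B).

Definition set_lt (A B : X -> Prop) : Prop := forall x y, A x -> B y -> lt x y.

Definition RelSim (u v : list Cls) : Prop :=
  exists (B : Ball) (L : list Ball),
    L <> [] /\
    (forall B', maximal_proper_subball B' (proj1_sig B) <->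
                exists Bi, In Bi L /\ proj1_sig Bi = B') /\
    (forall i j, (i < j < length L)%nat ->
        forall b, set_lt (proj1_sig (nth i L b)) (proj1_sig (nth j L b))) /\
    u = [cls B] /\ v = map cls L.

End Pres.
End Metric.

(* A diagram: wires and transistors are natural-number identifiers.
   dtop / dbot : wires attached to the top / bottom of the frame, left to right.
   dtrs        : the transistors.
   ttop t / tbot t : wires attached to the top / bottom of transistor t, left to right.
   dlab        : labels of wires.
   The wire set is the set of wires having a top end, i.e. dtop ++ (tbot of transistors). *)
Record diagram (Sigma : Type) := mkDiagram {
  dlab : nat -> Sigma;
  dtop : list nat;
  dbot : list nat;
  dtrs : list nat;
  ttop : nat -> list nat;
  tbot : nat -> list nat }.
Arguments mkDiagram {Sigma}.
Arguments dlab {Sigma}. Arguments dtop {Sigma}. Arguments dbot {Sigma}.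
Arguments dtrs {Sigma}. Arguments ttop {Sigma}. Arguments tbot {Sigma}.

Section Diagrams.
Context {Sigma : Type} (Rel : list Sigma -> list Sigma -> Prop).

Definition wire_tops (D : diagram Sigma) : list nat :=
  dtop D ++ concat (map (tbot D) (dtrs D)).
Definition wire_bots (D : diagram Sigma) : list nat :=
  dbot D ++ concat (map (ttop D) (dtrs D)).

Definition tprec (D : diagram Sigma) (t1 t2 : nat) : Prop :=
  In t1 (dtrs D) /\ In t2 (dtrs D) /\ exists j, In j (tbot D t2) /\ In j (ttop D t1).

Definition valid (u w : list Sigma) (D : diagram Sigma) : Prop :=
  NoDup (dtrs D) /\ NoDup (wire_tops D) /\ NoDup (wire_bots D) /\
  (forall j, In j (wire_tops D) <-> In j (wire_bots D)) /\
  wire_tops D <> [] /\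
  map (dlab D) (dtop D) = u /\ map (dlab D) (dbot D) = w /\
  (forall t, In t (dtrs D) ->
     Rel (map (dlab D) (ttop D t)) (map (dlab D) (tbot D t)) \/
     Rel (map (dlab D) (tbot D t)) (map (dlab D) (ttop D t))) /\
  (forall t, ~ clos_trans nat (tprec D) t t).

(* equivalence of diagrams (homeomorphism preserving all structure) *)
Definition diag_iso (D D' : diagram Sigma) : Prop :=
  exists (sig tau : nat -> nat),
    (forall j j', In j (wire_tops D) -> In j' (wire_tops D) -> sig j = sig j' -> j = j') /\
    (forall j', In j' (wire_tops D') -> exists j, In j (wire_tops D) /\ sig j = j') /\
    (forall t t', In t (dtrs D) -> In t' (dtrs D) -> tau t = tau t' -> t = t') /\
    (forall t', In t' (dtrs D') -> exists t, In t (dtrs D) /\ tau t = t') /\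
    (forall t, In t (dtrs D) -> In (tau t) (dtrs D')) /\
    (forall j, In j (wire_tops D) -> dlab D' (sig j) = dlab D j) /\
    map sig (dtop D) = dtop D' /\ map sig (dbot D) = dbot D' /\
    (forall t, In t (dtrs D) ->
       ttop D' (tau t) = map sig (ttop D t) /\ tbot D' (tau t) = map sig (tbot D t)).

Fixpoint subst (src tgt : list nat) (j : nat) : nat :=
  match src, tgt with
  | a :: s, b :: t => if Nat.eqb j a then b else subst s t j
  | _, _ => j
  end.

(* removal of a dipole T1 <. T2 (T2 above T1, bottom wires of T2 = top wires of T1) *)
Definition reduce_dipole (D : diagram Sigma) (t1 t2 : nat) : diagram Sigma :=
  let rho := subst (tbot D t1) (ttop D t2) in
  mkDiagram (dlab D) (dtop D) (map rho (dbot D))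
    (filter (fun t => negb (Nat.eqb t t1 || Nat.eqb t t2)) (dtrs D))
    (fun t => map rho (ttop D t)) (tbot D).

Definition reduces (D D' : diagram Sigma) : Prop :=
  exists t1 t2, In t1 (dtrs D) /\ In t2 (dtrs D) /\ t1 <> t2 /\
    tprec D t1 t2 /\
    map (dlab D) (tbot D t1) = map (dlab D) (ttop D t2) /\
    tbot D t2 = ttop D t1 /\
    D' = reduce_dipole D t1 t2.

Definition deq (w : list Sigma) : diagram Sigma -> diagram Sigma -> Prop :=
  clos_refl_sym_trans (diagram Sigma)
    (fun D D' => valid w w D /\ valid w w D' /\ (diag_iso D D' \/ reduces D D')).

Definition concat_diag (D1 D2 : diagram Sigma) : diagram Sigma :=
  let SW := S (list_max (wire_tops D1)) in
  let ST := S (list_max (dtrs D1)) in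
  let f2 := fun j => if existsb (Nat.eqb j) (dtop D2)
                     then subst (dtop D2) (dbot D1) j else (SW + j)%nat in
  mkDiagram
    (fun j => if Nat.ltb j SW then dlab D1 j else dlab D2 (j - SW))
    (dtop D1) (map f2 (dbot D2))
    (dtrs D1 ++ map (Nat.add ST) (dtrs D2))
    (fun t => if Nat.ltb t ST then ttop D1 t else map f2 (ttop D2 (t - ST)))
    (fun t => if Nat.ltb t ST then tbot D1 t else map f2 (tbot D2 (t - ST))).

End Diagrams.

Definition tree_like {Sigma : Type} (Rel : list Sigma -> list Sigma -> Prop) : Prop :=
  (forall w1 w2, Rel w1 w2 -> length w1 = 1%nat /\ (1 < length w2)%nat) /\
  (forall a w1 w2, Rel [a] w1 -> Rel [a] w2 -> w1 = w2).

(* Main.v *)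
(* Expanding a letter [a] by the relations [(a, w)] produces a finitely branching tree, and
   the points of the space are its branches, starting at [x]; the balls are the subtrees.
   Read from bottom to top, a diagram moves branches: going up through a transistor that
   splits [a] into [w] prepends the index of the letter, going up through one that merges
   [w] into [a] removes it.  The resulting map is a bijection which locally replaces a
   prefix by a prefix ending at the same letter, so it lies in the group of the similarity
   structure; it is multiplicative and invariant under dipole reduction.
   Injectivity: in a diagram without dipoles no merge lies above a split, because a letter
   has only one expansion.  Such a diagram is a tree of splits joined to a tree of merges,
   and it is determined by the pairs of addresses of its middle wires; absence of dipoles
   makes these pairs maximal, hence determined by the map.
   Surjectivity: by compactness a local bijection is given by a finite table of prefix
   pairs, which is turned into such a diagram. *)

Require Import Defs.
From Stdlib Require Import Reals List Lia Lra Relations Permutation Sorted Cantor.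
From Stdlib Require Import Classical ClassicalEpsilon FunctionalExtensionality PropExtensionality ProofIrrelevance.
Import ListNotations.
Local Open Scope nat_scope.

(** * Paths and addresses *)

(** Both halves of the theorem are instances of one statement, about spaces that are [coded] by
    infinite paths. For a given space the tree is that of iterated maximal proper sub-balls, and the
    work lies in showing that every ball occurs in it and that every path has exactly one limit
    point. For a given presentation the path space is built so as to be coded. Diagrams are read
    upwards because the left factor of a concatenation lies on top: the right factor then acts
    first, as in [Gamma_op], and no inversion enters. Right-hand sides of length at least two serve
    two purposes: a transistor is either a split or a merge but never both, and different addresses
    have different cylinders, so that a ball determines its address. Turning a diagram upside down
    ([flip]) inverts its map and exchanges splits with merges, so each fact about splits also gives
    one about merges. Compactness is used on the tree as bar induction, which directly returns the
    finite lists (subcovers, tables of prefix pairs) that are wanted. *)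

Definition point : Type := nat -> nat.

Definition pcons (i : nat) (p : point) : point :=
  fun n => match n with O => i | S m => p m end.

Definition ptail (p : point) : point := fun n => p (S n).

Definition papp (al : list nat) (p : point) : point := fold_right pcons p al.

Lemma pcons_eta (p : point) : pcons (p 0) (ptail p) = p.
Proof. extensionality n; destruct n; reflexivity. Qed.

Lemma pcons_inj (i j : nat) (p q : point) : pcons i p = pcons j q -> i = j /\ p = q.
Proof.
  intros H; split.
  - exact (f_equal (fun f => f 0) H).
  - extensionality n; exact (f_equal (fun f => f (S n)) H).
Qed.

Lemma papp_app (al be : list nat) (p : point) : papp (al ++ be) p = papp al (papp be p).
Proof. apply fold_right_app. Qed.

Lemma papp_snoc (al : list nat) (i : nat) (p : point) :
  papp (al ++ [i]) p = papp al (pcons i p).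
Proof. apply papp_app. Qed.

Lemma papp_inj (al : list nat) (p q : point) : papp al p = papp al q -> p = q.
Proof.
  induction al as [|i al IH]; intros H; [exact H|].
  apply IH; exact (proj2 (pcons_inj _ _ _ _ H)).
Qed.

Lemma papp_comparable (al be : list nat) (p q : point) :
  papp al p = papp be q ->
  exists ga, (al = be ++ ga /\ q = papp ga p) \/ (be = al ++ ga /\ p = papp ga q).
Proof.
  revert be; induction al as [|i al IH]; intros be H.
  - exists be; right; auto.
  - destruct be as [|j be].
    + exists (i :: al); left; auto.
    + destruct (pcons_inj _ _ _ _ H) as [-> H'].
      destruct (IH _ H') as [ga [[-> ->]|[-> ->]]]; exists ga; [left|right]; auto.
Qed.

Section Paths.
Context {Sigma : Type} (Rel : list Sigma -> list Sigma -> Prop) (TL : tree_like Rel).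

Definition nonterminal (a : Sigma) : Prop := exists w, Rel [a] w.

Lemma rel_inv (u w : list Sigma) : Rel u w -> exists a, u = [a] /\ 1 < length w.
Proof.
  intros H; destruct (proj1 TL _ _ H) as [H1 H2].
  destruct u as [|a [|b u]]; try discriminate; eauto.
Qed.

Lemma rel_length (a : Sigma) (w : list Sigma) : Rel [a] w -> 1 < length w.
Proof. intros H; exact (proj2 (proj1 TL _ _ H)). Qed.

Lemma rel_det (a : Sigma) (w w' : list Sigma) : Rel [a] w -> Rel [a] w' -> w = w'.
Proof. apply (proj2 TL). Qed.

(* A terminal letter is given itself as its only child, so that every path is
   infinite: a path ends with zeros once a terminal letter is reached. *)
Definition children (a : Sigma) : list Sigma :=
  match excluded_middle_informative (nonterminal a) with
  | left H => proj1_sig (constructive_indefinite_description _ H)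
  | right _ => [a]
  end.

Lemma children_rel (a : Sigma) (w : list Sigma) : Rel [a] w -> children a = w.
Proof.
  intros H; unfold children; destruct excluded_middle_informative as [K|K].
  - destruct constructive_indefinite_description as [w' H']; simpl; eapply rel_det; eauto.
  - destruct K; exists w; exact H.
Qed.

Lemma children_terminal (a : Sigma) : ~ nonterminal a -> children a = [a].
Proof.
  intros H; unfold children; destruct excluded_middle_informative; tauto.
Qed.

Lemma children_length (a : Sigma) : 0 < length (children a).
Proof.
  destruct (classic (nonterminal a)) as [[w H]|H].
  - rewrite (children_rel _ _ H); apply rel_length in H; lia.
  - rewrite children_terminal by exact H; simpl; lia.
Qed.

(** The default of [nth] is never met on the paths of interest: [ok] keeps every index below the
    number of children. *)
Fixpoint letter_at (a : Sigma) (p : point) (n : nat) : Sigma :=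
  match n with
  | O => a
  | S m => letter_at (nth (p 0) (children a) a) (ptail p) m
  end.

Definition ok (a : Sigma) (p : point) : Prop :=
  forall n, p n < length (children (letter_at a p n)).

Lemma ok_cons (a : Sigma) (i : nat) (p : point) :
  ok a (pcons i p) <-> i < length (children a) /\ ok (nth i (children a) a) p.
Proof.
  split.
  - intros H; split; [exact (H 0)|]; intros n; exact (H (S n)).
  - intros [H1 H2] [|n]; [exact H1|exact (H2 n)].
Qed.

Lemma ok_cons_rel (a b : Sigma) (w : list Sigma) (i : nat) (p : point) :
  Rel [a] w -> nth_error w i = Some b -> ok a (pcons i p) <-> ok b p.
Proof.
  intros H Hi; rewrite ok_cons, (children_rel _ _ H), (nth_error_nth _ _ _ Hi).
  assert (i < length w) by (apply nth_error_Some; congruence); tauto.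
Qed.

Lemma ok_inv (a : Sigma) (w : list Sigma) (p : point) :
  Rel [a] w -> ok a p ->
  exists i b q, p = pcons i q /\ nth_error w i = Some b /\ ok b q.
Proof.
  intros H Hp; rewrite <- (pcons_eta p) in Hp |- *.
  apply ok_cons in Hp as [H1 H2]; rewrite (children_rel _ _ H) in *.
  exists (p 0), (nth (p 0) w a), (ptail p); auto using nth_error_nth'.
Qed.

(** The base point of every cylinder, used below whenever a cylinder must be shown non-empty: no
    letter has an empty list of children. *)
Lemma ok_zero (a : Sigma) : ok a (fun _ => 0).
Proof. intros n; apply children_length. Qed.

Lemma ok_terminal (a : Sigma) (p : point) : ~ nonterminal a -> ok a p -> p = fun _ => 0.
Proof.
  intros Ha Hp; extensionality n; revert p Hp; induction n as [|n IH]; intros p Hp.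
  - specialize (Hp 0); simpl in Hp; rewrite children_terminal in Hp by exact Ha; simpl in Hp; lia.
  - rewrite <- (pcons_eta p) in Hp; apply ok_cons in Hp as [H1 H2].
    rewrite children_terminal in * by exact Ha.
    destruct (p 0); [|simpl in H1; lia]; exact (IH _ H2).
Qed.

(** Unlike [ok], a walk uses relations only and never the padding at a terminal letter. Otherwise
    one terminal node would have infinitely many addresses. *)
Inductive walk : Sigma -> list nat -> Sigma -> Prop :=
| walk_nil a : walk a [] a
| walk_cons a w i b al c :
    Rel [a] w -> nth_error w i = Some b -> walk b al c -> walk a (i :: al) c.

Lemma walk_nil_inv (a b : Sigma) : walk a [] b -> a = b.
Proof. inversion 1; reflexivity. Qed.

Lemma walk_cons_inv (a c : Sigma) (i : nat) (al : list nat) :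
  walk a (i :: al) c ->
  exists w b, Rel [a] w /\ nth_error w i = Some b /\ walk b al c.
Proof. inversion 1; subst; eauto. Qed.

Lemma walk_app (a b c : Sigma) (al be : list nat) :
  walk a al b -> walk b be c -> walk a (al ++ be) c.
Proof. induction 1; simpl; intros; [assumption|]; econstructor; eauto. Qed.

Lemma walk_app_inv (a c : Sigma) (al be : list nat) :
  walk a (al ++ be) c -> exists b, walk a al b /\ walk b be c.
Proof.
  revert a; induction al as [|i al IH]; intros a H; simpl in H.
  - exists a; split; [constructor|exact H].
  - apply walk_cons_inv in H as (w & b & H1 & H2 & H3).
    destruct (IH _ H3) as (b' & H4 & H5); exists b'; split; [econstructor; eauto|exact H5].
Qed.

Lemma walk_det (a b c : Sigma) (al : list nat) : walk a al b -> walk a al c -> b = c.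
Proof.
  intros H; revert c; induction H as [a|a w i b al c H1 H2 H3 IH]; intros d Hd.
  - apply walk_nil_inv; exact Hd.
  - apply walk_cons_inv in Hd as (w' & b' & H4 & H5 & H6).
    rewrite (rel_det _ _ _ H4 H1) in H5; apply IH; congruence.
Qed.

Lemma walk_one (a b : Sigma) (w : list Sigma) (i : nat) :
  Rel [a] w -> nth_error w i = Some b -> walk a [i] b.
Proof. intros; econstructor; eauto; constructor. Qed.

Lemma walk_snoc (a b c : Sigma) (w : list Sigma) (al : list nat) (i : nat) :
  walk a al b -> Rel [b] w -> nth_error w i = Some c -> walk a (al ++ [i]) c.
Proof. intros; eapply walk_app; eauto; eapply walk_one; eauto. Qed.

Lemma walk_snoc_inv (a c : Sigma) (al : list nat) (i : nat) :
  walk a (al ++ [i]) c ->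
  exists b w, walk a al b /\ Rel [b] w /\ nth_error w i = Some c.
Proof.
  intros H; apply walk_app_inv in H as (b & H1 & H2).
  apply walk_cons_inv in H2 as (w & c' & H3 & H4 & H5); apply walk_nil_inv in H5; subst; eauto.
Qed.

Lemma ok_papp (a b : Sigma) (al : list nat) (p : point) :
  walk a al b -> ok a (papp al p) <-> ok b p.
Proof.
  induction 1; simpl; [tauto|]; rewrite <- IHwalk; eapply ok_cons_rel; eauto.
Qed.

Lemma cylinder_subset (a b c : Sigma) (al be : list nat) :
  walk a al b -> walk a be c ->
  (forall p, ok b p -> exists q, papp al p = papp be q) ->
  exists ga, al = be ++ ga.
Proof.
  intros Hal Hbe H.
  destruct (H _ (ok_zero b)) as [q Hq].
  destruct (papp_comparable _ _ _ _ Hq) as [ga [[-> _]|[-> _]]]; [eauto|].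
  destruct ga as [|i ga]; [exists []; rewrite !app_nil_r; reflexivity|exfalso].
  apply walk_app_inv in Hbe as (b' & H1 & H2); rewrite (walk_det _ _ _ _ H1 Hal) in H2.
  apply walk_cons_inv in H2 as (w & b1 & H3 & H4 & _).
  pose proof (rel_length _ _ H3) as Hw.
  (* A sibling of [i]: one of the indices 0 and 1 differs from [i], and both exist because [w] has
     at least two letters. *)
  set (i' := if Nat.eqb i 0 then 1 else 0).
  assert (i' <> i /\ i' < length w) as [Hi1 Hi2]
    by (unfold i'; destruct (Nat.eqb_spec i 0); lia).
  destruct (nth_error w i') as [b2|] eqn:E; [|apply nth_error_None in E; lia].
  destruct (H (pcons i' (fun _ => 0))) as [q' Hq'].
  - apply (ok_cons_rel _ _ _ _ _ H3 E), ok_zero.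
  - rewrite papp_app in Hq'; apply papp_inj in Hq'; simpl in Hq'.
    apply pcons_inj in Hq' as [? _]; contradiction.
Qed.

Lemma cylinder_inj (a b c : Sigma) (al be : list nat) :
  walk a al b -> walk a be c ->
  (forall p, ok b p -> exists q, papp al p = papp be q) ->
  (forall q, ok c q -> exists p, papp be q = papp al p) ->
  al = be.
Proof.
  intros Hal Hbe H1 H2.
  destruct (cylinder_subset _ _ _ _ _ Hal Hbe H1) as [ga Ha].
  destruct (cylinder_subset _ _ _ _ _ Hbe Hal H2) as [de Hb].
  pose proof (f_equal (@length nat) Ha) as La; pose proof (f_equal (@length nat) Hb) as Lb.
  rewrite length_app in La, Lb.
  destruct ga; [rewrite app_nil_r in Ha; exact Ha|simpl in La; lia].
Qed.

Lemma papp_inj_l (a b : Sigma) (al be : list nat) :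
  walk a al b -> walk a be b -> (forall p, ok b p -> papp al p = papp be p) -> al = be.
Proof.
  intros Hal Hbe H; apply (cylinder_inj a b b al be Hal Hbe); intros p Hp; exists p;
    [|symmetry]; auto.
Qed.

(** * Bar induction on the expansion tree *)

Inductive barred (good : list nat -> Prop) : list nat -> Sigma -> Prop :=
| bar_good al a : good al -> barred good al a
| bar_split al a w : Rel [a] w ->
    (forall i b, nth_error w i = Some b -> barred good (al ++ [i]) b) ->
    barred good al a.

(** The form in which compactness is used. A node that is not barred has a child that is not barred;
    choosing such children forever gives a path, and the good prefix of that path contradicts the
    choice. *)
Lemma fan_theorem (x : Sigma) (good : list nat -> Prop) :
  (forall p, ok x p -> exists al a q, walk x al a /\ p = papp al q /\ good al) ->
  (forall al be b, good al -> walk x (al ++ be) b -> good (al ++ be)) ->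
  barred good [] x.
Proof.
  intros Hbar Hmono; apply NNPP; intros Hnot.
  pose (bad := fun s : list nat * Sigma => walk x (fst s) (snd s) /\ ~ barred good (fst s) (snd s)).
  assert (Hstep : forall s, bad s -> exists i b w, Rel [snd s] w /\ nth_error w i = Some b /\ bad (fst s ++ [i], b)).
  { intros [al a] [Hw Hb]; simpl in *.
    destruct (classic (nonterminal a)) as [[w Hr]|Ht].
    - apply NNPP; intros Hno; apply Hb; eapply bar_split; [exact Hr|].
      intros i b Hi; apply NNPP; intros Hbi; apply Hno; exists i, b, w; repeat split; auto.
      simpl; eapply walk_snoc; eauto.
    (* Below a terminal node there is no further address, so the good prefix of its zero path is a
       prefix of [al], and monotonicity makes [al] good. *)
    - exfalso; apply Hb, bar_good.
      destruct (Hbar (papp al (fun _ => 0))) as (be & b & q & H1 & H2 & H3).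
      { apply (ok_papp _ _ _ _ Hw), ok_zero. }
      destruct (papp_comparable _ _ _ _ H2) as [ga [[-> _]|[-> _]]]; [eauto|].
      destruct ga as [|j ga]; [rewrite app_nil_r in H3; exact H3|exfalso].
      apply walk_app_inv in H1 as (b' & H4 & H5); rewrite (walk_det _ _ _ _ H4 Hw) in H5.
      apply walk_cons_inv in H5 as (w & ? & H6 & _); apply Ht; exists w; exact H6. }
  pose (next := fun s => match excluded_middle_informative (bad s) with
                | left H => let (i, E) := constructive_indefinite_description _ (Hstep s H) in i
                | right _ => 0 end).
  assert (Hnext : forall s, bad s -> exists b w, Rel [snd s] w /\ nth_error w (next s) = Some b /\ bad (fst s ++ [next s], b)).
  { intros s Hs; unfold next; destruct excluded_middle_informative; [|contradiction].
    destruct constructive_indefinite_description; assumption. }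
  clearbody next.
  (* The address and the letter reached after [n] choices; the letter is recomputed with [children],
     which agrees with the relation supplied by [Hnext]. *)
  pose (branch := fix branch n := match n with
                  | O => ([], x)
                  | S m => let s := branch m in
                           (fst s ++ [next s], nth (next s) (children (snd s)) x)
                  end).
  assert (Hbad : forall n, bad (branch n)).
  { induction n as [|n IH]; [split; [constructor|exact Hnot]|].
    destruct (Hnext _ IH) as (b & w & H1 & H2 & H3); simpl.
    rewrite (children_rel _ _ H1), (nth_error_nth _ _ _ H2); exact H3. }
  pose (p := fun n => next (branch n)).
  assert (Hp : forall n, p = papp (fst (branch n)) (fun k => p (n + k))).
  { induction n as [|n IH]; [reflexivity|].
    rewrite IH at 1; simpl; rewrite papp_snoc; f_equal.
    extensionality k; destruct k; simpl; [rewrite Nat.add_0_r|rewrite Nat.add_succ_r]; reflexivity. }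
  assert (Hlen : forall n, length (fst (branch n)) = n).
  { induction n as [|n IH]; [reflexivity|]; simpl; rewrite length_app, IH; simpl; lia. }
  (* The statement starts from an arbitrary level [n] because [letter_at] consumes its path from the
     front, so that induction on [m] changes the starting letter. *)
  assert (Hlet : forall m n, letter_at (snd (branch n)) (fun k => p (n + k)) m = snd (branch (n + m))).
  { induction m as [|m IH]; intros n; [rewrite Nat.add_0_r; reflexivity|].
    rewrite Nat.add_succ_r; change (S (n + m)) with (S n + m); rewrite <- (IH (S n)); simpl.
    rewrite Nat.add_0_r; unfold p at 1; f_equal.
    - destruct (Hnext _ (Hbad n)) as (b & w & H1 & H2 & H3).
      rewrite (children_rel _ _ H1); rewrite !(nth_error_nth _ _ _ H2); reflexivity.
    - extensionality k; unfold ptail; f_equal; lia. }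
  assert (Hokp : ok x p).
  { intros n; specialize (Hlet n 0); simpl in Hlet.
    change (letter_at x p n = snd (branch n)) in Hlet; rewrite Hlet.
    destruct (Hnext _ (Hbad n)) as (b & w & H1 & H2 & H3); rewrite (children_rel _ _ H1).
    apply nth_error_Some; unfold p; congruence. }
  destruct (Hbar p Hokp) as (al & a & q & H1 & H2 & H3).
  pose proof (Hp (length al)) as H4; rewrite H2 in H4 at 1.
  assert (E : al = fst (branch (length al))).
  { destruct (papp_comparable _ _ _ _ H4) as [ga [[E _]|[E _]]];
      pose proof (f_equal (@length nat) E) as L; rewrite length_app, Hlen in L;
      destruct ga; simpl in L; try lia; rewrite app_nil_r in E; auto. }
  destruct (Hbad (length al)) as [_ Hb]; apply Hb, bar_good; rewrite <- E; exact H3.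
Qed.

Lemma in_concat_seq {T : Type} (F : nat -> list T) (w : list Sigma) (c : T) :
  In c (concat (map F (seq 0 (length w)))) <->
  exists i b, nth_error w i = Some b /\ In c (F i).
Proof.
  rewrite <- flat_map_concat_map, in_flat_map; split.
  - intros (i & Hi & Hc); apply in_seq in Hi.
    destruct (nth_error w i) as [b|] eqn:E; [eauto|apply nth_error_None in E; lia].
  - intros (i & b & Hi & Hc); exists i; split; [|exact Hc].
    apply in_seq; assert (i < length w) by (apply nth_error_Some; congruence); lia.
Qed.

(** Lists attached to the good nodes are concatenated along the tree. It serves both for finite
    subcovers and for finite tables of prefix pairs. *)
Lemma barred_list {T : Type} (good : list nat -> Prop) (P : list nat -> Sigma -> list T -> Prop) :
  (forall al a, good al -> exists l, P al a l) ->
  (forall al a w F, Rel [a] w ->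
     (forall i b, nth_error w i = Some b -> P (al ++ [i]) b (F i)) ->
     P al a (concat (map F (seq 0 (length w))))) ->
  forall al a, barred good al a -> exists l, P al a l.
Proof.
  intros Hgood Hsplit; induction 1 as [al a H|al a w Hr _ IH]; [auto|].
  assert (H : forall i, exists l, forall b, nth_error w i = Some b -> P (al ++ [i]) b l).
  (* Indices beyond [w] get an empty list, so that one list can be chosen for each natural
     number. *)
  { intros i; destruct (nth_error w i) as [b|] eqn:E; [|exists []; discriminate].
    destruct (IH i b E) as [l Hl]; exists l; intros b' [= <-]; exact Hl. }
  eexists; apply (Hsplit al a w (fun i => proj1_sig (constructive_indefinite_description _ (H i))) Hr).
  intros i; destruct constructive_indefinite_description as [l Hl]; exact Hl.
Qed.

End Paths.

(** * Diagrams as maps of paths *)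

Lemma NoDup_app_iff {A : Type} (l l' : list A) :
  NoDup (l ++ l') <-> NoDup l /\ NoDup l' /\ (forall a, In a l -> In a l' -> False).
Proof.
  split.
  - intros H; split; [eapply NoDup_app_remove_r; eauto|split; [eapply NoDup_app_remove_l; eauto|]].
    induction l as [|b l IH]; simpl in *; [tauto|].
    inversion H as [|? ? Hb Hl]; subst; intros a [<-|Ha] Ha'; [|eapply IH; eauto].
    apply Hb, in_or_app; auto.
  - intros (H1 & H2 & H3); apply NoDup_app; eauto.
Qed.

Lemma in_concat_map {A B : Type} (f : A -> list B) (l : list A) (b : B) :
  In b (concat (map f l)) <-> exists a, In a l /\ In b (f a).
Proof. rewrite <- flat_map_concat_map; apply in_flat_map. Qed.

Lemma NoDup_concat_map {A B : Type} (f : A -> list B) (l : list A) :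
  NoDup l ->
  NoDup (concat (map f l)) <->
  (forall a, In a l -> NoDup (f a)) /\
  (forall a a' b, In a l -> In a' l -> In b (f a) -> In b (f a') -> a = a').
Proof.
  induction 1 as [|a l Ha Hl IH]; simpl.
  - split; [intros; split; intros; contradiction|intros; constructor].
  - rewrite NoDup_app_iff, IH; split.
    + intros (H1 & (H2 & H3) & H4); split.
      * intros a' [<-|Ha']; auto.
      * intros a1 a2 b [<-|H5] [<-|H6] Hb1 Hb2; eauto; exfalso; eapply H4; eauto;
          apply in_concat_map; eauto.
    + intros [H1 H2]; split; [auto|split; [split; [auto|eauto]|]].
      intros b Hb Hb'; apply in_concat_map in Hb' as (a' & H5 & H6).
      apply Ha; rewrite (H2 a a' b); auto.
Qed.

Lemma map_singleton_inv {A B : Type} (f : A -> B) (l : list A) (b : B) :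
  map f l = [b] -> exists a, l = [a] /\ f a = b.
Proof. destruct l as [|a [|]]; simpl; intros H; try discriminate; injection H; eauto. Qed.

(** A descending chain in an acyclic relation never repeats an element, hence is no longer than
    [l]. *)
Lemma acyclic_acc (R : nat -> nat -> Prop) (l : list nat) :
  (forall a b, R a b -> In a l /\ In b l) -> (forall a, ~ clos_trans nat R a a) ->
  forall a, Acc R a.
Proof.
  intros Hl Hirr.
  (* [visited] is the chain already descended, and [n] bounds the number of elements of [l] still
     outside it. *)
  assert (H : forall n visited a, NoDup visited -> incl visited l -> In a l ->
            (forall b, In b visited -> clos_trans nat R a b) ->
            length l <= length visited + n -> Acc R a).
  { induction n as [|n IH]; intros visited a H1 H2 H3 H4 H5.
    - assert (length (a :: visited) <= length l); [|simpl in *; lia].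
      apply NoDup_incl_length; [|apply incl_cons; auto].
      constructor; [|auto]; intros Ha; exact (Hirr _ (H4 _ Ha)).
    - constructor; intros b Hb; apply (IH (a :: visited)).
      + constructor; [|auto]; intros Ha; exact (Hirr _ (H4 _ Ha)).
      + apply incl_cons; auto.
      + exact (proj1 (Hl _ _ Hb)).
      + intros c [<-|Hc]; [apply t_step, Hb|eapply t_trans; [apply t_step, Hb|auto]].
      + simpl; lia. }
  intros a; constructor; intros b Hb.
  apply (H (length l) []); simpl; auto using NoDup_nil, incl_nil_l; try tauto.
  exact (proj1 (Hl _ _ Hb)).
Qed.

Lemma subst_notin (src tgt : list nat) (j : nat) : ~ In j src -> subst src tgt j = j.
Proof.
  revert tgt; induction src as [|a src IH]; intros [|b tgt] H; simpl in *; auto.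
  destruct (Nat.eqb_spec j a); [subst; tauto|apply IH; tauto].
Qed.

Lemma subst_nth (src tgt : list nat) (i j k : nat) :
  NoDup src -> nth_error src i = Some j -> nth_error tgt i = Some k -> subst src tgt j = k.
Proof.
  revert tgt i; induction src as [|a src IH]; intros [|b tgt] [|i] H H1 H2; simpl in *; try discriminate.
  - injection H1 as ->; injection H2 as ->; rewrite Nat.eqb_refl; reflexivity.
  - inversion H as [|? ? H3 H4]; subst; destruct (Nat.eqb_spec j a) as [->|]; [|eauto].
    apply nth_error_In in H1; contradiction.
Qed.

Lemma in_nth_error2 {A B C : Type} (f : A -> C) (g : B -> C) (l : list A) (l' : list B) (a : A) :
  map f l = map g l' -> In a l -> exists i b, nth_error l i = Some a /\ nth_error l' i = Some b.
Proof.
  intros H Ha; apply In_nth_error in Ha as [i Hi]; exists i.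
  apply (f_equal (@length C)) in H; rewrite !length_map in H.
  destruct (nth_error l' i) as [b|] eqn:E; [eauto|].
  apply nth_error_None in E; assert (i < length l) by (apply nth_error_Some; congruence); lia.
Qed.

Section DiagramFacts.
Context {Sigma : Type} (Rel : list Sigma -> list Sigma -> Prop) (TL : tree_like Rel).

(** The diagram upside down. It represents the inverse element and turns every lemma on splits into
    one on merges. *)
Definition flip (D : diagram Sigma) : diagram Sigma :=
  mkDiagram (dlab D) (dbot D) (dtop D) (dtrs D) (tbot D) (ttop D).

Lemma clos_trans_flip (D : diagram Sigma) (t t' : nat) :
  clos_trans nat (tprec (flip D)) t t' -> clos_trans nat (tprec D) t' t.
Proof.
  induction 1 as [t t' (H1 & H2 & j & H3 & H4)|t s t' _ IH1 _ IH2].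
  - apply t_step; repeat split; auto; exists j; auto.
  - eapply t_trans; eauto.
Qed.

Lemma valid_flip (u w : list Sigma) (D : diagram Sigma) :
  valid Rel u w D -> valid Rel w u (flip D).
Proof.
  intros (H1 & H2 & H3 & H4 & H5 & H6 & H7 & H8 & H9).
  repeat split; auto; try (apply H4).
  - change (wire_bots D <> []); intros E.
    destruct (wire_tops D) as [|j l] eqn:F; [tauto|].
    specialize (H4 j); rewrite E in H4; simpl in H4; tauto.
  - intros t Ht; destruct (H8 t Ht); auto.
  - intros t Ht; exact (H9 _ (clos_trans_flip _ _ _ Ht)).
Qed.

Lemma in_tops (D : diagram Sigma) (j : nat) :
  In j (wire_tops D) <-> In j (dtop D) \/ exists t, In t (dtrs D) /\ In j (tbot D t).
Proof. unfold wire_tops; rewrite in_app_iff, in_concat_map; tauto. Qed.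

Lemma in_bots (D : diagram Sigma) (j : nat) :
  In j (wire_bots D) <-> In j (dbot D) \/ exists t, In t (dtrs D) /\ In j (ttop D t).
Proof. apply (in_tops (flip D)). Qed.

Section Valid.
Context {u w : list Sigma} {D : diagram Sigma} (V : valid Rel u w D).

Lemma tops_bots (j : nat) : In j (wire_tops D) <-> In j (wire_bots D).
Proof. apply V. Qed.

Lemma tbot_unique (t t' j : nat) :
  In t (dtrs D) -> In t' (dtrs D) -> In j (tbot D t) -> In j (tbot D t') -> t = t'.
Proof.
  destruct V as (H1 & H2 & _); unfold wire_tops in H2.
  rewrite NoDup_app_iff, NoDup_concat_map in H2 by exact H1; intros; eapply H2; eauto.
Qed.

Lemma tbot_NoDup (t : nat) : In t (dtrs D) -> NoDup (tbot D t).
Proof.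
  destruct V as (H1 & H2 & _); unfold wire_tops in H2.
  rewrite NoDup_app_iff, NoDup_concat_map in H2 by exact H1; intros; apply H2; auto.
Qed.

Lemma dtop_not_tbot (t j : nat) : In j (dtop D) -> In t (dtrs D) -> ~ In j (tbot D t).
Proof.
  destruct V as (H1 & H2 & _); unfold wire_tops in H2.
  rewrite NoDup_app_iff in H2; intros Hj Ht Hjt.
  eapply H2; [exact Hj|]; apply in_concat_map; eauto.
Qed.

(** Induction towards the top of the frame: the induction hypothesis concerns the transistors
    directly above [t]. Applied to [flip D] it is induction downwards. *)
Lemma up_acc (t : nat) : Acc (fun t2 t1 => tprec D t1 t2) t.
Proof.
  apply (acyclic_acc _ (dtrs D)).
  - intros a b (H1 & H2 & _); auto.
  - intros a Ha; apply (clos_trans_transp_permute nat (tprec D)) in Ha.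
    destruct V as (_ & _ & _ & _ & _ & _ & _ & _ & H9); exact (H9 a Ha).
Qed.

Lemma tbot_wire (t j : nat) : In t (dtrs D) -> In j (tbot D t) -> In j (wire_tops D).
Proof. intros; apply in_tops; eauto. Qed.

Lemma ttop_wire (t j : nat) : In t (dtrs D) -> In j (ttop D t) -> In j (wire_tops D).
Proof. intros; apply tops_bots, in_bots; eauto. Qed.

Lemma trans_rel (t : nat) : In t (dtrs D) ->
  (exists k, ttop D t = [k] /\ Rel [dlab D k] (map (dlab D) (tbot D t))) \/
  (exists k, tbot D t = [k] /\ Rel [dlab D k] (map (dlab D) (ttop D t))).
Proof.
  intros Ht; destruct V as (_ & _ & _ & _ & _ & _ & _ & H & _).
  destruct (H t Ht) as [K|K]; [left|right];
    destruct (rel_inv Rel TL _ _ K) as (a & E & _);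
    destruct (map_singleton_inv _ _ _ E) as (k & Ek & Ea); exists k; split; auto;
    rewrite E in K; rewrite Ea; exact K.
Qed.

End Valid.

(* [step D t j p k q]: the point [p] of the wire [j] below the transistor [t] is
   carried upwards through [t] to the point [q] of the wire [k]. *)
Inductive step (D : diagram Sigma) (t : nat) : nat -> point -> nat -> point -> Prop :=
| step_split i j k p :
    ttop D t = [k] -> Rel [dlab D k] (map (dlab D) (tbot D t)) ->
    nth_error (tbot D t) i = Some j -> step D t j p k (pcons i p)
| step_merge i j k p :
    tbot D t = [j] -> Rel [dlab D j] (map (dlab D) (ttop D t)) ->
    nth_error (ttop D t) i = Some k -> step D t j (pcons i p) k p.

(** The iteration of [step] up to the single wire at the top of the frame. As an inductive relation
    it makes sense for every diagram; totality is proved for valid ones by [up_acc]. *)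
Inductive flow (D : diagram Sigma) : nat -> point -> point -> Prop :=
| flow_top j p : dtop D = [j] -> flow D j p p
| flow_step t j p k p' q : In t (dtrs D) -> step D t j p k p' -> flow D k p' q -> flow D j p q.

Lemma step_flip (D : diagram Sigma) (t j k : nat) (p q : point) :
  step D t j p k q -> step (flip D) t k q j p.
Proof. destruct 1; [apply step_merge|apply step_split]; assumption. Qed.

Lemma step_in (D : diagram Sigma) (t j k : nat) (p q : point) :
  step D t j p k q -> In j (tbot D t) /\ In k (ttop D t).
Proof.
  destruct 1 as [i j k p H1 H2 H3|i j k p H1 H2 H3]; rewrite H1; simpl;
    apply nth_error_In in H3; auto.
Qed.

(** Stated for an arbitrary renaming of wires so as to cover isomorphisms and both factors of a
    concatenation. *)
Lemma step_map (D D' : diagram Sigma) (t t' : nat) (sig : nat -> nat) (j k : nat) (p q : point) :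
  ttop D' t' = map sig (ttop D t) -> tbot D' t' = map sig (tbot D t) ->
  (forall i, In i (ttop D t) \/ In i (tbot D t) -> dlab D' (sig i) = dlab D i) ->
  step D t j p k q -> step D' t' (sig j) p (sig k) q.
Proof.
  intros E1 E2 Hlab.
  assert (M1 : map (dlab D') (ttop D' t') = map (dlab D) (ttop D t))
    by (rewrite E1, map_map; apply map_ext_in; auto).
  assert (M2 : map (dlab D') (tbot D' t') = map (dlab D) (tbot D t))
    by (rewrite E2, map_map; apply map_ext_in; auto).
  destruct 1 as [i j k p H1 H2 H3|i j k p H1 H2 H3]; [apply step_split|apply step_merge].
  - rewrite E1, H1; reflexivity.
  - rewrite M2, Hlab by (rewrite H1; simpl; auto); exact H2.
  - rewrite E2; apply map_nth_error; exact H3.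
  - rewrite E2, H1; reflexivity.
  - rewrite M1, Hlab by (rewrite H1; simpl; auto); exact H2.
  - rewrite E1; apply map_nth_error; exact H3.
Qed.

Lemma step_ok (D : diagram Sigma) (t j k : nat) (p q : point) :
  step D t j p k q -> ok Rel (dlab D j) p <-> ok Rel (dlab D k) q.
Proof.
  destruct 1 as [i j k p H1 H2 H3|i j k p H1 H2 H3];
    pose proof (ok_cons_rel Rel TL _ _ _ _ p H2 (map_nth_error (dlab D) _ _ H3)); tauto.
Qed.

Lemma step_total (u w : list Sigma) (D : diagram Sigma) (t j : nat) (p : point) :
  valid Rel u w D -> In t (dtrs D) -> In j (tbot D t) -> ok Rel (dlab D j) p ->
  exists k q, step D t j p k q.
Proof.
  intros V Ht Hj Hp; destruct (trans_rel V t Ht) as [(k & H1 & H2)|(k & H1 & H2)].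
  - apply In_nth_error in Hj as [i Hi]; exists k, (pcons i p); apply step_split; auto.
  - rewrite H1 in Hj; destruct Hj as [->|[]].
    destruct (ok_inv Rel TL _ _ _ H2 Hp) as (i & b & q & -> & Hi & _).
    destruct (nth_error (ttop D t) i) as [m|] eqn:E.
    + exists m, q; apply step_merge; auto.
    + apply nth_error_None in E; assert (i < length (map (dlab D) (ttop D t)))
        by (apply nth_error_Some; congruence); rewrite length_map in *; lia.
Qed.

Lemma split_merge_false (D : diagram Sigma) (t j k : nat) :
  ttop D t = [k] -> Rel [dlab D k] (map (dlab D) (tbot D t)) -> tbot D t = [j] -> False.
Proof. intros _ H1 H2; apply (rel_length Rel TL) in H1; rewrite H2 in H1; simpl in H1; lia. Qed.

Lemma step_det (u w : list Sigma) (D : diagram Sigma) (t j k k' : nat) (p q q' : point) :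
  valid Rel u w D -> In t (dtrs D) ->
  step D t j p k q -> step D t j p k' q' -> k = k' /\ q = q'.
Proof.
  intros V Ht H H'; pose proof (tbot_NoDup V t Ht) as N.
  inversion H as [i j1 k1 p1 H1 H2 H3|i j1 k1 p1 H1 H2 H3]; subst;
  inversion H' as [i' j2 k2 p2 H4 H5 H6|i' j2 k2 p2 H4 H5 H6]; subst.
  - assert (i = i') as <-; [|split; congruence].
    eapply (proj1 (NoDup_nth_error _) N); [apply nth_error_Some; congruence|congruence].
  - exfalso; eapply split_merge_false; eauto.
  - exfalso; eapply split_merge_false; eauto.
  - match goal with E : pcons _ _ = pcons _ _ |- _ => apply pcons_inj in E as [<- <-] end.
    split; congruence.
Qed.

Lemma flow_wire (u w : list Sigma) (D : diagram Sigma) (j : nat) (p q : point) :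
  valid Rel u w D -> flow D j p q -> In j (wire_tops D).
Proof.
  intros V; destruct 1 as [j p H|t j p k p' q Ht H _]; apply in_tops.
  - left; rewrite H; simpl; auto.
  - right; exists t; split; [exact Ht|apply (step_in _ _ _ _ _ _ H)].
Qed.

(** * The upward flow in a diagram with one top wire and one bottom wire *)

Section OneOne.
Context {x : Sigma} {D : diagram Sigma} (V : valid Rel [x] [x] D).

Lemma valid_dtop : exists j, dtop D = [j] /\ dlab D j = x.
Proof. apply map_singleton_inv, V. Qed.

Lemma valid_dbot : exists j, dbot D = [j] /\ dlab D j = x.
Proof. apply map_singleton_inv, V. Qed.

Lemma flow_total (j : nat) (p : point) :
  In j (wire_tops D) -> ok Rel (dlab D j) p -> exists q, flow D j p q.
Proof.
  assert (Ht : forall t, In t (dtrs D) -> forall j p, In j (tbot D t) ->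
           ok Rel (dlab D j) p -> exists q, flow D j p q).
  { intros t; induction (up_acc V t) as [t _ IH]; intros Ht k q Hk Hq.
    destruct (step_total _ _ _ _ _ _ V Ht Hk Hq) as (k' & q' & Hs).
    pose proof (proj1 (step_ok _ _ _ _ _ _ Hs) Hq) as Hok.
    destruct (step_in _ _ _ _ _ _ Hs) as [_ Hk'].
    assert (Hw : In k' (wire_tops D)) by (eapply ttop_wire; eauto).
    assert (exists r, flow D k' q' r) as [r Hr].
    { apply in_tops in Hw as [Hw|(t' & Ht' & Hw)].
      - exists q'; destruct valid_dtop as (j0 & H0 & _); rewrite H0 in Hw.
        destruct Hw as [->|[]]; apply flow_top; exact H0.
      - apply (IH t'); auto; repeat split; eauto. }
    exists r; eapply flow_step; eauto. }
  intros Hw Hp; apply in_tops in Hw as [Hw|(t & Ht' & Hw)]; [|eauto].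
  exists p; destruct valid_dtop as (j0 & H0 & _); rewrite H0 in Hw.
  destruct Hw as [->|[]]; apply flow_top; exact H0.
Qed.

Lemma flow_det (j : nat) (p q q' : point) : flow D j p q -> flow D j p q' -> q = q'.
Proof.
  induction 1 as [j p H|t j p k p' q Ht H _ IH]; intros H'.
  - inversion H' as [j1 p1 H1|t j1 p1 k p2 q1 Ht H1 _]; subst; [reflexivity|exfalso].
    apply step_in in H1 as [H1 _]; eapply (dtop_not_tbot V); eauto; rewrite H; simpl; auto.
  - inversion H' as [j1 p1 H1|t' j1 p1 k' p2 q1 Ht' H1 H2]; subst.
    + exfalso; apply step_in in H as [H _]; eapply (dtop_not_tbot V); eauto; rewrite H1; simpl; auto.
    + assert (t = t') as <-.
      { apply step_in in H as [H _], H1 as [H1 _]; eapply (tbot_unique V); eauto. }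
      destruct (step_det _ _ _ _ _ _ _ _ _ _ V Ht H H1) as [<- <-]; auto.
Qed.

(** The upward flow is retraced: each of its steps, turned round, is put in front of the downward
    flow that starts at the wire [j]. *)
Lemma flow_flip (j : nat) (p q r : point) :
  flow D j p q -> flow (flip D) j p r -> forall k, dtop D = [k] -> flow (flip D) k q r.
Proof.
  induction 1 as [j p H|t j p k p' q Ht H _ IH]; intros Hr k' Hk'.
  - congruence.
  - apply IH; [|exact Hk'].
    eapply flow_step; [exact Ht|apply step_flip; exact H|exact Hr].
Qed.

(** Only finitely many indices are read or written on the way up, so the tail [r] is carried along
    unchanged and may be replaced by any other. *)
Lemma flow_local (j : nat) (p q : point) :
  flow D j p q -> exists al be a r,
    walk Rel (dlab D j) al a /\ walk Rel x be a /\ p = papp al r /\ q = papp be r /\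
    forall r', flow D j (papp al r') (papp be r').
Proof.
  destruct valid_dtop as (j0 & H0 & Hx).
  induction 1 as [j p H|t j p k p' q Ht H _ IH].
  - exists [], [], x, p; assert (j = j0) as -> by congruence; rewrite Hx.
    repeat split; try constructor; exact H.
  - destruct IH as (al & be & a & r & H1 & H2 & H3 & H4 & H5).
    destruct H as [i j k p H6 H7 H8|i j k p H6 H7 H8];
      pose proof (map_nth_error (dlab D) _ _ H8) as H9.
    (* A split writes the index [i]. If the flow above reads it again, it is the head of [al] and
       cancels; if nothing more is read, it becomes the last letter of [be]. *)
    + destruct al as [|i' al]; simpl in H3.
      * apply walk_nil_inv in H1; subst.
        exists [], (be ++ [i]), (dlab D j), p; repeat split.
        -- constructor.
        -- eapply walk_snoc; eauto.
        -- rewrite papp_snoc; reflexivity.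
        -- intros r'; simpl; rewrite papp_snoc.
           eapply flow_step; [exact Ht|apply step_split; eauto|]; exact (H5 (pcons i r')).
      * apply pcons_inj in H3 as [<- ->].
        apply walk_cons_inv in H1 as (w & b & K1 & K2 & K3).
        rewrite (rel_det Rel TL _ _ _ K1 H7), H9 in K2; injection K2 as <-.
        exists al, be, a, r; repeat split; auto.
        intros r'; eapply flow_step; [exact Ht|apply step_split; eauto|]; exact (H5 r').
    + exists (i :: al), be, a, r; repeat split; auto.
      * econstructor; eauto.
      * subst; reflexivity.
      * intros r'; eapply flow_step; [exact Ht|apply step_merge; eauto|]; exact (H5 r').
Qed.

End OneOne.

Definition sem (D : diagram Sigma) (p q : point) : Prop :=
  exists b, dbot D = [b] /\ flow D b p q.

Section Sem.
Context {x : Sigma} {D : diagram Sigma} (V : valid Rel [x] [x] D).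

Lemma sem_det (p q q' : point) : sem D p q -> sem D p q' -> q = q'.
Proof.
  intros (b & H1 & H2) (b' & H3 & H4); assert (b = b') as <- by congruence.
  eapply (flow_det V); eauto.
Qed.

Lemma sem_local (p q : point) : sem D p q -> exists al be a r,
  walk Rel x al a /\ walk Rel x be a /\ p = papp al r /\ q = papp be r /\
  forall r', sem D (papp al r') (papp be r').
Proof.
  intros (b & H1 & H2); destruct (flow_local V _ _ _ H2) as (al & be & a & r & H3 & H4 & H5 & H6 & H7).
  destruct (valid_dbot V) as (b' & H8 & H9); assert (b = b') as <- by congruence.
  rewrite H9 in H3; exists al, be, a, r; repeat split; auto; intros r'; exists b; auto.
Qed.

Lemma sem_ok (p q : point) : sem D p q -> ok Rel x p <-> ok Rel x q.
Proof.
  intros H; destruct (sem_local _ _ H) as (al & be & a & r & H1 & H2 & -> & -> & _).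
  rewrite (ok_papp Rel TL _ _ _ r H1), (ok_papp Rel TL _ _ _ r H2); tauto.
Qed.

Lemma sem_total (p : point) : ok Rel x p -> exists q, sem D p q.
Proof.
  intros Hp; destruct (valid_dbot V) as (b & H1 & H2).
  destruct (flow_total V b p) as [q Hq].
  - apply (tops_bots V), in_bots; left; rewrite H1; simpl; auto.
  - rewrite H2; exact Hp.
  - exists q, b; auto.
Qed.

Lemma sem_flip (p q : point) : sem D p q -> sem (flip D) q p.
Proof.
  intros (b & H1 & H2); destruct (valid_dtop V) as (j & H3 & _); exists j; split; [exact H3|].
  eapply (flow_flip); eauto; apply flow_top; exact H1.
Qed.

End Sem.

(** Injectivity is determinism of the flipped diagram, and surjectivity below is its totality. *)
Lemma sem_inj (x : Sigma) (D : diagram Sigma) (p p' q : point) :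
  valid Rel [x] [x] D -> sem D p q -> sem D p' q -> p = p'.
Proof.
  intros V H1 H2; apply (sem_det (valid_flip _ _ _ V) q); apply (sem_flip V); assumption.
Qed.

Lemma sem_surj (x : Sigma) (D : diagram Sigma) (q : point) :
  valid Rel [x] [x] D -> ok Rel x q -> exists p, sem D p q.
Proof.
  intros V H; destruct (sem_total (valid_flip _ _ _ V) q H) as [p Hp]; exists p.
  apply (sem_flip (valid_flip _ _ _ V)) in Hp; destruct D; exact Hp.
Qed.

End DiagramFacts.

(** * Isomorphic diagrams and concatenation *)

Section Invariance.
Context {Sigma : Type} (Rel : list Sigma -> list Sigma -> Prop) (TL : tree_like Rel).

Lemma list_max_ge (l : list nat) (n : nat) : In n l -> n <= list_max l.
Proof.
  intros H; pose proof (proj1 (list_max_le l (list_max l)) (le_n _)) as F.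
  rewrite Forall_forall in F; auto.
Qed.

Lemma iso_sem (x : Sigma) (D D' : diagram Sigma) (p q : point) :
  valid Rel [x] [x] D -> diag_iso D D' -> sem Rel D p q -> sem Rel D' p q.
Proof.
  intros V (sig & tau & _ & _ & _ & _ & Htau & Hlab & Htop & Hbot & Hts).
  assert (Hflow : forall j p q, flow Rel D j p q -> flow Rel D' (sig j) p q).
  { induction 1 as [j r H|t j r k r' s Ht H _ IH].
    - apply flow_top; rewrite <- Htop, H; reflexivity.
    - apply (flow_step _ _ (tau t) _ _ (sig k) r'); auto.
      apply (step_map Rel D D' t); auto; try apply (Hts t Ht).
      intros i [Hi|Hi]; apply Hlab; [eapply ttop_wire|eapply tbot_wire]; eauto. }
  intros (b & H1 & H2); exists (sig b); split; [rewrite <- Hbot, H1; reflexivity|auto].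
Qed.

Section Concat.
Context {x : Sigma} {D1 D2 : diagram Sigma}
  (V1 : valid Rel [x] [x] D1) (V2 : valid Rel [x] [x] D2).

Let SW := S (list_max (wire_tops D1)).
Let ST := S (list_max (dtrs D1)).
Let C := concat_diag D1 D2.
Let f2 := fun j => if existsb (Nat.eqb j) (dtop D2)
                     then subst (dtop D2) (dbot D1) j else (SW + j)%nat.

Lemma concat_wire_lt (j : nat) : In j (wire_tops D1) -> j < SW.
Proof. intros H; apply list_max_ge in H; unfold SW; lia. Qed.

Lemma concat_trans_lt (t : nat) : In t (dtrs D1) -> t < ST.
Proof. intros H; apply list_max_ge in H; unfold ST; lia. Qed.

(** With one-letter boundary words exactly one wire is glued: [a] receives the name [b], and all
    other wires of [D2] are shifted past those of [D1]. *)
Lemma concat_rename (a b j : nat) : dtop D2 = [a] -> dbot D1 = [b] ->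
  f2 j = if Nat.eqb j a then b else SW + j.
Proof.
  intros H1 H2; unfold f2; rewrite H1, H2; simpl.
  destruct (Nat.eqb j a); reflexivity.
Qed.

Lemma concat_rename_inj (j k : nat) : f2 j = f2 k -> j = k.
Proof.
  destruct (valid_dtop _ V2) as (a & Ha & _); destruct (valid_dbot _ V1) as (b & Hb & _).
  rewrite !(concat_rename a b) by assumption.
  assert (Hlt : b < SW).
  { apply concat_wire_lt, (tops_bots _ V1), in_bots; rewrite Hb; simpl; auto. }
  destruct (Nat.eqb_spec j a), (Nat.eqb_spec k a); lia.
Qed.

Lemma concat_label1 (j : nat) : In j (wire_tops D1) -> dlab C j = dlab D1 j.
Proof.
  intros H; apply concat_wire_lt in H; simpl; fold SW.
  destruct (Nat.ltb_spec j SW); [reflexivity|lia].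
Qed.

Lemma concat_label2 (j : nat) : dlab C (f2 j) = dlab D2 j.
Proof.
  destruct (valid_dtop _ V2) as (a & Ha & La); destruct (valid_dbot _ V1) as (b & Hb & Lb).
  rewrite (concat_rename a b) by assumption; destruct (Nat.eqb_spec j a) as [->|_].
  - rewrite concat_label1; [congruence|].
    apply (tops_bots _ V1), in_bots; rewrite Hb; simpl; auto.
  - unfold C, concat_diag; cbn [dlab]; fold SW.
    destruct (Nat.ltb_spec (SW + j) SW); [lia|]; f_equal; lia.
Qed.

Lemma concat_ttop1 (t : nat) : In t (dtrs D1) -> ttop C t = ttop D1 t.
Proof.
  intros H; apply concat_trans_lt in H; simpl; fold ST.
  destruct (Nat.ltb_spec t ST); [reflexivity|lia].
Qed.

Lemma concat_tbot1 (t : nat) : In t (dtrs D1) -> tbot C t = tbot D1 t.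
Proof.
  intros H; apply concat_trans_lt in H; simpl; fold ST.
  destruct (Nat.ltb_spec t ST); [reflexivity|lia].
Qed.

Lemma concat_ttop2 (t : nat) : ttop C (ST + t) = map f2 (ttop D2 t).
Proof.
  unfold C, concat_diag; cbn [ttop]; fold ST; destruct (Nat.ltb_spec (ST + t) ST); [lia|].
  replace (ST + t - ST) with t by lia; reflexivity.
Qed.

Lemma concat_tbot2 (t : nat) : tbot C (ST + t) = map f2 (tbot D2 t).
Proof.
  unfold C, concat_diag; cbn [tbot]; fold ST; destruct (Nat.ltb_spec (ST + t) ST); [lia|].
  replace (ST + t - ST) with t by lia; reflexivity.
Qed.

Lemma in_concat_trans (t : nat) :
  In t (dtrs C) <-> In t (dtrs D1) \/ exists t', t = ST + t' /\ In t' (dtrs D2).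
Proof.
  simpl; fold ST; rewrite in_app_iff, in_map_iff.
  split; intros [H|(t' & H1 & H2)]; auto; right; exists t'; auto.
Qed.

Lemma concat_wire_tops :
  wire_tops C = wire_tops D1 ++ map f2 (concat (map (tbot D2) (dtrs D2))).
Proof.
  unfold wire_tops at 1; change (dtop C) with (dtop D1).
  change (dtrs C) with (dtrs D1 ++ map (Nat.add ST) (dtrs D2)).
  rewrite map_app, concat_app, app_assoc; unfold wire_tops; f_equal.
  - do 2 f_equal; apply map_ext_in, concat_tbot1.
  - rewrite map_map, concat_map, map_map; f_equal; apply map_ext; apply concat_tbot2.
Qed.

Lemma concat_wire_bots :
  wire_bots C = map f2 (dbot D2) ++ concat (map (ttop D1) (dtrs D1)) ++
                map f2 (concat (map (ttop D2) (dtrs D2))).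
Proof.
  unfold wire_bots at 1; change (dbot C) with (map f2 (dbot D2)).
  change (dtrs C) with (dtrs D1 ++ map (Nat.add ST) (dtrs D2)).
  rewrite map_app, concat_app; do 2 f_equal.
  - f_equal; apply map_ext_in, concat_ttop1.
  - rewrite map_map, concat_map, map_map; f_equal; apply map_ext; apply concat_ttop2.
Qed.

(** A chain going up from [D1] stays in [D1]; one going up from [D2] may pass into [D1] but cannot
    return. A cycle would therefore lie in one of the factors. *)
Lemma concat_tprec (t t' : nat) : clos_trans nat (tprec C) t t' ->
  (t < ST -> t' < ST /\ clos_trans nat (tprec D1) t t') /\
  (ST <= t -> t' < ST \/ (ST <= t' /\ clos_trans nat (tprec D2) (t - ST) (t' - ST))).
Proof.
  destruct (valid_dtop _ V2) as (a & Ha & _); destruct (valid_dbot _ V1) as (b & Hb & _).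
  induction 1 as [t t' (H1 & H2 & j & H3 & H4)|t s t' _ [A1 A2] _ [B1 B2]].
  - apply in_concat_trans in H1 as [H1|(t1 & -> & H1)];
      apply in_concat_trans in H2 as [H2|(t2 & -> & H2)].
    + pose proof (concat_trans_lt _ H1); pose proof (concat_trans_lt _ H2).
      rewrite concat_ttop1, concat_tbot1 in * by assumption.
      split; [|lia]; intros _; split; [assumption|]; apply t_step; repeat split; eauto.
    (* A wire from [D2] down into [D1] could only be the glued one, but its name in [D2] is the top
       wire [a], which hangs from the frame and not from a transistor. *)
    + exfalso; rewrite concat_ttop1 in H4 by assumption; rewrite concat_tbot2 in H3.
      apply in_map_iff in H3 as (k & <- & H3).
      assert (f2 k < SW) as Hk by (apply concat_wire_lt; eapply ttop_wire; eauto).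
      rewrite (concat_rename a b) in Hk by assumption.
      destruct (Nat.eqb_spec k a) as [->|]; [|lia].
      eapply (dtop_not_tbot _ V2); [|exact H2|exact H3]; rewrite Ha; simpl; auto.
    + pose proof (concat_trans_lt _ H2); split; [lia|auto].
    + split; [lia|]; intros _; right; split; [lia|].
      replace (ST + t1 - ST) with t1 by lia; replace (ST + t2 - ST) with t2 by lia.
      rewrite concat_ttop2 in H4; rewrite concat_tbot2 in H3.
      apply in_map_iff in H3 as (k & <- & H3); apply in_map_iff in H4 as (k' & E & H4).
      apply concat_rename_inj in E as ->; apply t_step; repeat split; eauto.
  - split.
    + intros Ht; destruct (A1 Ht) as [Hs A3]; destruct (B1 Hs) as [Ht' B3].
      split; [exact Ht'|eapply t_trans; eauto].
    + intros Ht; destruct (A2 Ht) as [Hs|[Hs A3]]; [left; apply B1, Hs|].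
      destruct (B2 Hs) as [Ht'|[Ht' B3]]; [auto|right; split; [exact Ht'|eapply t_trans; eauto]].
Qed.

Lemma valid_concat : valid Rel [x] [x] C.
Proof.
  destruct (valid_dtop _ V2) as (a & Ha & La); destruct (valid_dbot _ V1) as (b & Hb & Lb).
  assert (Hb1 : In b (wire_tops D1)) by (apply (tops_bots _ V1), in_bots; rewrite Hb; simpl; auto).
  pose proof V1 as (N1 & N2 & N3 & _ & N5 & N6 & _ & N8 & N9).
  pose proof V2 as (M1 & M2 & M3 & _ & M5 & M6 & M7 & M8 & M9).
  assert (Ia : ~ In a (concat (map (tbot D2) (dtrs D2)))).
  { unfold wire_tops in M2; rewrite Ha in M2; simpl in M2; inversion M2; assumption. }
  assert (Ib : ~ In b (concat (map (ttop D1) (dtrs D1)))).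
  { unfold wire_bots in N3; rewrite Hb in N3; simpl in N3; inversion N3; assumption. }
  assert (Hge : forall j, j <> a -> SW <= f2 j).
  { intros j Hj; rewrite (concat_rename a b) by assumption.
    destruct (Nat.eqb_spec j a); [contradiction|lia]. }
  assert (Hfa : f2 a = b) by (rewrite (concat_rename a b), Nat.eqb_refl by assumption; reflexivity).
  assert (Hbt : forall j, In j (concat (map (ttop D1) (dtrs D1))) -> In j (wire_tops D1) /\ j <> b).
  { intros j Hj; split; [|intros ->; contradiction].
    apply (tops_bots _ V1); unfold wire_bots; apply in_or_app; auto. }
  (* The wire [b] is missing from the first list because it occurs in the second one, as [f2 a]. *)
  assert (P : Permutation (wire_bots C)
                (concat (map (ttop D1) (dtrs D1)) ++ map f2 (wire_bots D2))).
  { rewrite concat_wire_bots; unfold wire_bots; rewrite map_app.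
    apply Permutation_app_swap_app. }
  split; [|split; [|split; [|split; [|split; [|split; [|split; [|split]]]]]]].
  - change (dtrs C) with (dtrs D1 ++ map (Nat.add ST) (dtrs D2)); apply NoDup_app_iff.
    split; [exact N1|split; [apply NoDup_map_NoDup_ForallPairs; [intros ? ? _ _; lia|exact M1]|]].
    intros t H1 H2; apply concat_trans_lt in H1; apply in_map_iff in H2 as (t' & <- & _); lia.
  - rewrite concat_wire_tops; apply NoDup_app_iff; split; [exact N2|split].
    + apply NoDup_map_NoDup_ForallPairs; [|eapply NoDup_app_remove_l; exact M2].
      intros j k _ _; apply concat_rename_inj.
    + intros j H1 H2; apply in_map_iff in H2 as (k & <- & H2).
      apply concat_wire_lt in H1; assert (k <> a) by (intros ->; contradiction).
      apply Hge in H; lia.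
  - apply (Permutation_NoDup (Permutation_sym P)), NoDup_app_iff; split; [|split].
    + eapply NoDup_app_remove_l; exact N3.
    + apply NoDup_map_NoDup_ForallPairs; [intros j k _ _; apply concat_rename_inj|exact M3].
    + intros j H1 H2; apply in_map_iff in H2 as (k & <- & H2).
      destruct (Hbt _ H1) as [H3 H4]; apply concat_wire_lt in H3.
      destruct (Nat.eq_dec k a) as [->|Hk]; [congruence|apply Hge in Hk; lia].
  - intros j; rewrite concat_wire_tops.
    rewrite (Permutation_in' eq_refl P), !in_app_iff, !in_map_iff.
    split.
    + intros [H|(k & <- & H)].
      * apply (tops_bots _ V1) in H; unfold wire_bots in H; rewrite Hb in H.
        destruct H as [<-|H]; [|auto].
        right; exists a; split; [exact Hfa|]; apply (tops_bots _ V2), in_tops.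
        rewrite Ha; simpl; auto.
      * right; exists k; split; [reflexivity|]; apply (tops_bots _ V2).
        unfold wire_tops; apply in_or_app; auto.
    + intros [H|(k & <- & H)].
      * left; apply Hbt, H.
      * apply (tops_bots _ V2) in H; unfold wire_tops in H; rewrite Ha in H.
        destruct H as [<-|H]; [rewrite Hfa; auto|right; exists k; auto].
  - rewrite concat_wire_tops; destruct (wire_tops D1); [tauto|discriminate].
  - change (map (dlab C) (dtop D1) = [x]); rewrite <- N6.
    apply map_ext_in; intros j Hj; apply concat_label1, in_tops; auto.
  - change (map (dlab C) (map f2 (dbot D2)) = [x]); rewrite <- M7, map_map.
    apply map_ext; apply concat_label2.
  - intros t Ht; apply in_concat_trans in Ht as [Ht|(t' & -> & Ht)].
    + rewrite concat_ttop1, concat_tbot1 by exact Ht.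
      rewrite (map_ext_in (dlab C) (dlab D1) (ttop D1 t)), (map_ext_in (dlab C) (dlab D1) (tbot D1 t)).
      * apply N8, Ht.
      * intros j Hj; apply concat_label1; eapply tbot_wire; eauto.
      * intros j Hj; apply concat_label1; eapply ttop_wire; eauto.
    + rewrite concat_ttop2, concat_tbot2, !map_map.
      rewrite !(map_ext (fun j => dlab C (f2 j)) (dlab D2)) by apply concat_label2.
      apply M8, Ht.
  - intros t Ht; apply concat_tprec in Ht as [H1 H2].
    destruct (Nat.lt_ge_cases t ST) as [H|H].
    + exact (N9 _ (proj2 (H1 H))).
    + destruct (H2 H) as [|[_ H3]]; [lia|exact (M9 _ H3)].
Qed.

(** The flow crosses [D2] first and enters [D1] through the glued wire [b]. *)
Lemma concat_sem (p q r : point) : sem Rel D2 p q -> sem Rel D1 q r -> sem Rel C p r.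
Proof.
  intros (b2 & H1 & H2) (b & Hb & H4).
  destruct (valid_dtop _ V2) as (a & Ha & _).
  assert (F1 : forall j p q, flow Rel D1 j p q -> flow Rel C j p q).
  { induction 1 as [j s H|t j s k s' s'' Ht H _ IH]; [apply flow_top; exact H|].
    apply (flow_step _ _ t _ _ k s'); [apply in_concat_trans; auto| |exact IH].
    apply (step_map Rel D1 C t t (fun j => j)); try rewrite map_id.
    - apply concat_ttop1, Ht.
    - apply concat_tbot1, Ht.
    - intros i [Hi|Hi]; apply concat_label1; [eapply ttop_wire|eapply tbot_wire]; eauto.
    - exact H. }
  assert (F2 : forall j p q, flow Rel D2 j p q -> forall r, flow Rel D1 b q r -> flow Rel C (f2 j) p r).
  { induction 1 as [j s H|t j s k s' s'' Ht H _ IH]; intros z Hz.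
    - assert (j = a) as -> by congruence.
      rewrite (concat_rename a b), Nat.eqb_refl by assumption; auto.
    - apply (flow_step _ _ (ST + t) _ _ (f2 k) s'); [apply in_concat_trans; eauto| |auto].
      apply (step_map Rel D2 C t (ST + t) f2); auto using concat_ttop2, concat_tbot2, concat_label2. }
  exists (f2 b2); split; [|eauto].
  change (map f2 (dbot D2) = [f2 b2]); rewrite H1; reflexivity.
Qed.

End Concat.

End Invariance.

(** * Reduction of dipoles *)

Section Reduction.
Context {Sigma : Type} (Rel : list Sigma -> list Sigma -> Prop) (TL : tree_like Rel).
Context {x : Sigma} {D : diagram Sigma} (V : valid Rel [x] [x] D) {t1 t2 : nat}
  (T1 : In t1 (dtrs D)) (T2 : In t2 (dtrs D)) (Hne : t1 <> t2) (Hprec : tprec D t1 t2)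
  (Hlab : map (dlab D) (tbot D t1) = map (dlab D) (ttop D t2))
  (Hmid : tbot D t2 = ttop D t1).

Let D' := reduce_dipole D t1 t2.
Let rho := subst (tbot D t1) (ttop D t2).
Let rest := filter (fun t => negb (Nat.eqb t t1 || Nat.eqb t t2)) (dtrs D).

Lemma in_rest (t : nat) : In t rest <-> In t (dtrs D) /\ t <> t1 /\ t <> t2.
Proof.
  unfold rest; rewrite filter_In; destruct (Nat.eqb_spec t t1), (Nat.eqb_spec t t2); simpl;
    intuition congruence.
Qed.

Lemma rest_permutation : Permutation (dtrs D) (t1 :: t2 :: rest).
Proof.
  destruct V as (N & _); apply NoDup_Permutation; [exact N| |].
  - constructor; [|constructor].
    + intros [H|H]; [congruence|]; apply in_rest in H; tauto.
    + intros H; apply in_rest in H; tauto.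
    + apply NoDup_filter, N.
  - intros t; simpl; rewrite in_rest.
    split; [|intros [<-|[<-|H]]; tauto].
    destruct (Nat.eq_dec t t1), (Nat.eq_dec t t2); auto 6.
Qed.

Lemma rho_notin (j : nat) : ~ In j (tbot D t1) -> rho j = j.
Proof. apply subst_notin. Qed.

Lemma rho_in (j : nat) : In j (tbot D t1) ->
  exists i, nth_error (tbot D t1) i = Some j /\ nth_error (ttop D t2) i = Some (rho j).
Proof.
  intros H; destruct (in_nth_error2 _ _ _ _ _ Hlab H) as (i & k & H1 & H2); exists i.
  split; [exact H1|]; rewrite H2; f_equal; symmetry.
  eapply subst_nth; eauto; eapply tbot_NoDup; eauto.
Qed.

Lemma rho_label (j : nat) : dlab D (rho j) = dlab D j.
Proof.
  destruct (in_dec Nat.eq_dec j (tbot D t1)) as [H|H]; [|rewrite rho_notin; auto].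
  destruct (rho_in j H) as (i & H1 & H2).
  apply (map_nth_error (dlab D)) in H1, H2; rewrite Hlab in H1; congruence.
Qed.

Lemma rho_labels (l : list nat) : map (dlab D) (map rho l) = map (dlab D) l.
Proof. rewrite map_map; apply map_ext, rho_label. Qed.

Lemma rho_inj_in (j k : nat) : In j (tbot D t1) -> In k (tbot D t1) -> rho j = rho k -> j = k.
Proof.
  intros H H' E; destruct (rho_in j H) as (i & H1 & H2); destruct (rho_in k H') as (i' & H3 & H4).
  assert (i = i') as <-; [|congruence].
  eapply (proj1 (NoDup_nth_error _) (tbot_NoDup Rel (valid_flip _ _ _ _ V) t2 T2)).
  - apply nth_error_Some; simpl; congruence.
  - simpl; congruence.
Qed.

Let new_tops := dtop D ++ concat (map (tbot D) rest).
Let old_bots := dbot D ++ concat (map (ttop D) rest).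

Lemma reduce_tops : Permutation (wire_tops D) (tbot D t1 ++ tbot D t2 ++ new_tops).
Proof.
  unfold wire_tops, new_tops.
  rewrite (Permutation_map (tbot D) rest_permutation); simpl.
  rewrite Permutation_app_swap_app; apply Permutation_app_head, Permutation_app_swap_app.
Qed.

Lemma reduce_bots : Permutation (wire_bots D) (ttop D t1 ++ ttop D t2 ++ old_bots).
Proof.
  unfold wire_bots, old_bots.
  rewrite (Permutation_map (ttop D) rest_permutation); simpl.
  rewrite Permutation_app_swap_app; apply Permutation_app_head, Permutation_app_swap_app.
Qed.

Lemma reduce_wire_bots : wire_bots D' = map rho old_bots.
Proof.
  unfold wire_bots, old_bots; rewrite map_app; simpl; f_equal.
  rewrite concat_map, map_map; reflexivity.
Qed.

(** Such a wire would put [t1] above [t2], which already lies above [t1]. *)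
Lemma top_bot_disjoint (j : nat) : In j (tbot D t1) -> In j (ttop D t2) -> False.
Proof.
  intros H1 H2; destruct V as (_ & _ & _ & _ & _ & _ & _ & _ & N); apply (N t1).
  eapply t_trans; apply t_step; [exact Hprec|]; repeat split; eauto.
Qed.

(** Two families of names disappear: the wires between [t2] and [t1], and the wires below [t1],
    which are absorbed by those above [t2] through [rho]. Acyclicity keeps the outer wires of the
    dipole apart. *)
Lemma reduce_wires (j : nat) : In j new_tops <-> In j (map rho old_bots).
Proof.
  destruct V as (_ & N2 & N3 & N4 & _).
  apply (Permutation_NoDup reduce_tops) in N2; apply (Permutation_NoDup reduce_bots) in N3.
  rewrite !NoDup_app_iff in N2, N3; destruct N2 as (_ & (_ & _ & A2) & A1), N3 as (_ & (_ & _ & B2) & B1).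
  assert (W : forall j, In j (tbot D t1) \/ In j (tbot D t2) \/ In j new_tops <->
                        In j (ttop D t1) \/ In j (ttop D t2) \/ In j old_bots).
  { intros k; specialize (N4 k).
    rewrite (Permutation_in' eq_refl reduce_tops), (Permutation_in' eq_refl reduce_bots) in N4.
    rewrite !in_app_iff in N4; exact N4. }
  rewrite in_map_iff; split.
  - intros H; destruct (proj1 (W j)) as [K|[K|K]]; [auto| | |].
    + exfalso; rewrite <- Hmid in K; eauto.
    + apply In_nth_error in K as [i Hi].
      destruct (nth_error (tbot D t1) i) as [k|] eqn:E.
      * exists k; assert (Hk : In k (tbot D t1)) by (eapply nth_error_In; eauto).
        split; [eapply subst_nth; eauto; eapply tbot_NoDup; eauto|].
        destruct (proj1 (W k)) as [K|[K|K]]; [auto| | |exact K].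
        -- exfalso; rewrite <- Hmid in K; apply (A1 k); auto; apply in_or_app; auto.
        -- exfalso; eapply top_bot_disjoint; eauto.
      * apply nth_error_None in E; apply (f_equal (@length _)) in Hlab; rewrite !length_map in Hlab.
        assert (i < length (ttop D t2)) by (apply nth_error_Some; congruence); lia.
    + exists j; split; [apply rho_notin; intros K'; apply (A1 j); auto; apply in_or_app; auto|exact K].
  - intros (k & <- & H).
    assert (Hk1 : ~ In k (ttop D t1)) by (intros K; apply (B1 k); auto; apply in_or_app; auto).
    destruct (in_dec Nat.eq_dec k (tbot D t1)) as [K|K].
    + destruct (rho_in k K) as (i & _ & Hi); apply nth_error_In in Hi.
      destruct (proj2 (W (rho k))) as [K'|[K'|K']]; [auto| | |exact K'].
      * exfalso; eapply top_bot_disjoint; eauto.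
      * exfalso; rewrite Hmid in K'; apply (B1 (rho k)); auto; apply in_or_app; auto.
    + rewrite rho_notin by exact K; destruct (proj2 (W k)) as [K'|[K'|K']]; auto; [tauto|].
      rewrite Hmid in K'; tauto.
Qed.

(** An edge of [D'] along a glued wire comes from the chain [t], [t1], [t2], [t'] in [D]. *)
Lemma reduce_tprec (t t' : nat) : clos_trans nat (tprec D') t t' -> clos_trans nat (tprec D) t t'.
Proof.
  induction 1 as [t t' (H1 & H2 & j & H3 & H4)|]; [|eapply t_trans; eauto].
  apply in_rest in H1, H2; destruct H1 as [H1 H1'], H2 as [H2 H2'].
  apply in_map_iff in H4 as (k & E & H4); fold rho in E; simpl in H3.
  destruct (in_dec Nat.eq_dec k (tbot D t1)) as [K|K].
  - destruct (rho_in k K) as (i & _ & Hi); rewrite E in Hi; apply nth_error_In in Hi.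
    apply t_trans with t1; [apply t_step; repeat split; eauto|].
    apply t_trans with t2; [apply t_step; exact Hprec|apply t_step; repeat split; eauto].
  - rewrite rho_notin in E by exact K; subst k; apply t_step; repeat split; eauto.
Qed.

Lemma valid_reduce : valid Rel [x] [x] D'.
Proof.
  pose proof V as (N1 & N2 & N3 & N4 & N5 & N6 & N7 & N8 & N9).
  apply (Permutation_NoDup reduce_tops) in N2; apply (Permutation_NoDup reduce_bots) in N3.
  rewrite !NoDup_app_iff in N2, N3.
  destruct (valid_dtop _ V) as (j0 & Hj0 & _).
  split; [|split; [|split; [|split; [|split; [|split; [|split; [|split]]]]]]].
  - apply NoDup_filter, N1.
  - apply N2.
  - rewrite reduce_wire_bots; apply NoDup_map_NoDup_ForallPairs; [|apply N3].
    destruct N3 as (_ & (_ & _ & B2) & B1).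
    intros j k Hj Hk E.
    destruct (in_dec Nat.eq_dec j (tbot D t1)) as [J|J], (in_dec Nat.eq_dec k (tbot D t1)) as [K|K].
    + apply rho_inj_in; assumption.
    + exfalso; rewrite (rho_notin k K) in E; destruct (rho_in j J) as (i & _ & Hi).
      rewrite E in Hi; apply nth_error_In in Hi; eauto.
    + exfalso; rewrite (rho_notin j J) in E; destruct (rho_in k K) as (i & _ & Hi).
      rewrite <- E in Hi; apply nth_error_In in Hi; eauto.
    + rewrite !rho_notin in E; assumption.
  - intros j; rewrite reduce_wire_bots; apply reduce_wires.
  - change (new_tops <> []); unfold new_tops; rewrite Hj0; discriminate.
  - exact N6.
  - change (map (dlab D) (map rho (dbot D)) = [x]); rewrite rho_labels; exact N7.
  - intros t Ht; apply in_rest in Ht as [Ht _].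
    change (Rel (map (dlab D) (map rho (ttop D t))) (map (dlab D) (tbot D t)) \/
            Rel (map (dlab D) (tbot D t)) (map (dlab D) (map rho (ttop D t)))).
    rewrite rho_labels; apply N8, Ht.
  - intros t Ht; exact (N9 _ (reduce_tprec _ _ Ht)).
Qed.

(** Crossing [t1] and then [t2] changes no point: either an index is prepended and removed again, or
    the first index is removed and put back. *)
Lemma flow_dipole (k : nat) (p q : point) :
  In k (tbot D t1) -> ok Rel (dlab D k) p -> flow Rel D (rho k) p q -> flow Rel D k p q.
Proof.
  intros Hk Hp Hf; destruct (rho_in k Hk) as (i & E1 & E2).
  destruct (trans_rel Rel TL V t1 T1) as [(m & K1 & K2)|(m & K1 & K2)].
  - apply (flow_step _ _ t1 _ _ m (pcons i p)); [exact T1|apply step_split; auto|].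
    apply (flow_step _ _ t2 _ _ (rho k) p); [exact T2|apply step_merge|exact Hf].
    + rewrite Hmid; exact K1.
    + rewrite <- Hlab; exact K2.
    + exact E2.
  - rewrite K1 in Hk; destruct Hk as [->|[]].
    destruct (ok_inv Rel TL _ _ _ K2 Hp) as (i' & b & p' & -> & Hi & _).
    assert (exists m, nth_error (ttop D t1) i' = Some m) as [m Hm].
    { destruct (nth_error (ttop D t1) i') eqn:E; [eauto|].
      apply nth_error_None in E; rewrite <- (length_map (dlab D)) in E.
      apply nth_error_None in E; congruence. }
    assert (Hrho : ttop D t2 = [rho k]).
    { pose proof (f_equal (@length _) Hlab) as L; rewrite !length_map, K1 in L; simpl in L.
      revert L E2; generalize (rho k) (ttop D t2); intros r [|r' [|]] L E2; try discriminate.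
      destruct i as [|[|]]; try discriminate; injection E2 as ->; reflexivity. }
    apply (flow_step _ _ t1 _ _ m p'); [exact T1|apply step_merge; auto|].
    apply (flow_step _ _ t2 _ _ (rho k) (pcons i' p')); [exact T2|apply step_split|exact Hf].
    + exact Hrho.
    + rewrite Hmid, rho_label; exact K2.
    + rewrite Hmid; exact Hm.
Qed.

Lemma flow_reduce (j : nat) (p q : point) :
  flow Rel D' j p q -> ok Rel (dlab D j) p -> flow Rel D j p q.
Proof.
  induction 1 as [j p H|t j p k p' q Ht H _ IH]; intros Hp; [apply flow_top; exact H|].
  apply in_rest in Ht as [Ht _].
  assert (exists k', k = rho k' /\ step Rel D t j p k' p') as (k' & -> & Hs).
  { destruct H as [i j k p H1 H2 H3|i j k p H1 H2 H3].
    - apply map_singleton_inv in H1 as (k' & H1 & <-); exists k'; split; [reflexivity|].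
      apply step_split; [exact H1| |exact H3].
      change (Rel [dlab D (rho k')] (map (dlab D) (tbot D t))) in H2.
      rewrite rho_label in H2; exact H2.
    - simpl in H3; rewrite nth_error_map in H3; destruct (nth_error (ttop D t) i) as [k'|] eqn:E;
        [|discriminate].
      injection H3 as <-; exists k'; split; [reflexivity|]; apply step_merge; [exact H1| |exact E].
      change (Rel [dlab D j] (map (dlab D) (map rho (ttop D t)))) in H2.
      rewrite rho_labels in H2; exact H2. }
  pose proof (proj1 (step_ok Rel TL _ _ _ _ _ _ Hs) Hp) as Hp'.
  apply (flow_step _ _ t _ _ k' p'); [exact Ht|exact Hs|].
  rewrite rho_label in IH; specialize (IH Hp').
  destruct (in_dec Nat.eq_dec k' (tbot D t1)) as [K|K].
  - apply flow_dipole; assumption.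
  - rewrite rho_notin in IH by exact K; exact IH.
Qed.

Lemma reduce_sem (p q : point) : ok Rel x p -> sem Rel D' p q -> sem Rel D p q.
Proof.
  intros Hp (b' & H1 & H2); apply map_singleton_inv in H1 as (b & Hb & <-); fold rho in H2.
  exists b; split; [exact Hb|].
  destruct (valid_dbot _ V) as (b' & E & Lb); assert (b = b') as <- by congruence.
  apply flow_reduce in H2; [|rewrite rho_label, Lb; exact Hp].
  destruct (in_dec Nat.eq_dec b (tbot D t1)) as [K|K].
  - apply flow_dipole; [exact K|rewrite Lb; exact Hp|exact H2].
  - rewrite rho_notin in H2 by exact K; exact H2.
Qed.

Lemma reduce_size : length (dtrs D') < length (dtrs D).
Proof. rewrite (Permutation_length rest_permutation); simpl; unfold rest; lia. Qed.

End Reduction.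

(** * Invariance of the map under the equivalence of diagrams *)

Section Deq.
Context {Sigma : Type} (Rel : list Sigma -> list Sigma -> Prop) (TL : tree_like Rel).
Context (x : Sigma).

Definition sem_eq (D D' : diagram Sigma) : Prop :=
  forall p q, ok Rel x p -> sem Rel D p q <-> sem Rel D' p q.

(** Both relations are total and functional on admissible paths, so an inclusion between them is an
    equality. This is why the invariance lemmas are proved in one direction. *)
Lemma sem_eq_of_incl (D D' : diagram Sigma) :
  valid Rel [x] [x] D -> valid Rel [x] [x] D' ->
  (forall p q, ok Rel x p -> sem Rel D p q -> sem Rel D' p q) -> sem_eq D D'.
Proof.
  intros V V' H p q Hp; split; [auto|intros Hq].
  destruct (sem_total Rel TL V p Hp) as [q' Hq'].
  rewrite (sem_det Rel TL V' p q q' Hq (H _ _ Hp Hq')); exact Hq'.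
Qed.

Lemma deq_sem (D D' : diagram Sigma) : deq Rel [x] D D' -> sem_eq D D'.
Proof.
  induction 1 as [D D' (V & V' & [H|H])| |D D' _ IH|D D' D'' _ IH _ IH'].
  - apply sem_eq_of_incl; auto; intros p q _; apply (iso_sem Rel x); auto.
  - destruct H as (t1 & t2 & H1 & H2 & H3 & H4 & H5 & H6 & ->).
    intros p q Hp; symmetry; revert p q Hp; apply sem_eq_of_incl; auto.
    intros p q; apply (reduce_sem Rel TL V); auto.
  - intros p q _; reflexivity.
  - intros p q Hp; symmetry; apply IH; exact Hp.
  - intros p q Hp; rewrite (IH p q Hp); apply IH'; exact Hp.
Qed.

Definition irreducible_diagram (D : diagram Sigma) : Prop := forall D', ~ reduces D D'.

(** Each reduction deletes two transistors, so their number is the induction measure. *)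
Lemma reduce_fully (D : diagram Sigma) : valid Rel [x] [x] D ->
  exists D', valid Rel [x] [x] D' /\ deq Rel [x] D D' /\ irreducible_diagram D'.
Proof.
  remember (length (dtrs D)) as n eqn:Hn; revert D Hn.
  induction n as [n IH] using Wf_nat.lt_wf_ind; intros D Hn V.
  destruct (classic (exists D', reduces D D')) as [[D' H]|H].
  - pose proof H as (t1 & t2 & H1 & H2 & H3 & H4 & H5 & H6 & E).
    pose proof (valid_reduce Rel V H1 H2 H3 H4 H5 H6) as V'.
    pose proof (reduce_size Rel V H1 H2 H3) as L; rewrite <- E in V', L.
    destruct (IH (length (dtrs D')) ltac:(lia) D' eq_refl V') as (D'' & K1 & K2 & K3).
    exists D''; split; [exact K1|split; [|exact K3]]; eapply rst_trans; [|exact K2].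
    apply rst_step; auto.
  - exists D; split; [exact V|split; [apply rst_refl|intros D' H'; eauto]].
Qed.

End Deq.

(** * Diagrams without dipoles *)

Lemma flip_flip {Sigma : Type} (D : diagram Sigma) : flip (flip D) = D.
Proof. destruct D; reflexivity. Qed.

Lemma irreducible_flip {Sigma : Type} (D : diagram Sigma) :
  irreducible_diagram D -> irreducible_diagram (flip D).
Proof.
  intros H D' (t1 & t2 & H1 & H2 & H3 & (_ & _ & j & H4 & H4') & H5 & H6 & _).
  apply (H (reduce_dipole D t2 t1)); exists t2, t1; repeat split; auto; exists j; auto.
Qed.

Section Addresses.
Context {Sigma : Type} (Rel : list Sigma -> list Sigma -> Prop) (TL : tree_like Rel).

(* [split_address D j al]: the wire [j] is reached from the top of the frame by
   going down through splitting transistors only, leaving the n-th one through its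
   [nth n al]-th bottom wire. *)
Inductive split_address (D : diagram Sigma) : nat -> list nat -> Prop :=
| sa_top j : dtop D = [j] -> split_address D j []
| sa_split t k i j al :
    In t (dtrs D) -> ttop D t = [k] -> Rel [dlab D k] (map (dlab D) (tbot D t)) ->
    nth_error (tbot D t) i = Some j -> split_address D k al -> split_address D j (al ++ [i]).

Definition merge_address (D : diagram Sigma) : nat -> list nat -> Prop := split_address (flip D).

(** A middle wire, under the tree of splits and over the tree of merges. It makes the map replace
    the prefix [be] by [al]. *)
Definition leaf (D : diagram Sigma) (al be : list nat) : Prop :=
  exists j, split_address D j al /\ merge_address D j be.

Lemma sa_snoc_inv (D : diagram Sigma) (j i : nat) (al : list nat) :
  split_address D j (al ++ [i]) -> exists t k,
    In t (dtrs D) /\ ttop D t = [k] /\ Rel [dlab D k] (map (dlab D) (tbot D t)) /\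
    nth_error (tbot D t) i = Some j /\ split_address D k al.
Proof.
  remember (al ++ [i]) as be eqn:E; destruct 1 as [j H|t k i' j al' H1 H2 H3 H4 H5].
  - destruct al; discriminate.
  - apply app_inj_tail in E as [-> ->]; exists t, k; auto.
Qed.

Lemma sa_nil_inv (D : diagram Sigma) (j : nat) : split_address D j [] -> dtop D = [j].
Proof.
  intros H; inversion H as [|t k i j' al H1 H2 H3 H4 H5 E H6]; [assumption|].
  destruct al; discriminate.
Qed.

Lemma sa_prefix (D : diagram Sigma) (al ga : list nat) (j : nat) :
  split_address D j (al ++ ga) -> exists k, split_address D k al.
Proof.
  revert j; induction ga as [|i ga IH] using rev_ind; intros j H.
  - rewrite app_nil_r in H; eauto.
  - rewrite app_assoc in H; apply sa_snoc_inv in H as (t & k & _ & _ & _ & _ & H); eauto.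
Qed.

Section Valid.
Context {x : Sigma} {D : diagram Sigma} (V : valid Rel [x] [x] D).

Lemma sa_walk (j : nat) (al : list nat) : split_address D j al -> walk Rel x al (dlab D j).
Proof.
  induction 1 as [j H|t k i j al H1 H2 H3 H4 H5 IH].
  - destruct (valid_dtop _ V) as (j' & H' & <-); assert (j = j') as <- by congruence; constructor.
  - eapply walk_snoc; eauto; apply map_nth_error; exact H4.
Qed.

Lemma sa_flow (j : nat) (al : list nat) (p : point) :
  split_address D j al -> flow Rel D j p (papp al p).
Proof.
  intros H; revert p; induction H as [j H|t k i j al H1 H2 H3 H4 H5 IH]; intros p.
  - apply flow_top; exact H.
  - rewrite papp_snoc; eapply flow_step; [exact H1|apply step_split; eauto|apply IH].
Qed.

Lemma sa_wire (j : nat) (al : list nat) : split_address D j al -> In j (wire_tops D).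
Proof. intros H; eapply flow_wire; [exact V|apply (sa_flow j al (fun _ => 0) H)]. Qed.

Lemma sa_det (j : nat) (al be : list nat) :
  split_address D j al -> split_address D j be -> al = be.
Proof.
  intros H; revert be; induction H as [j H|t k i j al H1 H2 H3 H4 H5 IH]; intros be H'.
  - destruct H' as [j H'|t k i j be H1 H2 H3 H4 H5]; [reflexivity|exfalso].
    eapply (dtop_not_tbot Rel V); [|exact H1|eapply nth_error_In; exact H4].
    rewrite H; simpl; auto.
  - destruct H' as [j H'|t' k' i' j be K1 K2 K3 K4 K5].
    + exfalso; eapply (dtop_not_tbot Rel V); [|exact H1|eapply nth_error_In; exact H4].
      rewrite H'; simpl; auto.
    + assert (t = t') as <- by (eapply (tbot_unique Rel V); eauto using nth_error_In).
      assert (k = k') as <- by congruence.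
      assert (i = i') as <-.
      { eapply (proj1 (NoDup_nth_error _) (tbot_NoDup Rel V t H1)); [|congruence].
        apply nth_error_Some; congruence. }
      rewrite (IH _ K5); reflexivity.
Qed.

Lemma sa_inj (j j' : nat) (al : list nat) :
  split_address D j al -> split_address D j' al -> j = j'.
Proof.
  intros H; revert j'; induction H as [j H|t k i j al H1 H2 H3 H4 H5 IH]; intros j' H'.
  - apply sa_nil_inv in H'; congruence.
  - apply sa_snoc_inv in H' as (t' & k' & K1 & K2 & K3 & K4 & K5).
    apply IH in K5 as <-.
    assert (t = t') as <-; [|congruence].
    eapply (tbot_unique Rel (valid_flip _ _ _ _ V)); [exact H1|exact K1| |]; simpl;
      [rewrite H2|rewrite K2]; simpl; eauto.
Qed.

End Valid.

(** Going up from the bottom of the frame to [j], the merges remove [be] index by index; this is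
    [sa_flow] of the flipped diagram, reversed. *)
Lemma ma_flow (x : Sigma) (D : diagram Sigma) (j b : nat) (be : list nat) (p q : point) :
  valid Rel [x] [x] D -> dbot D = [b] ->
  merge_address D j be -> flow Rel D j p q -> flow Rel D b (papp be p) q.
Proof.
  intros V Hb H Hf; rewrite <- (flip_flip D).
  eapply (flow_flip Rel (D := flip D)); [apply sa_flow; exact H| |exact Hb].
  rewrite flip_flip; exact Hf.
Qed.

Lemma leaf_sem (x : Sigma) (D : diagram Sigma) (al be : list nat) (p : point) :
  valid Rel [x] [x] D -> leaf D al be -> sem Rel D (papp be p) (papp al p).
Proof.
  intros V (j & H1 & H2); destruct (valid_dbot _ V) as (b & Hb & _); exists b; split; [exact Hb|].
  eapply ma_flow; eauto; apply sa_flow; exact H1.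
Qed.

Lemma leaf_walk (x : Sigma) (D : diagram Sigma) (al be : list nat) :
  valid Rel [x] [x] D -> leaf D al be -> exists a, walk Rel x al a /\ walk Rel x be a.
Proof.
  intros V (j & H1 & H2); exists (dlab D j); split; [apply (sa_walk V); auto|].
  apply (sa_walk (valid_flip _ _ _ _ V) j be H2).
Qed.

Lemma leaf_flip (D : diagram Sigma) (al be : list nat) : leaf (flip D) be al <-> leaf D al be.
Proof.
  unfold leaf, merge_address; rewrite flip_flip; split; intros (j & H1 & H2); exists j; auto.
Qed.

(** * Wires of a diagram without dipoles *)

Section Irreducible.
Context {x : Sigma} {D : diagram Sigma} (V : valid Rel [x] [x] D) (Hirr : irreducible_diagram D).

Lemma no_merge_above_split (t1 t2 m : nat) :
  In t1 (dtrs D) -> In t2 (dtrs D) ->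
  tbot D t2 = [m] -> Rel [dlab D m] (map (dlab D) (ttop D t2)) ->
  ttop D t1 = [m] -> Rel [dlab D m] (map (dlab D) (tbot D t1)) -> False.
Proof.
  intros H1 H2 H3 H4 H5 H6; apply (Hirr (reduce_dipole D t1 t2)); exists t1, t2.
  repeat split; auto.
  - intros <-; eapply (split_merge_false Rel TL); eauto.
  - exists m; rewrite H3, H5; simpl; auto.
  - eapply rel_det; eauto.
  - congruence.
Qed.

(** Induction upwards: a wire that leaves a split inherits an address from the wire entering it,
    since that wire cannot come out of a merge. *)
Lemma split_address_or_merge (j : nat) : In j (wire_tops D) ->
  (exists al, split_address D j al) \/
  (exists t, In t (dtrs D) /\ tbot D t = [j] /\ Rel [dlab D j] (map (dlab D) (ttop D t))).
Proof.
  assert (Htop : forall j, In j (dtop D) -> split_address D j []).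
  { intros k Hk; destruct (valid_dtop _ V) as (j0 & H0 & _); rewrite H0 in Hk.
    destruct Hk as [->|[]]; apply sa_top; exact H0. }
  assert (H : forall t, In t (dtrs D) -> forall j, In j (tbot D t) ->
     (exists al, split_address D j al) \/
     (exists t, In t (dtrs D) /\ tbot D t = [j] /\ Rel [dlab D j] (map (dlab D) (ttop D t)))).
  { intros t; induction (up_acc Rel V t) as [t _ IH]; intros Ht k Hk.
    destruct (trans_rel Rel TL V t Ht) as [(m & H1 & H2)|(m & H1 & H2)].
    - left; apply In_nth_error in Hk as [i Hi].
      assert (exists al, split_address D m al) as [al Hal];
        [|exists (al ++ [i]); eapply sa_split; eauto].
      assert (Hm : In m (wire_tops D)) by (eapply (ttop_wire Rel V); eauto; rewrite H1; simpl; auto).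
      apply in_tops in Hm as [Hm|(t' & Ht' & Hm)]; [eauto|].
      assert (Hup : tprec D t t') by (repeat split; auto; exists m; rewrite H1; simpl; auto).
      destruct (IH t' Hup Ht' m Hm) as [?|(t2 & K1 & K2 & K3)]; [assumption|].
      exfalso; apply (no_merge_above_split t t2 m); assumption.
    - right; exists t; rewrite H1 in Hk |- *; destruct Hk as [->|[]]; auto. }
  intros Hj; apply in_tops in Hj as [Hj|(t & Ht & Hj)]; eauto.
Qed.

End Irreducible.

Section Leaves.
Context {x : Sigma} {D : diagram Sigma} (V : valid Rel [x] [x] D) (Hirr : irreducible_diagram D).

Lemma merge_address_or_split (j : nat) : In j (wire_tops D) ->
  (exists be, merge_address D j be) \/
  (exists t, In t (dtrs D) /\ ttop D t = [j] /\ Rel [dlab D j] (map (dlab D) (tbot D t))).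
Proof.
  intros H; apply (split_address_or_merge (valid_flip _ _ _ _ V) (irreducible_flip _ Hirr)).
  apply (tops_bots Rel V); exact H.
Qed.

Lemma split_or_merge_address (j : nat) : In j (wire_tops D) ->
  (exists al, split_address D j al) \/ (exists be, merge_address D j be).
Proof.
  intros H; destruct (split_address_or_merge V Hirr j H) as [?|(t & H1 & H2 & H3)]; [auto|].
  destruct (merge_address_or_split j H) as [?|(t' & H4 & H5 & H6)]; [auto|exfalso].
  eapply (no_merge_above_split Hirr t' t); eauto.
Qed.

(** While the flow climbs merges the merge address grows; the wire from which it enters its first
    split, or reaches the frame, is the leaf. *)
Lemma leaf_cover (j : nat) (p q : point) (be : list nat) :
  flow Rel D j p q -> merge_address D j be ->
  exists al be' r, leaf D al be' /\ papp be p = papp be' r /\ q = papp al r.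
Proof.
  intros H; revert be; induction H as [j p H|t j p k p' q Ht H Hf IH]; intros be Hbe.
  - exists [], be, p; repeat split; auto; exists j; split; [apply sa_top; exact H|exact Hbe].
  - destruct H as [i j k p H1 H2 H3|i j k p H1 H2 H3].
    + assert (Hj : In j (wire_tops D)) by (eapply (tbot_wire (D := D)); eauto using nth_error_In).
      destruct (split_address_or_merge V Hirr j Hj) as [[al Hal]|(t' & K1 & K2 & K3)].
      * exists al, be, p; split; [exists j; auto|split; [reflexivity|]].
        eapply (flow_det Rel TL V j p); [|apply sa_flow; exact Hal].
        eapply flow_step; [exact Ht|apply step_split; eauto|exact Hf].
      * exfalso; assert (t = t') as <-.
        { eapply (tbot_unique Rel V); [exact Ht|exact K1|eapply nth_error_In; exact H3|].
          rewrite K2; simpl; auto. }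
        eapply (split_merge_false Rel TL); eauto.
    + destruct (IH (be ++ [i])) as (al & be' & r & K1 & K2 & K3).
      * eapply (sa_split (flip D) t j i k); eauto.
      * exists al, be', r; rewrite <- papp_snoc; auto.
Qed.

Lemma leaf_cover_top (q : point) : ok Rel x q -> exists al be r, leaf D al be /\ q = papp al r.
Proof.
  intros Hq; destruct (sem_surj Rel TL x D q V Hq) as (p & b & H1 & H2).
  destruct (leaf_cover b p q [] H2) as (al & be & r & H3 & _ & H4); [apply sa_top; exact H1|eauto].
Qed.

(** Descending through splits, always by the first wire, ends at a leaf. Hence the leaves determine
    all nodes of the upper tree. *)
Lemma sa_extend (j : nat) (al : list nat) : split_address D j al ->
  exists ga be, leaf D (al ++ ga) be.
Proof.
  assert (H : forall t, In t (dtrs D) -> forall k al, ttop D t = [k] ->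
     Rel [dlab D k] (map (dlab D) (tbot D t)) -> split_address D k al ->
     exists ga be, leaf D (al ++ ga) be).
  { intros t; induction (up_acc Rel (valid_flip _ _ _ _ V) t) as [t _ IH].
    intros Ht k be Hk Hr Hbe.
    pose proof (rel_length Rel TL _ _ Hr) as L; rewrite length_map in L.
    destruct (nth_error (tbot D t) 0) as [j'|] eqn:E; [|apply nth_error_None in E; lia].
    assert (Hj' : split_address D j' (be ++ [0])) by (eapply sa_split; eauto).
    destruct (merge_address_or_split j') as [[de Hde]|(t' & K1 & K2 & K3)].
    - eapply sa_wire; eauto.
    - exists [0], de, j'; auto.
    - destruct (IH t') with (k := j') (al := be ++ [0]) as (ga & de & Hl); auto.
      + repeat split; auto; exists j'; simpl; rewrite K2; apply nth_error_In in E; simpl; auto.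
      + exists (0 :: ga), de; rewrite <- app_assoc in Hl; exact Hl. }
  intros Hj; destruct (merge_address_or_split j) as [[be Hbe]|(t & K1 & K2 & K3)].
  - eapply sa_wire; eauto.
  - exists [], be, j; rewrite app_nil_r; auto.
  - eauto.
Qed.

(* Minimality of the leaves: the lowest split below a coarser local description
   [be'] to [al'] would form a dipole with the merge below it. *)
Lemma leaf_minimal (al' be' ga be : list nat) (i : nat) (a : Sigma) :
  walk Rel x al' a -> walk Rel x be' a ->
  (forall q, ok Rel a q -> sem Rel D (papp be' q) (papp al' q)) ->
  leaf D (al' ++ i :: ga) be -> False.
Proof.
  intros Wa Wb Hsem (j0 & Hj0 & _).
  (* No split can sit at or below the address [al']. By downward induction it is enough to refute a
     split none of whose bottom wires is split again. *)
  assert (H : forall t, In t (dtrs D) -> forall k de, ttop D t = [k] ->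
     Rel [dlab D k] (map (dlab D) (tbot D t)) -> split_address D k (al' ++ de) -> False).
  { intros t; induction (up_acc Rel (valid_flip _ _ _ _ V) t) as [t _ IH].
    intros Ht k de Hk Hr Hde.
    (* All bottom wires of such a split are leaves. The coarser description prescribes their images,
       so injectivity of the map forces their merge addresses to be [be' ++ de ++ [n]]. *)
    assert (Hleaf : forall n j, nth_error (tbot D t) n = Some j ->
              merge_address D j ((be' ++ de) ++ [n])).
    { intros n j Hn.
      assert (Hj : split_address D j ((al' ++ de) ++ [n])) by (eapply sa_split; eauto).
      destruct (merge_address_or_split j) as [[be1 Hbe1]|(t' & K1 & K2 & K3)].
      - eapply sa_wire; eauto.
      - assert (Hl : leaf D ((al' ++ de) ++ [n]) be1) by (exists j; auto).
        rewrite <- app_assoc in Hl, Hj.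
        pose proof (sa_walk V _ _ Hj) as W1; apply walk_app_inv in W1 as (a' & W1 & W2).
        rewrite (walk_det Rel TL _ _ _ _ W1 Wa) in W2.
        rewrite <- app_assoc; replace (be' ++ de ++ [n]) with be1; [exact Hbe1|].
        apply (papp_inj_l Rel TL x (dlab D j)).
        + apply (sa_walk (valid_flip _ _ _ _ V) _ _ Hbe1).
        + eapply walk_app; eauto.
        + intros p Hp; eapply (sem_inj Rel TL); [exact V|apply (leaf_sem _ _ _ _ _ V Hl)|].
          rewrite !(papp_app _ (de ++ [n])); apply Hsem; eapply ok_papp; eauto.
      - exfalso; rewrite <- app_assoc in Hj.
        apply (IH t') with (k := j) (de := de ++ [n]); auto.
        repeat split; auto; exists j; simpl; rewrite K2; apply nth_error_In in Hn; simpl; auto. }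
    pose proof (rel_length Rel TL _ _ Hr) as L; rewrite length_map in L.
    destruct (nth_error (tbot D t) 0) as [j1|] eqn:E; [|apply nth_error_None in E; lia].
    destruct (sa_snoc_inv _ _ _ _ (Hleaf _ _ E)) as (t1 & m & K1 & K2 & K3 & K4 & K5).
    simpl in K1, K2, K3, K4.
    (* These addresses differ only in the last index, so the wires all enter one merge, in the order
       in which they left the split. *)
    assert (Hnth : forall n j, nth_error (tbot D t) n = Some j -> nth_error (ttop D t1) n = Some j).
    { intros n j Hn; destruct (sa_snoc_inv _ _ _ _ (Hleaf _ _ Hn)) as (t2 & m' & M1 & M2 & M3 & M4 & M5).
      simpl in M1, M2, M3, M4.
      rewrite (sa_inj (valid_flip _ _ _ _ V) _ _ _ M5 K5) in M2.
      assert (t1 = t2) as <-; [|exact M4].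
      eapply (tbot_unique Rel V); eauto; [rewrite K2|rewrite M2]; simpl; auto. }
    (* Both letters are reached from [a] along [de]. With equal letters the split and the merge use
       the same relation, hence have equally many wires. *)
    assert (Hlab : dlab D m = dlab D k).
    { pose proof (sa_walk (valid_flip _ _ _ _ V) _ _ K5) as W1.
      pose proof (sa_walk V _ _ Hde) as W2.
      apply walk_app_inv in W1 as (a1 & W3 & W4); apply walk_app_inv in W2 as (a2 & W5 & W6).
      rewrite (walk_det Rel TL _ _ _ _ W3 Wb) in W4; rewrite (walk_det Rel TL _ _ _ _ W5 Wa) in W6.
      eapply walk_det; eauto. }
    assert (Heq : tbot D t = ttop D t1).
    { rewrite <- Hlab in Hr; pose proof (f_equal (@length _) (rel_det Rel TL _ _ _ Hr K3)) as Le.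
      rewrite !length_map in Le; apply nth_error_ext; intros n.
      destruct (nth_error (tbot D t) n) as [j|] eqn:F; [symmetry; auto|].
      symmetry; apply nth_error_None; apply nth_error_None in F; simpl in Le; lia. }
    apply (Hirr (reduce_dipole D t1 t)); exists t1, t; repeat split; auto.
    - intros ->; eapply (split_merge_false Rel TL); eauto.
    - exists j1; rewrite <- Heq; apply nth_error_In in E; auto.
    - rewrite K2, Hk; simpl; congruence. }
  replace (al' ++ i :: ga) with ((al' ++ [i]) ++ ga) in Hj0 by (rewrite <- app_assoc; reflexivity).
  apply sa_prefix in Hj0 as [k Hk]; apply sa_snoc_inv in Hk as (t & m & K1 & K2 & K3 & _ & K5).
  apply (H t K1 m []); auto; rewrite app_nil_r; exact K5.
Qed.

End Leaves.

(** A leaf of [D'] covering a point below [al] has an address comparable to [al]. If one address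
    properly extended the other, the shorter leaf would be a coarser description, which
    [leaf_minimal] forbids. *)
Lemma leaf_incl (x : Sigma) (D D' : diagram Sigma) (al be : list nat) :
  valid Rel [x] [x] D -> valid Rel [x] [x] D' ->
  irreducible_diagram D -> irreducible_diagram D' -> sem_eq Rel x D D' ->
  leaf D al be -> leaf D' al be.
Proof.
  intros V V' I I' Heq Hl; destruct (leaf_walk _ _ _ _ V Hl) as (a & W1 & W2).
  destruct (leaf_cover_top V' I' (papp al (fun _ => 0))) as (al' & be' & r & Hl' & E).
  { apply (ok_papp Rel TL _ _ _ _ W1), ok_zero; exact TL. }
  destruct (leaf_walk _ _ _ _ V' Hl') as (a' & W1' & W2').
  assert (S : forall p, ok Rel a p -> sem Rel D' (papp be p) (papp al p)).
  { intros p Hp; apply Heq; [apply (ok_papp Rel TL _ _ _ _ W2), Hp|apply (leaf_sem _ _ _ _ _ V Hl)]. }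
  assert (S' : forall p, ok Rel a' p -> sem Rel D (papp be' p) (papp al' p)).
  { intros p Hp; apply Heq; [apply (ok_papp Rel TL _ _ _ _ W2'), Hp|apply (leaf_sem _ _ _ _ _ V' Hl')]. }
  assert (Hsame : al' = al -> leaf D' al be).
  { intros ->; replace be with be'; [exact Hl'|].
    rewrite (walk_det Rel TL _ _ _ _ W1' W1) in W2'.
    apply (papp_inj_l Rel TL x a); auto; intros p Hp.
    eapply (sem_inj Rel TL); [exact V'|apply (leaf_sem _ _ _ _ _ V' Hl')|auto]. }
  destruct (papp_comparable _ _ _ _ E) as [ga [[-> _]|[-> _]]]; destruct ga as [|i ga].
  - apply Hsame; symmetry; apply app_nil_r.
  - destruct (leaf_minimal V I al' be' ga be i a' W1' W2' S' Hl).
  - apply Hsame, app_nil_r.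
  - destruct (leaf_minimal V' I' al be ga be' i a W1 W2 S Hl').
Qed.

(** * Reconstruction of a diagram without dipoles from its leaves *)

Definition same_leaves (D D' : diagram Sigma) : Prop :=
  forall al be, leaf D al be <-> leaf D' al be.

Definition same_address (D D' : diagram Sigma) (j j' : nat) : Prop :=
  (exists al, split_address D j al /\ split_address D' j' al) \/
  (exists be, merge_address D j be /\ merge_address D' j' be).

Lemma same_leaves_flip (D D' : diagram Sigma) :
  same_leaves D D' -> same_leaves (flip D) (flip D').
Proof. intros H al be; rewrite !leaf_flip; apply H. Qed.

Lemma same_leaves_sym (D D' : diagram Sigma) : same_leaves D D' -> same_leaves D' D.
Proof. intros H al be; symmetry; apply H. Qed.

Lemma same_address_sym (D D' : diagram Sigma) (j j' : nat) :
  same_address D D' j j' -> same_address D' D j' j.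
Proof. intros [(al & H1 & H2)|(al & H1 & H2)]; [left|right]; eauto. Qed.

Lemma same_address_flip (D D' : diagram Sigma) (j j' : nat) :
  same_address (flip D) (flip D') j j' -> same_address D D' j j'.
Proof.
  unfold same_address, merge_address; rewrite !flip_flip; tauto.
Qed.

Section SameLeaves.
Context {x : Sigma} {D D' : diagram Sigma}
  (V : valid Rel [x] [x] D) (V' : valid Rel [x] [x] D')
  (I : irreducible_diagram D) (I' : irreducible_diagram D') (Hleaf : same_leaves D D').

Lemma sa_transfer (j : nat) (al : list nat) :
  split_address D j al -> exists j', split_address D' j' al.
Proof.
  intros H; destruct (sa_extend V I j al H) as (ga & be & Hl).
  apply Hleaf in Hl as (j' & Hj' & _); eapply sa_prefix; eauto.
Qed.

(** The delicate case is a wire [j] matched once by its split address and once by its merge address.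
    It is then a leaf, and the common leaf of [D'] has both addresses. *)
Lemma same_address_det (j j' j'' : nat) :
  same_address D D' j j' -> same_address D D' j j'' -> j' = j''.
Proof.
  assert (Hmix : forall al be k k', split_address D j al -> merge_address D j be ->
            split_address D' k al -> merge_address D' k' be -> k = k').
  { intros al be k k' H1 H2 H3 H4.
    destruct (proj1 (Hleaf al be)) as (j3 & H5 & H6); [exists j; auto|].
    rewrite (sa_inj V' _ _ _ H3 H5), (sa_inj (valid_flip _ _ _ _ V') _ _ _ H4 H6); reflexivity. }
  intros [(al & H1 & H2)|(al & H1 & H2)] [(be & H3 & H4)|(be & H3 & H4)].
  - rewrite (sa_det V _ _ _ H1 H3) in H2; apply (sa_inj V' _ _ _ H2 H4).
  - eauto.
  - symmetry; eauto.
  - rewrite (sa_det (valid_flip _ _ _ _ V) _ _ _ H1 H3) in H2.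
    apply (sa_inj (valid_flip _ _ _ _ V') _ _ _ H2 H4).
Qed.

Lemma same_address_label (j j' : nat) : same_address D D' j j' -> dlab D' j' = dlab D j.
Proof.
  intros [(al & H1 & H2)|(al & H1 & H2)].
  - eapply (walk_det Rel TL); [apply (sa_walk V' _ _ H2)|apply (sa_walk V _ _ H1)].
  - eapply (walk_det Rel TL);
      [apply (sa_walk (valid_flip _ _ _ _ V') _ _ H2)|apply (sa_walk (valid_flip _ _ _ _ V) _ _ H1)].
Qed.

(** The partner is found through the first bottom wire of [t]: its address occurs in [D'], so the
    parent address is split there too, and by the same relation. *)
Lemma same_split (t k : nat) :
  In t (dtrs D) -> ttop D t = [k] -> Rel [dlab D k] (map (dlab D) (tbot D t)) ->
  exists t', In t' (dtrs D') /\ Forall2 (same_address D D') (ttop D t) (ttop D' t') /\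
             Forall2 (same_address D D') (tbot D t) (tbot D' t').
Proof.
  intros Ht Hk Hr.
  assert (exists al, split_address D k al) as [al Hal].
  { destruct (split_address_or_merge V I k) as [?|(t' & H1 & H2 & H3)]; [|assumption|].
    - eapply (ttop_wire Rel V); eauto; rewrite Hk; simpl; auto.
    - exfalso; eapply (no_merge_above_split I t t'); eauto. }
  pose proof (rel_length Rel TL _ _ Hr) as L; rewrite length_map in L.
  destruct (nth_error (tbot D t) 0) as [j|] eqn:E; [|apply nth_error_None in E; lia].
  destruct (sa_transfer j (al ++ [0])) as [j' Hj']; [eapply sa_split; eauto|].
  apply sa_snoc_inv in Hj' as (t' & k' & K1 & K2 & K3 & K4 & K5).
  assert (Hkk : same_address D D' k k') by (left; eauto).
  exists t'; split; [exact K1|split].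
  - rewrite Hk, K2; constructor; auto.
  - rewrite (same_address_label _ _ Hkk) in K3.
    pose proof (f_equal (@length _) (rel_det Rel TL _ _ _ Hr K3)) as Le; rewrite !length_map in Le.
    assert (H : forall i u u', nth_error (tbot D t) i = Some u -> nth_error (tbot D' t') i = Some u' ->
              same_address D D' u u').
    { intros i u u' Hu Hu'; left; exists (al ++ [i]); split; eapply sa_split; eauto.
      rewrite (same_address_label _ _ Hkk); exact K3. }
    revert H Le; generalize (tbot D t) (tbot D' t').
    induction l as [|u l IH]; intros [|u' l'] H Le; try discriminate; constructor.
    + apply (H 0); reflexivity.
    + apply IH; [intros i; apply (H (S i))|injection Le; auto].
Qed.

End SameLeaves.

Section Isomorphism.
Context {x : Sigma} {D D' : diagram Sigma}
  (V : valid Rel [x] [x] D) (V' : valid Rel [x] [x] D')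
  (I : irreducible_diagram D) (I' : irreducible_diagram D') (Hleaf : same_leaves D D').

Lemma same_address_total (j : nat) : In j (wire_tops D) -> exists j', same_address D D' j j'.
Proof.
  intros H; destruct (split_or_merge_address V I j H) as [[al Hal]|[be Hbe]].
  - destruct (sa_transfer V I Hleaf j al Hal) as [j' Hj']; exists j'; left; eauto.
  - destruct (sa_transfer (valid_flip _ _ _ _ V) (irreducible_flip _ I) (same_leaves_flip _ _ Hleaf) j be Hbe)
      as [j' Hj']; exists j'; right; eauto.
Qed.

Lemma same_transistor (t : nat) : In t (dtrs D) ->
  exists t', In t' (dtrs D') /\ Forall2 (same_address D D') (ttop D t) (ttop D' t') /\
             Forall2 (same_address D D') (tbot D t) (tbot D' t').
Proof.
  intros Ht; destruct (trans_rel Rel TL V t Ht) as [(k & H1 & H2)|(k & H1 & H2)].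
  - apply (same_split V V' I Hleaf t k); auto.
  - destruct (same_split (valid_flip _ _ _ _ V) (valid_flip _ _ _ _ V') (irreducible_flip _ I)
               (same_leaves_flip _ _ Hleaf) t k) as (t' & K1 & K2 & K3); auto.
    exists t'; split; [exact K1|split].
    + eapply Forall2_impl; [|exact K3]; intros; apply same_address_flip; assumption.
    + eapply Forall2_impl; [|exact K2]; intros; apply same_address_flip; assumption.
Qed.

End Isomorphism.

Lemma same_leaves_iso (x : Sigma) (D D' : diagram Sigma) :
  valid Rel [x] [x] D -> valid Rel [x] [x] D' ->
  irreducible_diagram D -> irreducible_diagram D' -> same_leaves D D' -> diag_iso D D'.
Proof.
  intros V V' I I' Hleaf; pose proof (same_leaves_sym _ _ Hleaf) as Hleaf'.
  pose (sig := fun j => epsilon (inhabits 0) (same_address D D' j)).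
  assert (Hsig : forall j j', same_address D D' j j' -> sig j = j').
  { intros j j' H; apply (same_address_det V V' Hleaf j); [|exact H].
    apply epsilon_spec; eauto. }
  assert (Hsig' : forall j, In j (wire_tops D) -> same_address D D' j (sig j)).
  { intros j H; destruct (same_address_total V I Hleaf j H) as [j' Hj'].
    rewrite (Hsig _ _ Hj'); exact Hj'. }
  assert (Hmap : forall l l', Forall2 (same_address D D') l l' -> l' = map sig l).
  { induction 1; simpl; [reflexivity|f_equal; [symmetry|]; auto]. }
  assert (Hinj : forall j j', In j (wire_tops D) -> In j' (wire_tops D) -> sig j = sig j' -> j = j').
  { intros j j' H H' E; apply Hsig' in H, H'; rewrite <- E in H'.
    apply (same_address_det V' V Hleaf' (sig j)); apply same_address_sym; assumption. }
  pose (tau := fun t => epsilon (inhabits 0) (fun t' => In t' (dtrs D') /\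
                 Forall2 (same_address D D') (ttop D t) (ttop D' t') /\
                 Forall2 (same_address D D') (tbot D t) (tbot D' t'))).
  assert (Htau : forall t, In t (dtrs D) -> In (tau t) (dtrs D') /\
            ttop D' (tau t) = map sig (ttop D t) /\ tbot D' (tau t) = map sig (tbot D t)).
  { intros t Ht; destruct (epsilon_spec (inhabits 0) _ (same_transistor V V' I Hleaf t Ht)) as (H1 & H2 & H3).
    split; [exact H1|split; apply Hmap; assumption]. }
  (* Every transistor has a bottom wire, and a wire has one upper end; so [tau] is injective and
     onto because [sig] matches the bottom wires. *)
  assert (Hne : forall E t, valid Rel [x] [x] E -> In t (dtrs E) -> exists j, In j (tbot E t)).
  { intros E t VE Ht; destruct (trans_rel Rel TL VE t Ht) as [(k & H1 & H2)|(k & H1 & H2)].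
    - apply (rel_length Rel TL) in H2; rewrite length_map in H2.
      destruct (tbot E t) as [|j l]; [simpl in H2; lia|exists j; simpl; auto].
    - exists k; rewrite H1; simpl; auto. }
  exists sig, tau; split; [exact Hinj|split; [|split; [|split; [|split; [|split; [|split; [|split]]]]]]].
  - intros j' Hj'; destruct (same_address_total V' I' Hleaf' j' Hj') as [j Hj].
    apply same_address_sym in Hj; exists j; split; [|auto].
    destruct Hj as [(al & H1 & _)|(al & H1 & _)]; [eapply sa_wire; eauto|].
    apply (tops_bots Rel V), (sa_wire (valid_flip _ _ _ _ V) _ _ H1).
  - intros t t' Ht Ht' E; destruct (Hne _ _ V Ht) as [j Hj].
    destruct (Htau t Ht) as (_ & _ & E1); destruct (Htau t' Ht') as (_ & _ & E2).
    rewrite E, E2 in E1.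
    assert (K : In (sig j) (map sig (tbot D t'))) by (rewrite E1; apply in_map; exact Hj).
    apply in_map_iff in K as (j' & K1 & K2).
    assert (j' = j) as -> by (apply Hinj; [exact (tbot_wire t' j' Ht' K2)|exact (tbot_wire t j Ht Hj)|exact K1]).
    exact (tbot_unique Rel V t t' j Ht Ht' Hj K2).
  - intros t' Ht'; destruct (same_transistor V' V I' Hleaf' t' Ht') as (t & H1 & _ & H3).
    exists t; split; [exact H1|]; destruct (Htau t H1) as (K1 & _ & K2).
    assert (E : tbot D' t' = map sig (tbot D t)).
    { apply Hmap, Forall2_flip; eapply Forall2_impl; [|exact H3].
      intros; apply same_address_sym; assumption. }
    rewrite <- E in K2; destruct (Hne _ _ V' Ht') as [j Hj].
    eapply (tbot_unique Rel V'); eauto; rewrite K2; exact Hj.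
  - intros t Ht; apply Htau, Ht.
  - intros j Hj; apply (same_address_label V V'), Hsig', Hj.
  - destruct (valid_dtop _ V) as (j & H1 & _); destruct (valid_dtop _ V') as (j' & H1' & _).
    rewrite H1, H1'; simpl; f_equal; apply Hsig; left; exists []; split; apply sa_top; assumption.
  - destruct (valid_dbot _ V) as (j & H1 & _); destruct (valid_dbot _ V') as (j' & H1' & _).
    rewrite H1, H1'; simpl; f_equal; apply Hsig; right; exists []; split; apply sa_top; assumption.
  - intros t Ht; apply Htau, Ht.
Qed.

Theorem sem_complete (x : Sigma) (D D' : diagram Sigma) :
  valid Rel [x] [x] D -> valid Rel [x] [x] D' -> sem_eq Rel x D D' -> deq Rel [x] D D'.
Proof.
  intros V V' H.
  destruct (reduce_fully Rel x D V) as (E & VE & HE & IE).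
  destruct (reduce_fully Rel x D' V') as (E' & VE' & HE' & IE').
  assert (HEE : sem_eq Rel x E E').
  { intros p q Hp; rewrite <- (deq_sem Rel TL x _ _ HE p q Hp), (H p q Hp).
    apply (deq_sem Rel TL x _ _ HE'); exact Hp. }
  assert (HEE' : sem_eq Rel x E' E) by (intros p q Hp; symmetry; apply HEE; exact Hp).
  eapply rst_trans; [exact HE|]; eapply rst_trans; [|apply rst_sym; exact HE'].
  apply rst_step; split; [exact VE|split; [exact VE'|left]].
  apply (same_leaves_iso x); auto; intros al be; split; apply (leaf_incl x); auto.
Qed.

End Addresses.

(** * Every local bijection comes from a diagram *)

(** Diagrams name wires and transistors by numbers, whereas the nodes of a tree are lists of
    indices. *)
Fixpoint code (l : list nat) : nat :=
  match l with [] => 0 | i :: l => S (Cantor.to_nat (i, code l)) end.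

Lemma code_inj (l l' : list nat) : code l = code l' -> l = l'.
Proof.
  revert l'; induction l as [|i l IH]; intros [|j l'] H; try discriminate; [reflexivity|].
  apply (Nat.succ_inj (Cantor.to_nat (i, code l)) (Cantor.to_nat (j, code l'))) in H.
  apply (f_equal Cantor.of_nat) in H; rewrite !Cantor.cancel_of_to in H.
  injection H as E H; rewrite E, (IH _ H); reflexivity.
Qed.

Definition decode (n : nat) : list nat := epsilon (inhabits []) (fun l => code l = n).

Lemma decode_code (l : list nat) : decode (code l) = l.
Proof. apply code_inj; unfold decode; apply epsilon_spec; eauto. Qed.

Section Codes.
Context {Sigma : Type} (Rel : list Sigma -> list Sigma -> Prop) (TL : tree_like Rel) (x : Sigma).

(** The leaf set of a finite full subtree containing the root: its cylinders partition the space of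
    paths from [x]. *)
Record complete_code (C : list (list nat)) : Prop := {
  code_walk : forall al, In al C -> exists a, walk Rel x al a;
  code_antichain : forall al ga, In al C -> In (al ++ ga) C -> ga = [];
  code_complete : forall p, ok Rel x p -> exists al r, In al C /\ p = papp al r }.

Definition inner (C : list (list nat)) : list (list nat) :=
  nodup (list_eq_dec Nat.eq_dec)
    (flat_map (fun al => map (fun n => firstn n al) (seq 0 (length al))) C).

Lemma in_inner (C : list (list nat)) (al : list nat) :
  In al (inner C) <-> exists i ga, In (al ++ i :: ga) C.
Proof.
  unfold inner; rewrite nodup_In, in_flat_map; split.
  - intros (be & H1 & H2); apply in_map_iff in H2 as (n & <- & H2); apply in_seq in H2.
    destruct (skipn n be) as [|i ga] eqn:E.
    + pose proof (f_equal (@length _) E) as L; rewrite length_skipn in L; simpl in L; lia.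
    + exists i, ga; rewrite <- E, firstn_skipn; exact H1.
  - intros (i & ga & H); exists (al ++ i :: ga); split; [exact H|].
    apply in_map_iff; exists (length al); split.
    + rewrite firstn_app, firstn_all, Nat.sub_diag; simpl; apply app_nil_r.
    + apply in_seq; rewrite length_app; simpl; lia.
Qed.

Section CompleteCode.
Context {C : list (list nat)} (HC : complete_code C).

Lemma inner_not_code (al : list nat) : In al (inner C) -> ~ In al C.
Proof.
  intros H H'; apply in_inner in H as (i & ga & H).
  pose proof (code_antichain _ HC _ _ H' H); discriminate.
Qed.

(** Some codeword covers the zero path below [al], hence is comparable to [al]; the hypothesis
    excludes that it is a proper prefix. *)
Lemma code_or_inner (al : list nat) (a : Sigma) : walk Rel x al a ->
  (forall be ga, al = be ++ ga -> In be C -> ga = []) -> In al C \/ In al (inner C).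
Proof.
  intros Hw Hpre.
  destruct (code_complete _ HC (papp al (fun _ => 0))) as (be & r & Hbe & E).
  { apply (ok_papp Rel TL _ _ _ _ Hw), ok_zero; exact TL. }
  destruct (papp_comparable _ _ _ _ E) as [ga [[-> _]|[-> _]]].
  - rewrite (Hpre be ga eq_refl Hbe), app_nil_r; auto.
  - destruct ga as [|i ga]; [rewrite app_nil_r in Hbe; auto|].
    right; apply in_inner; eauto.
Qed.

Lemma nil_code_or_inner : In [] C \/ In [] (inner C).
Proof.
  apply (code_or_inner [] x); [constructor|].
  intros be ga E _; symmetry in E; apply app_eq_nil in E as [_ E]; exact E.
Qed.

Lemma inner_walk (al : list nat) : In al (inner C) ->
  exists a w, walk Rel x al a /\ Rel [a] w.
Proof.
  intros H; apply in_inner in H as (i & ga & H).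
  destruct (code_walk _ HC _ H) as [c Hc]; apply walk_app_inv in Hc as (a & H1 & H2).
  apply walk_cons_inv in H2 as (w & b & H2 & _); eauto.
Qed.

(** A codeword that is a proper prefix of the child would be a prefix of [al], and hence a proper
    prefix of a codeword beyond [al]. *)
Lemma inner_child (al : list nat) (i : nat) (b : Sigma) :
  In al (inner C) -> walk Rel x (al ++ [i]) b -> In (al ++ [i]) C \/ In (al ++ [i]) (inner C).
Proof.
  intros H Hw; apply (code_or_inner _ b Hw); intros be ga E Hbe.
  destruct ga as [|j ga _] using rev_ind; [reflexivity|exfalso].
  rewrite app_assoc in E; apply app_inj_tail in E as [-> _].
  apply in_inner in H as (k & de & H); rewrite <- app_assoc in H.
  apply (code_antichain _ HC _ _ Hbe) in H; destruct ga; discriminate.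
Qed.

Lemma parent_inner (al : list nat) (i : nat) :
  In (al ++ [i]) C \/ In (al ++ [i]) (inner C) -> In al (inner C).
Proof.
  rewrite !in_inner; intros [H|(j & ga & H)]; [exists i, []; exact H|].
  exists i, (j :: ga); rewrite <- app_assoc in H; exact H.
Qed.

Lemma code_or_inner_walk (al : list nat) : In al C \/ In al (inner C) -> exists a, walk Rel x al a.
Proof.
  intros [H|H]; [apply (code_walk _ HC), H|]; destruct (inner_walk _ H) as (a & w & H1 & _); eauto.
Qed.

End CompleteCode.

Lemma concat_singletons {A B : Type} (f : A -> B) (l : list A) : concat (map (fun a => [f a]) l) = map f l.
Proof. induction l; simpl; congruence. Qed.

Definition letter (al : list nat) : Sigma := epsilon (inhabits x) (walk Rel x al).

Lemma letter_walk (al : list nat) (a : Sigma) : walk Rel x al a -> letter al = a.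
Proof.
  intros H; apply (walk_det Rel TL x _ _ al); [|exact H].
  unfold letter; apply epsilon_spec; eauto.
Qed.

Definition arity (al : list nat) : nat := length (children Rel (letter al)).

Lemma letter_children (al : list nat) (a : Sigma) (w : list Sigma) :
  walk Rel x al a -> Rel [a] w ->
  arity al = length w /\ map (fun i => letter (al ++ [i])) (seq 0 (arity al)) = w.
Proof.
  intros Hw Hr; unfold arity; rewrite (letter_walk _ _ Hw), (children_rel Rel TL _ _ Hr).
  split; [reflexivity|].
  apply nth_ext with (d := x) (d' := x); rewrite length_map, length_seq; [reflexivity|].
  intros n Hn; rewrite (nth_indep _ x (letter (al ++ [0]))) by (rewrite length_map, length_seq; exact Hn).
  rewrite (map_nth (fun i => letter (al ++ [i]))), seq_nth by exact Hn; simpl.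
  apply letter_walk; eapply walk_snoc; eauto; apply nth_error_nth'; exact Hn.
Qed.

Lemma arity_walk (al : list nat) (a : Sigma) (w : list Sigma) (i : nat) :
  walk Rel x al a -> Rel [a] w -> i < arity al <-> exists b, walk Rel x (al ++ [i]) b.
Proof.
  intros Hw Hr; destruct (letter_children _ _ _ Hw Hr) as [-> _]; split.
  - intros Hi; destruct (nth_error w i) as [b|] eqn:E; [|apply nth_error_None in E; lia].
    exists b; eapply walk_snoc; eauto.
  - intros [b Hb]; apply walk_snoc_inv in Hb as (a' & w' & H1 & H2 & H3).
    rewrite (walk_det Rel TL _ _ _ _ H1 Hw) in H2; rewrite (rel_det Rel TL _ _ _ H2 Hr) in H3.
    apply nth_error_Some; congruence.
Qed.

(** * The wires of a finite tree of addresses, for any injective naming: the upper tree uses [top],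
    the lower one [low] *)

Section TreeWires.
Context {C : list (list nat)} (HC : complete_code C) (name : list nat -> nat).

Definition node (al : list nat) : Prop := In al C \/ In al (inner C).

Context (Hname : forall al be, node al -> node be -> name al = name be -> al = be).

Lemma inner_arity (al : list nat) (i : nat) :
  In al (inner C) -> i < arity al <-> node (al ++ [i]).
Proof.
  intros H; destruct (inner_walk HC _ H) as (a & w & H1 & H2).
  rewrite (arity_walk _ _ _ _ H1 H2); split.
  - intros [b Hb]; eapply inner_child; eauto.
  - apply code_or_inner_walk; exact HC.
Qed.

Lemma inner_rel (al : list nat) :
  In al (inner C) -> Rel [letter al] (map (fun i => letter (al ++ [i])) (seq 0 (arity al))).
Proof.
  intros H; destruct (inner_walk HC _ H) as (a & w & H1 & H2).
  rewrite (proj2 (letter_children _ _ _ H1 H2)), (letter_walk _ _ H1); exact H2.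
Qed.

Definition child_wires (al : list nat) : list nat :=
  map (fun i => name (al ++ [i])) (seq 0 (arity al)).

Lemma in_child_wires (al : list nat) (j : nat) : In al (inner C) ->
  In j (child_wires al) <-> exists i, j = name (al ++ [i]) /\ node (al ++ [i]).
Proof.
  intros H; unfold child_wires; rewrite in_map_iff; split; intros (i & H1 & H2); exists i; split; auto.
  - apply in_seq in H2; apply inner_arity; auto; lia.
  - apply in_seq; apply inner_arity in H2; auto; lia.
Qed.

Lemma nth_child_wires (al : list nat) (i : nat) : In al (inner C) -> node (al ++ [i]) ->
  nth_error (child_wires al) i = Some (name (al ++ [i])).
Proof.
  intros H Hi; apply (inner_arity _ _ H) in Hi; apply (map_nth_error (fun i => name (al ++ [i]))).
  rewrite nth_error_nth' with (d := 0) by (rewrite length_seq; exact Hi); f_equal; apply seq_nth, Hi.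
Qed.

Definition tree_wires : list nat := name [] :: concat (map child_wires (inner C)).

Lemma in_tree_wires (j : nat) : In j tree_wires <-> exists al, node al /\ j = name al.
Proof.
  unfold tree_wires; simpl; rewrite in_concat_map; split.
  - intros [<-|(al & Hal & Hj)]; [exists []; split; [apply (nil_code_or_inner HC)|reflexivity]|].
    apply (in_child_wires _ _ Hal) in Hj as (i & -> & Hi); eauto.
  - intros (al & Hal & ->); destruct al as [|i al _] using rev_ind; [auto|right].
    pose proof (parent_inner _ _ Hal); exists al; split; [assumption|]; apply in_child_wires; eauto.
Qed.

Lemma tree_wires_NoDup : NoDup tree_wires.
Proof.
  unfold tree_wires; constructor.
  - intros H; apply in_concat_map in H as (al & Hal & Hj).
    apply (in_child_wires _ _ Hal) in Hj as (i & E & Hi).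
    apply Hname in E; [destruct al; discriminate|apply (nil_code_or_inner HC)|exact Hi].
  - apply NoDup_concat_map; [apply NoDup_nodup|split].
    + intros al Hal; apply NoDup_map_NoDup_ForallPairs; [|apply seq_NoDup].
      intros i i' Hi Hi' E; apply in_seq in Hi, Hi'.
      apply Hname, app_inj_tail in E as [_ E]; [exact E| |]; apply inner_arity; auto; lia.
    + intros al al' j Hal Hal' Hj Hj'.
      apply (in_child_wires _ _ Hal) in Hj as (i & -> & Hi).
      apply (in_child_wires _ _ Hal') in Hj' as (i' & E & Hi').
      apply Hname, app_inj_tail in E as [E _]; assumption.
Qed.

End TreeWires.

(* The diagram of a finite table [L] of pairs [(be, al)]: it splits down to the
   leaves [al] and merges the leaves [be], the two trees being joined along [L].
   The nodes of the upper tree are coded by [top], the inner nodes of the lower tree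
   by [bot]; a leaf wire is named after its end in the upper tree. *)
Section Table.
Context (L : list (list nat * list nat)).
Let up := map snd L.
Let down := map fst L.
Context (Hup : complete_code up) (Hdown : complete_code down)
  (Hletter : forall be al, In (be, al) L -> exists a, walk Rel x be a /\ walk Rel x al a)
  (Hfun : forall be al al', In (be, al) L -> In (be, al') L -> al = al')
  (Hinj : forall be be' al, In (be, al) L -> In (be', al) L -> be = be').

Definition top (al : list nat) : nat := code (0 :: al).
Definition bot (be : list nat) : nat := code (1 :: be).

Definition low (be : list nat) : nat :=
  match excluded_middle_informative (exists al, In (be, al) L) with
  | left H => top (proj1_sig (constructive_indefinite_description _ H))
  | right _ => bot be
  end.

(** The head of a decoded number, 0 or 1, tells the two trees apart, and [tl] drops it to recover
    the address. Transistors reuse the codes of inner nodes: wires and transistors are numbered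
    independently. *)
Definition table_diagram : diagram Sigma :=
  mkDiagram
    (fun n => letter (tl (decode n)))
    [top []] [low []]
    (map top (inner up) ++ map bot (inner down))
    (fun n => match decode n with
              | 0 :: al => [top al]
              | _ :: be => map (fun i => low (be ++ [i])) (seq 0 (arity be))
              | [] => []
              end)
    (fun n => match decode n with
              | 0 :: al => map (fun i => top (al ++ [i])) (seq 0 (arity al))
              | _ :: be => [low be]
              | [] => []
              end).

Let D := table_diagram.

Lemma top_inj (al al' : list nat) : top al = top al' -> al = al'.
Proof. intros H; apply code_inj in H; congruence. Qed.

Lemma bot_inj (al al' : list nat) : bot al = bot al' -> al = al'.
Proof. intros H; apply code_inj in H; congruence. Qed.

Lemma top_bot (al be : list nat) : top al <> bot be.
Proof. intros H; apply code_inj in H; congruence. Qed.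

Lemma low_leaf (be al : list nat) : In (be, al) L -> low be = top al.
Proof.
  intros H; unfold low; destruct excluded_middle_informative as [K|K]; [|destruct K; eauto].
  destruct constructive_indefinite_description as [al' H']; simpl; f_equal; eauto.
Qed.

Lemma in_down (be : list nat) : In be down <-> exists al, In (be, al) L.
Proof.
  unfold down; rewrite in_map_iff; split.
  - intros ([be' al] & <- & H); eauto.
  - intros [al H]; exists (be, al); auto.
Qed.

Lemma in_up (al : list nat) : In al up <-> exists be, In (be, al) L.
Proof.
  unfold up; rewrite in_map_iff; split.
  - intros ([be al'] & <- & H); eauto.
  - intros [be H]; exists (be, al); auto.
Qed.

Lemma low_inner (be : list nat) : In be (inner down) -> low be = bot be.
Proof.
  intros H; unfold low; destruct excluded_middle_informative as [K|K]; [exfalso|reflexivity].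
  apply (inner_not_code Hdown _ H), in_down, K.
Qed.

Lemma table_ttop_top (al : list nat) : ttop D (top al) = [top al].
Proof. unfold D, top; cbn [ttop table_diagram]; rewrite decode_code; reflexivity. Qed.

Lemma table_tbot_top (al : list nat) : tbot D (top al) = child_wires top al.
Proof. unfold D, top at 1; cbn [tbot table_diagram]; rewrite decode_code; reflexivity. Qed.

Lemma table_ttop_bot (be : list nat) : ttop D (bot be) = child_wires low be.
Proof. unfold D, bot; cbn [ttop table_diagram]; rewrite decode_code; reflexivity. Qed.

Lemma table_tbot_bot (be : list nat) : tbot D (bot be) = [low be].
Proof. unfold D, bot; cbn [tbot table_diagram]; rewrite decode_code; reflexivity. Qed.

Lemma table_label_top (al : list nat) : dlab D (top al) = letter al.
Proof. unfold D, top; cbn [dlab table_diagram]; rewrite decode_code; reflexivity. Qed.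

Lemma table_label_low (be : list nat) : node (C := down) be ->
  dlab D (low be) = letter be.
Proof.
  intros [H|H].
  - apply in_down in H as [al H]; rewrite (low_leaf _ _ H), table_label_top.
    destruct (Hletter _ _ H) as (a & H1 & H2).
    rewrite (letter_walk _ _ H1), (letter_walk _ _ H2); reflexivity.
  - rewrite (low_inner _ H); unfold D, bot; cbn [dlab table_diagram]; rewrite decode_code; reflexivity.
Qed.

Lemma table_labels_up (al : list nat) :
  map (dlab D) (tbot D (top al)) = map (fun i => letter (al ++ [i])) (seq 0 (arity al)).
Proof.
  rewrite table_tbot_top; unfold child_wires; rewrite map_map; apply map_ext; intros; apply table_label_top.
Qed.

Lemma table_labels_down (be : list nat) : In be (inner down) ->
  map (dlab D) (ttop D (bot be)) = map (fun i => letter (be ++ [i])) (seq 0 (arity be)).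
Proof.
  intros H; rewrite table_ttop_bot; unfold child_wires; rewrite map_map; apply map_ext_in.
  intros i Hi; apply in_seq in Hi; apply table_label_low, (inner_arity Hdown); auto; lia.
Qed.

Lemma in_table_trans (t : nat) : In t (dtrs D) <->
  (exists al, In al (inner up) /\ t = top al) \/ (exists be, In be (inner down) /\ t = bot be).
Proof.
  unfold D; cbn [dtrs table_diagram]; rewrite in_app_iff, !in_map_iff.
  split; (intros [(al & H1 & H2)|(al & H1 & H2)]; [left|right]; exists al; auto).
Qed.

Lemma low_inj (be be' : list nat) :
  node (C := down) be -> node (C := down) be' -> low be = low be' -> be = be'.
Proof.
  intros H H' E.
  destruct H as [H|H]; [apply in_down in H as [al H]; rewrite (low_leaf _ _ H) in E|rewrite (low_inner _ H) in E];
  (destruct H' as [H'|H']; [apply in_down in H' as [al' H']; rewrite (low_leaf _ _ H') in E|rewrite (low_inner _ H') in E]).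
  - apply top_inj in E as <-; eauto.
  - apply top_bot in E as [].
  - symmetry in E; apply top_bot in E as [].
  - apply bot_inj in E; exact E.
Qed.

Lemma low_top_inner (be al : list nat) :
  node (C := down) be -> In al (inner up) -> low be <> top al.
Proof.
  intros [H|H] Hal E.
  - apply in_down in H as [al' H]; rewrite (low_leaf _ _ H) in E; apply top_inj in E as ->.
    apply (inner_not_code Hup _ Hal), in_up; eauto.
  - rewrite (low_inner _ H) in E; symmetry in E; apply top_bot in E as [].
Qed.

Definition height : nat := S (list_max (map (@length nat) (inner up ++ inner down))).

Lemma inner_height (al : list nat) : In al (inner up) \/ In al (inner down) -> length al < height.
Proof.
  intros H; assert (length al <= list_max (map (@length nat) (inner up ++ inner down))); [|unfold height; lia].
  apply list_max_ge, in_map, in_or_app; exact H.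
Qed.

(** It drops on the way up, which excludes cycles. Depths are below [height], so every merge has
    rank above [height] and every split has rank below it. *)
Definition rank (t : nat) : nat :=
  match decode t with
  | 0 :: al => length al
  | _ :: be => height + height - length be
  | [] => 0
  end.

Lemma rank_top (al : list nat) : rank (top al) = length al.
Proof. unfold rank, top; rewrite decode_code; reflexivity. Qed.

Lemma rank_bot (be : list nat) : rank (bot be) = height + height - length be.
Proof. unfold rank, bot; rewrite decode_code; reflexivity. Qed.

Lemma table_rank (t t' : nat) : clos_trans nat (tprec D) t t' -> rank t' < rank t.
Proof.
  induction 1 as [t t' (H1 & H2 & j & H3 & H4)|]; [|lia].
  apply in_table_trans in H1 as [(al & H1 & ->)|(be & H1 & ->)];
    apply in_table_trans in H2 as [(al' & H2 & ->)|(be' & H2 & ->)];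
    rewrite ?rank_top, ?rank_bot; [| | |];
    try (pose proof (inner_height _ (or_introl H1)));
    try (pose proof (inner_height _ (or_introl H2)));
    try (pose proof (inner_height _ (or_intror H1)));
    try (pose proof (inner_height _ (or_intror H2))).
  - rewrite table_tbot_top in H3; apply (in_child_wires Hup _ _ _ H2) in H3 as (i & -> & _).
    rewrite table_ttop_top in H4; destruct H4 as [H4|[]]; apply top_inj in H4 as ->.
    rewrite length_app; simpl; lia.
  - rewrite table_ttop_top in H4; rewrite table_tbot_bot, (low_inner _ H2) in H3.
    destruct H3 as [<-|[]], H4 as [H4|[]]; apply top_bot in H4 as [].
  - lia.
  - rewrite table_tbot_bot in H3; destruct H3 as [<-|[]].
    rewrite table_ttop_bot in H4; apply (in_child_wires Hdown _ _ _ H1) in H4 as (i & E & Hi).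
    apply low_inj in E; [|right; assumption|exact Hi].
    subst be'; rewrite length_app in *; cbn [length] in *; lia.
Qed.

Lemma table_wire_tops : wire_tops D = tree_wires (C := up) top ++ map low (inner down).
Proof.
  unfold wire_tops; change (dtrs D) with (map top (inner up) ++ map bot (inner down)).
  rewrite map_app, concat_app, !map_map, (map_ext _ _ table_tbot_top), (map_ext _ _ table_tbot_bot).
  rewrite concat_singletons; reflexivity.
Qed.

Lemma table_wire_bots :
  Permutation (wire_bots D) (tree_wires (C := down) low ++ map top (inner up)).
Proof.
  unfold wire_bots; change (dtrs D) with (map top (inner up) ++ map bot (inner down)).
  rewrite map_app, concat_app, !map_map, (map_ext _ _ table_ttop_top), (map_ext _ _ table_ttop_bot).
  rewrite concat_singletons; constructor; apply Permutation_app_comm.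
Qed.

Lemma valid_table : valid Rel [x] [x] D.
Proof.
  assert (Nt : NoDup (dtrs D)).
  { unfold D; cbn [dtrs table_diagram]; apply NoDup_app_iff; split; [|split].
    - apply NoDup_map_NoDup_ForallPairs; [intros al al' _ _; apply top_inj|apply NoDup_nodup].
    - apply NoDup_map_NoDup_ForallPairs; [intros al al' _ _; apply bot_inj|apply NoDup_nodup].
    - intros t H1 H2; apply in_map_iff in H1 as (al & <- & _), H2 as (be & E & _).
      symmetry in E; apply top_bot in E as []. }
  split; [exact Nt|split; [|split; [|split; [|split; [|split; [|split; [|split]]]]]]].
  - rewrite table_wire_tops; apply NoDup_app_iff; split; [|split].
    + apply (tree_wires_NoDup Hup); intros al be _ _; apply top_inj.
    + apply NoDup_map_NoDup_ForallPairs; [|apply NoDup_nodup].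
      intros be be' H H'; apply low_inj; right; assumption.
    + intros j H1 H2; apply (in_tree_wires Hup) in H1 as (al & _ & ->).
      apply in_map_iff in H2 as (be & E & H2); rewrite (low_inner _ H2) in E.
      symmetry in E; apply top_bot in E as [].
  - apply (Permutation_NoDup (Permutation_sym table_wire_bots)), NoDup_app_iff; split; [|split].
    + apply (tree_wires_NoDup Hdown), low_inj.
    + apply NoDup_map_NoDup_ForallPairs; [intros al al' _ _; apply top_inj|apply NoDup_nodup].
    + intros j H1 H2; apply (in_tree_wires Hdown) in H1 as (be & Hbe & ->).
      apply in_map_iff in H2 as (al & E & H2); symmetry in E; exact (low_top_inner _ _ Hbe H2 E).
  - intros j; rewrite table_wire_tops, (Permutation_in' eq_refl table_wire_bots), !in_app_iff.
    rewrite (in_tree_wires Hup), (in_tree_wires Hdown), !in_map_iff; split.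
    + intros [(al & [H|H] & ->)|(be & <- & H)].
      * left; apply in_up in H as [be H]; exists be; rewrite (low_leaf _ _ H).
        split; [left; apply in_down; eauto|reflexivity].
      * right; eauto.
      * left; exists be; split; [right; exact H|reflexivity].
    + intros [(be & [H|H] & ->)|(al & <- & H)].
      * left; apply in_down in H as [al H]; exists al; rewrite (low_leaf _ _ H).
        split; [left; apply in_up; eauto|reflexivity].
      * right; eauto.
      * left; exists al; split; [right; exact H|reflexivity].
  - discriminate.
  - change ([dlab D (top [])] = [x]); rewrite table_label_top; f_equal.
    apply letter_walk; constructor.
  - change ([dlab D (low [])] = [x]); rewrite table_label_low by apply (nil_code_or_inner Hdown).
    f_equal; apply letter_walk; constructor.
  - intros t Ht; apply in_table_trans in Ht as [(al & Ht & ->)|(be & Ht & ->)]; [left|right].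
    + rewrite table_ttop_top; cbn [map]; rewrite table_label_top, table_labels_up.
      apply (inner_rel Hup); exact Ht.
    + rewrite table_tbot_bot; cbn [map]; rewrite table_label_low, table_labels_down by (exact Ht || (right; exact Ht)).
      apply (inner_rel Hdown); exact Ht.
  - intros t Ht; apply table_rank in Ht; lia.
Qed.

Lemma flow_table_top (al : list nat) (p : point) :
  In al up \/ In al (inner up) -> flow Rel D (top al) p (papp al p).
Proof.
  revert p; induction al as [|i al IH] using rev_ind; intros p H; [apply flow_top; reflexivity|].
  pose proof (parent_inner _ _ H) as H'; rewrite papp_snoc.
  apply (flow_step _ _ (top al) _ _ (top al) (pcons i p)); [apply in_table_trans; eauto| |auto].
  apply step_split; [apply table_ttop_top| |].
  - rewrite table_label_top, table_labels_up; apply (inner_rel Hup); exact H'.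
  - rewrite table_tbot_top; apply (nth_child_wires Hup); assumption.
Qed.

Lemma flow_table_low (ga be : list nat) (p q : point) :
  In (be ++ ga) down -> flow Rel D (low (be ++ ga)) p q -> flow Rel D (low be) (papp ga p) q.
Proof.
  revert be; induction ga as [|i ga IH]; intros be H Hf; [rewrite app_nil_r in Hf; exact Hf|].
  assert (Hin : In be (inner down)) by (apply in_inner; eauto).
  replace (be ++ i :: ga) with ((be ++ [i]) ++ ga) in * by (rewrite <- app_assoc; reflexivity).
  apply (flow_step _ _ (bot be) _ _ (low (be ++ [i])) (papp ga p)); [apply in_table_trans; eauto| |auto].
  assert (Hi : node (C := down) (be ++ [i])).
  { destruct ga as [|k ga]; [rewrite app_nil_r in H; left; exact H|].
    right; apply in_inner; eauto. }
  apply step_merge; [apply table_tbot_bot| |].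
  - rewrite table_label_low, table_labels_down by (exact Hin || (right; exact Hin)).
    apply (inner_rel Hdown); exact Hin.
  - rewrite table_ttop_bot; apply (nth_child_wires Hdown); assumption.
Qed.

Lemma table_sem (be al : list nat) (p : point) : In (be, al) L -> sem Rel D (papp be p) (papp al p).
Proof.
  intros H; exists (low []); split; [reflexivity|].
  apply (flow_table_low be []); [apply in_down; eauto|]; simpl.
  rewrite (low_leaf _ _ H); apply flow_table_top; left; apply in_up; eauto.
Qed.

End Table.

(** * From a local bijection to a finite table *)

Section Realize.
Context (g : point -> point)
  (Ginj : forall p q, ok Rel x p -> ok Rel x q -> g p = g q -> p = q)
  (Gsurj : forall q, ok Rel x q -> exists p, ok Rel x p /\ g p = q).

Definition local_pair (be al : list nat) : Prop :=
  exists a, walk Rel x be a /\ walk Rel x al a /\ forall r, ok Rel a r -> g (papp be r) = papp al r.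

Context (Gloc : forall p, ok Rel x p ->
  exists be al r, local_pair be al /\ p = papp be r).

Lemma local_table (be : list nat) (a : Sigma) :
  barred Rel (fun be => exists al, local_pair be al) be a -> walk Rel x be a ->
  exists L : list (list nat * list nat),
    (forall c, In c L -> local_pair (fst c) (snd c) /\ exists ga, fst c = be ++ ga) /\
    (forall r, ok Rel a r -> exists c s, In c L /\ papp be r = papp (fst c) s) /\
    (forall c c' ga, In c L -> In c' L -> fst c' = fst c ++ ga -> c = c').
Proof.
  intros Hbar Hw0; revert be a Hbar Hw0.
  (* The walk to [be] moves under the existential quantifier, because [barred_list] builds the list
     for all nodes at once. *)
  cut (forall be a, barred Rel (fun be => exists al, local_pair be al) be a ->
    exists L : list (list nat * list nat), walk Rel x be a ->
    (forall c, In c L -> local_pair (fst c) (snd c) /\ exists ga, fst c = be ++ ga) /\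
    (forall r, ok Rel a r -> exists c s, In c L /\ papp be r = papp (fst c) s) /\
    (forall c c' ga, In c L -> In c' L -> fst c' = fst c ++ ga -> c = c')).
  { intros H be a Hbar Hw; destruct (H be a Hbar) as [L HL]; exists L; auto. }
  apply barred_list.
  - intros be a [al H]; exists [(be, al)]; intros _; split; [|split].
    + intros c [<-|[]]; split; [exact H|exists []; symmetry; apply app_nil_r].
    + intros r _; exists (be, al), r; simpl; auto.
    + intros c c' ga [<-|[]] [<-|[]] _; reflexivity.
  - intros be a w F Hr IH Hw.
    assert (HF := fun i b Hi => IH i b Hi (walk_snoc _ _ _ _ _ _ _ Hw Hr Hi)); clear IH.
    split; [|split].
    + intros c Hc; apply in_concat_seq in Hc as (i & b & Hi & Hc).
      destruct (proj1 (HF i b Hi) c Hc) as [H2 [ga H3]]; split; [exact H2|].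
      exists (i :: ga); rewrite H3, <- app_assoc; reflexivity.
    + intros r Hor; destruct (ok_inv Rel TL _ _ _ Hr Hor) as (i & b & q & -> & Hi & Hq).
      destruct (HF i b Hi) as (_ & H2 & _); destruct (H2 q Hq) as (c & s & Hc & E).
      exists c, s; split; [apply in_concat_seq; eauto|rewrite <- papp_snoc; exact E].
    + intros c c' ga Hc Hc' E.
      apply in_concat_seq in Hc as (i & b & Hi & Hc), Hc' as (i' & b' & Hi' & Hc').
      destruct (proj1 (HF i b Hi) c Hc) as [_ [de H4]].
      destruct (proj1 (HF i' b' Hi') c' Hc') as [_ [de' H4']].
      assert (i = i') as <-; [|destruct (HF i b Hi) as (_ & _ & H3); eauto].
      rewrite H4, H4', <- !app_assoc in E; apply app_inv_head in E.
      apply (f_equal (hd 0)) in E; symmetry; exact E.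
Qed.

Lemma sem_realize : exists D, valid Rel [x] [x] D /\ forall p, ok Rel x p -> sem Rel D p (g p).
Proof.
  destruct (local_table [] x) as (L & H1 & H2 & H3); [|constructor|].
  { apply (fan_theorem Rel TL x).
    - intros p Hp; destruct (Gloc p Hp) as (be & al & r & Hl & ->).
      pose proof Hl as (a & Hw & _); exists be, a, r; eauto.
    (* A prefix replacement restricts to longer prefixes: the same word [ga] is appended on both
       sides. *)
    - intros be ga b [al (a & W1 & W2 & Hg)] Hw; apply walk_app_inv in Hw as (a' & W3 & W4).
      rewrite (walk_det Rel TL _ _ _ _ W3 W1) in W4.
      exists (al ++ ga), b; split; [exact (walk_app Rel _ _ _ _ _ W1 W4)|].
      split; [exact (walk_app Rel _ _ _ _ _ W2 W4)|].
      intros r Hr; rewrite !papp_app; apply Hg; eapply ok_papp; eauto. }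
  assert (Hc : forall be al, In (be, al) L -> local_pair be al).
  { intros be al H; exact (proj1 (H1 _ H)). }
  assert (Hcomp : forall p, ok Rel x p -> exists be al r, In (be, al) L /\ p = papp be r).
  { intros p Hp; destruct (H2 p Hp) as ([be al] & r & K1 & K2); exists be, al, r; auto. }
  (* Comparable targets have comparable sources, by injectivity of [g]. *)
  assert (Hanti : forall be al be' al' ga, In (be, al) L -> In (be', al') L -> al' = al ++ ga ->
            (be, al) = (be', al')).
  { intros be al be' al' ga K K' ->.
    destruct (Hc _ _ K) as (a & W1 & W2 & Hg); destruct (Hc _ _ K') as (a' & W1' & W2' & Hg').
    apply walk_app_inv in W2' as (a1 & W3 & W4); rewrite (walk_det Rel TL _ _ _ _ W3 W2) in W4.
    assert (E : papp be (papp ga (fun _ => 0)) = papp be' (fun _ => 0)).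
    { pose proof (ok_zero Rel TL a') as Z; pose proof (proj2 (ok_papp Rel TL _ _ _ _ W4) Z) as Z'.
      apply Ginj.
      - apply (ok_papp Rel TL _ _ _ _ W1); exact Z'.
      - apply (ok_papp Rel TL _ _ _ _ W1'); exact Z.
      - rewrite Hg, Hg', papp_app by assumption; reflexivity. }
    destruct (papp_comparable _ _ _ _ E) as [de [[F _]|[F _]]].
    - symmetry; exact (H3 _ _ de K' K F).
    - exact (H3 _ _ de K K' F). }
  assert (Hdown : complete_code (map fst L)).
  { constructor.
    - intros be H; apply in_map_iff in H as ([be' al] & <- & H).
      destruct (Hc _ _ H) as (a & W & _); exists a; exact W.
    - intros be ga H H'; apply in_map_iff in H as (c & <- & H), H' as (c' & E & H').
      rewrite (H3 _ _ _ H H' E) in E; rewrite <- (app_nil_r (fst c')) in E at 1.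
      apply app_inv_head in E; auto.
    - intros p Hp; destruct (Hcomp p Hp) as (be & al & r & K1 & K2); exists be, r; split; [|exact K2].
      apply in_map_iff; exists (be, al); auto. }
  assert (Hup : complete_code (map snd L)).
  { constructor.
    - intros al H; apply in_map_iff in H as ([be al'] & <- & H).
      destruct (Hc _ _ H) as (a & _ & W & _); exists a; exact W.
    - intros al ga H H'; apply in_map_iff in H as ([be al1] & E1 & H), H' as ([be' al2] & E2 & H').
      simpl in E1, E2; subst al1 al2.
      pose proof (Hanti _ _ _ _ ga H H' eq_refl) as E; injection E as _ E.
      rewrite <- (app_nil_r al) in E at 1; apply app_inv_head in E; auto.
    - intros q Hq; destruct (Gsurj q Hq) as (p & Hp & <-).
      destruct (Hcomp p Hp) as (be & al & r & K1 & ->); exists al, r; split.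
      + apply in_map_iff; exists (be, al); auto.
      + destruct (Hc _ _ K1) as (a & W1 & _ & Hg); apply Hg; apply (ok_papp Rel TL _ _ _ _ W1); exact Hp. }
  assert (Hletter : forall be al, In (be, al) L -> exists a, walk Rel x be a /\ walk Rel x al a).
  { intros be al H; destruct (Hc _ _ H) as (a & W1 & W2 & _); eauto. }
  assert (Hfun : forall be al al', In (be, al) L -> In (be, al') L -> al = al').
  { intros be al al' H H'; pose proof (H3 _ _ [] H H' (eq_sym (app_nil_r be))); congruence. }
  exists (table_diagram L); split.
  - apply valid_table; auto; intros be be' al H H'.
    pose proof (Hanti _ _ _ _ [] H H' (eq_sym (app_nil_r al))); congruence.
  - intros p Hp; destruct (Hcomp p Hp) as (be & al & r & K1 & ->).
    destruct (Hc _ _ K1) as (a & W1 & W2 & Hg).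
    rewrite Hg by (apply (ok_papp Rel TL _ _ _ _ W1); exact Hp).
    apply table_sem; auto.
Qed.

End Realize.
End Codes.

(** * Ultrametric spaces coded by paths *)

Section Coded.
Context {Sigma : Type} (Rel : list Sigma -> list Sigma -> Prop) (x : Sigma).
Context {X : Type} (d : X -> X -> R) (Sim : (X -> Prop) -> (X -> Prop) -> (X -> X) -> Prop)
  (pi : point -> X).

Definition cylinder (al : list nat) (a : Sigma) (B : X -> Prop) : Prop :=
  forall z, B z <-> exists p, ok Rel a p /\ pi (papp al p) = z.

(** The common ground of the two halves: paths enumerate the points without repetition, and [Sim]
    contains all prefix replacements between cylinders of the same letter and nothing else. *)
Record coded : Prop := {
  coded_inj : forall p q, ok Rel x p -> ok Rel x q -> pi p = pi q -> p = q;
  coded_surj : forall z, exists p, ok Rel x p /\ pi p = z;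
  coded_ball : forall B, is_ball d B <-> exists al a, walk Rel x al a /\ cylinder al a B;
  coded_sim : forall B1 B2 f, Sim B1 B2 f <-> exists al be a,
    walk Rel x al a /\ walk Rel x be a /\ cylinder al a B1 /\ cylinder be a B2 /\
    forall p, ok Rel a p -> f (pi (papp al p)) = pi (papp be p) }.

Context (TL : tree_like Rel) (HC : coded) (HS : finite_sim_structure d Sim)
  (HU : is_ultrametric d).

(** Every point of an ultrametric ball is a centre, so the radius of the ball itself works. *)
Lemma ball_open (B : X -> Prop) (z : X) : is_ball d B -> B z ->
  exists r, (0 < r)%R /\ forall y, (d z y < r)%R -> B y.
Proof.
  intros (c & r & Hr & HB) Hz; exists r; split; [exact Hr|]; intros y Hy.
  destruct HU as (_ & _ & _ & H); apply HB in Hz; apply HB.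
  apply Rle_trans with (1 := H c z y); apply Rmax_lub; lra.
Qed.

Lemma local_sim_continuous (g : X -> X) :
  (forall z, exists B, is_ball d B /\ B z /\ Sim B (image g B) g) -> continuous d g.
Proof.
  intros H z e He; destruct (H z) as (B & HB & Hz & Hs).
  destruct (proj1 HS _ _ _ Hs) as (_ & _ & _ & _ & lam & Hlam & Hd).
  destruct (ball_open B z HB Hz) as (r & Hr & Hball).
  (* Within [r] the points stay in the ball, where [g] scales distances by [lam]. For the inverse
     below, the bound becomes [lam * e]. *)
  exists (Rmin r (e / lam)); split.
  - apply Rmin_pos; [exact Hr|apply Rdiv_lt_0_compat; assumption].
  - intros y Hy; assert (d z y < r)%R by (eapply Rlt_le_trans; [exact Hy|apply Rmin_l]).
    assert (d z y < e / lam)%R as Hy' by (eapply Rlt_le_trans; [exact Hy|apply Rmin_r]).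
    rewrite Hd by auto; apply (Rmult_lt_compat_l lam) in Hy'; [|exact Hlam].
    replace (lam * (e / lam))%R with e in Hy' by (field; lra); exact Hy'.
Qed.

Lemma local_sim_inverse_continuous (g h : X -> X) :
  (forall z, h (g z) = z) -> (forall z, g (h z) = z) ->
  (forall z, exists B, is_ball d B /\ B z /\ Sim B (image g B) g) -> continuous d h.
Proof.
  intros Hhg Hgh H z e He; destruct (H (h z)) as (B & HB & Hz & Hs).
  destruct (proj1 HS _ _ _ Hs) as (_ & HgB & _ & _ & lam & Hlam & Hd).
  destruct (ball_open (image g B) z HgB) as (r & Hr & Hball); [exists (h z); auto|].
  exists (Rmin r (lam * e)); split.
  - apply Rmin_pos; [exact Hr|apply Rmult_lt_0_compat; assumption].
  - intros y Hy; assert (d z y < r)%R as Hyr by (eapply Rlt_le_trans; [exact Hy|apply Rmin_l]).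
    assert (d z y < lam * e)%R as Hy' by (eapply Rlt_le_trans; [exact Hy|apply Rmin_r]).
    destruct (Hball _ Hyr) as (y' & By' & <-); rewrite Hhg.
    rewrite <- (Hgh z), Hd in Hy' by auto.
    apply Rmult_lt_reg_l in Hy'; assumption.
Qed.

Definition local_on_codes (g : X -> X) : Prop :=
  forall p, ok Rel x p -> exists be al a r,
    walk Rel x be a /\ walk Rel x al a /\ p = papp be r /\
    forall r', ok Rel a r' -> g (pi (papp be r')) = pi (papp al r').

Lemma gamma_local (g : X -> X) : in_Gamma d Sim g -> local_on_codes g.
Proof.
  intros [_ Hg] p Hp; destruct (Hg (pi p)) as (B & _ & Hz & _ & Hs).
  apply (coded_sim HC) in Hs as (al & be & a & H1 & H2 & H3 & _ & H5).
  destruct (proj1 (H3 _) Hz) as (r & Hr & E); exists al, be, a, r; repeat split; auto.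
  symmetry; apply (coded_inj HC); auto; apply (ok_papp Rel TL _ _ _ _ H1); exact Hr.
Qed.

(** The inverse is given explicitly, since [in_Gamma] asks for a homeomorphism; continuity both ways
    follows from the local similarities. *)
Lemma local_gamma (g h : X -> X) :
  (forall z, h (g z) = z) -> (forall z, g (h z) = z) -> local_on_codes g -> in_Gamma d Sim g.
Proof.
  intros Hhg Hgh Hl.
  assert (Hb : forall z, exists B, is_ball d B /\ B z /\ is_ball d (image g B) /\ Sim B (image g B) g).
  { intros z; destruct (coded_surj HC z) as (p & Hp & <-).
    destruct (Hl p Hp) as (be & al & a & r & H1 & H2 & -> & H3).
    pose (B := fun z => exists p, ok Rel a p /\ pi (papp be p) = z).
    assert (C1 : cylinder be a B) by (intros z; reflexivity).
    assert (C2 : cylinder al a (image g B)).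
    { intros z; split.
      - intros (y & (q & Hq & <-) & <-); exists q; split; [exact Hq|symmetry; auto].
      - intros (q & Hq & <-); exists (pi (papp be q)); split; [exists q; auto|auto]. }
    exists B; split; [apply (coded_ball HC); eauto|split; [|split; [apply (coded_ball HC); eauto|]]].
    - exists r; split; [|reflexivity]; apply (ok_papp Rel TL _ _ _ _ H1); exact Hp.
    - apply (coded_sim HC); exists be, al, a; auto. }
  assert (Hb' : forall z, exists B, is_ball d B /\ B z /\ Sim B (image g B) g).
  { intros z; destruct (Hb z) as (B & H1 & H2 & _ & H3); eauto. }
  split; [|exact Hb]; exists h; repeat split; auto.
  - apply local_sim_continuous; exact Hb'.
  - apply (local_sim_inverse_continuous g); auto.
Qed.

Definition code_of (z : X) : point := epsilon (inhabits (fun _ => 0)) (fun p => ok Rel x p /\ pi p = z).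

Lemma code_of_spec (z : X) : ok Rel x (code_of z) /\ pi (code_of z) = z.
Proof. unfold code_of; apply epsilon_spec, (coded_surj HC). Qed.

Lemma code_of_pi (p : point) : ok Rel x p -> code_of (pi p) = p.
Proof.
  intros Hp; destruct (code_of_spec (pi p)) as [H1 H2]; apply (coded_inj HC); auto.
Qed.

(** The relation [sem] made into a function on points by choice; for valid diagrams totality and
    determinism leave nothing to choose. *)
Definition action (D : diagram Sigma) (z : X) : X :=
  pi (epsilon (inhabits (code_of z)) (sem Rel D (code_of z))).

Lemma action_sem (D : diagram Sigma) (p q : point) :
  valid Rel [x] [x] D -> ok Rel x p -> sem Rel D p q -> action D (pi p) = pi q.
Proof.
  intros V Hp H; unfold action; rewrite code_of_pi by exact Hp; f_equal.
  eapply (sem_det Rel TL V); [|exact H]; apply epsilon_spec; eauto.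
Qed.

Lemma action_flip (D : diagram Sigma) (z : X) :
  valid Rel [x] [x] D -> action (flip D) (action D z) = z.
Proof.
  intros V; destruct (coded_surj HC z) as (p & Hp & <-).
  destruct (sem_total Rel TL V p Hp) as [q Hq].
  rewrite (action_sem D p q V Hp Hq).
  apply (action_sem (flip D) q p (valid_flip _ _ _ _ V)).
  - apply (sem_ok Rel TL V p q Hq); exact Hp.
  - apply (sem_flip Rel V); exact Hq.
Qed.

Lemma action_eq (D D' : diagram Sigma) : valid Rel [x] [x] D -> valid Rel [x] [x] D' ->
  deq Rel [x] D D' <-> Gamma_eq (action D) (action D').
Proof.
  intros V V'; split.
  - intros H z; apply (deq_sem Rel TL) in H; destruct (coded_surj HC z) as (p & Hp & <-).
    destruct (sem_total Rel TL V p Hp) as [q Hq].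
    rewrite (action_sem D p q V Hp Hq); symmetry; apply action_sem; auto; apply H; auto.
  - intros H; apply (sem_complete Rel TL x); auto; apply (sem_eq_of_incl Rel TL); auto.
    intros p q Hp Hq; destruct (sem_total Rel TL V' p Hp) as [q' Hq'].
    replace q with q'; [exact Hq'|]; apply (coded_inj HC).
    + apply (sem_ok Rel TL V' p q' Hq'); exact Hp.
    + apply (sem_ok Rel TL V p q Hq); exact Hp.
    + rewrite <- (action_sem D p q V Hp Hq), <- (action_sem D' p q' V' Hp Hq'); symmetry; apply H.
Qed.

Lemma action_gamma (D : diagram Sigma) : valid Rel [x] [x] D -> in_Gamma d Sim (action D).
Proof.
  intros V; apply (local_gamma _ (action (flip D))).
  - intros z; apply action_flip, V.
  - intros z; pose proof (action_flip (flip D) z (valid_flip _ _ _ _ V)) as H.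
    rewrite flip_flip in H; exact H.
  - intros p Hp; destruct (sem_total Rel TL V p Hp) as [q Hq].
    destruct (sem_local Rel TL V p q Hq) as (be & al & a & r & H1 & H2 & H3 & _ & H5).
    exists be, al, a, r; repeat split; auto; intros r' Hr'.
    apply action_sem; auto; eapply ok_papp; eauto.
Qed.

Lemma action_surj (g : X -> X) : in_Gamma d Sim g ->
  exists D, valid Rel [x] [x] D /\ Gamma_eq (action D) g.
Proof.
  intros Hg; pose proof (gamma_local g Hg) as Hl.
  destruct Hg as [(h & Hhg & Hgh & _) _].
  assert (Hcode : forall p, ok Rel x (code_of (g (pi p))) /\ pi (code_of (g (pi p))) = g (pi p))
    by (intros; apply code_of_spec).
  (* The homeomorphism is transported to paths through the bijection between paths and points. *)
  destruct (sem_realize Rel TL x (fun p => code_of (g (pi p)))) as (D & V & HD).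
  - intros p q Hp Hq E; apply (coded_inj HC); auto.
    apply (f_equal pi) in E; rewrite !(proj2 (Hcode _)) in E.
    rewrite <- (Hhg (pi p)), E; apply Hhg.
  - intros q Hq; exists (code_of (h (pi q))); destruct (code_of_spec (h (pi q))) as [H1 H2].
    split; [exact H1|]; rewrite H2, Hgh; apply code_of_pi; exact Hq.
  - intros p Hp; destruct (Hl p Hp) as (be & al & a & r & H1 & H2 & H3 & H4).
    exists be, al, r; split; [|exact H3]; exists a; split; [exact H1|split; [exact H2|]].
    intros r' Hr'; rewrite H4 by exact Hr'; apply code_of_pi; eapply ok_papp; eauto.
  - exists D; split; [exact V|]; intros z; destruct (coded_surj HC z) as (p & Hp & <-).
    rewrite (action_sem D p _ V Hp (HD p Hp)); apply Hcode.
Qed.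

Lemma action_concat (D D' : diagram Sigma) :
  valid Rel [x] [x] D -> valid Rel [x] [x] D' ->
  Gamma_eq (action (concat_diag D D')) (Gamma_op (action D) (action D')).
Proof.
  intros V V' z; destruct (coded_surj HC z) as (p & Hp & <-); unfold Gamma_op.
  destruct (sem_total Rel TL V' p Hp) as [q Hq].
  pose proof (proj1 (sem_ok Rel TL V' p q Hq) Hp) as Hokq.
  destruct (sem_total Rel TL V q Hokq) as [r Hr].
  rewrite (action_sem D' p q V' Hp Hq), (action_sem D q r V Hokq Hr).
  apply action_sem; [apply valid_concat; assumption|exact Hp|].
  eapply (concat_sem Rel V V'); eauto.
Qed.

Theorem coded_iso :
  group_iso (valid Rel [x] [x]) (deq Rel [x]) concat_diag (in_Gamma d Sim) Gamma_eq Gamma_op.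
Proof.
  exists action; split; [|split; [|split]].
  - exact action_gamma.
  - exact action_eq.
  - exact action_surj.
  - exact action_concat.
Qed.

(** [group_iso] is directed, so the first half needs a map from homeomorphisms to diagrams. It picks
    a preimage under [action], and is multiplicative because [action] is multiplicative and
    injective up to [deq]. *)
Theorem coded_iso_inverse :
  group_iso (in_Gamma d Sim) Gamma_eq Gamma_op (valid Rel [x] [x]) (deq Rel [x]) concat_diag.
Proof.
  destruct (classic (exists D, valid Rel [x] [x] D)) as [[D0 V0]|Hno].
  (* A default diagram for the choice operator is obtained by realizing the identity. *)
  2: { exfalso; apply Hno; destruct (action_surj (fun z => z)) as (D & V & _); [|eauto].
       apply (local_gamma _ (fun z => z)); auto.
       intros p Hp; exists [], [], x, p; repeat split; constructor. }
  pose (psi := fun g => epsilon (inhabits D0) (fun D => valid Rel [x] [x] D /\ Gamma_eq (action D) g)).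
  assert (Hpsi : forall g, in_Gamma d Sim g -> valid Rel [x] [x] (psi g) /\ action (psi g) = g).
  { intros g Hg; destruct (epsilon_spec (inhabits D0) _ (action_surj g Hg)) as [H1 H2].
    split; [exact H1|extensionality z; apply H2]. }
  assert (Hop : forall g g', in_Gamma d Sim g -> in_Gamma d Sim g' ->
            action (concat_diag (psi g) (psi g')) = Gamma_op g g').
  { intros g g' Hg Hg'; destruct (Hpsi g Hg) as [V E]; destruct (Hpsi g' Hg') as [V' E'].
    extensionality z; rewrite (action_concat _ _ V V' z), E, E'; reflexivity. }
  assert (Hcl : forall g g', in_Gamma d Sim g -> in_Gamma d Sim g' ->
            valid Rel [x] [x] (concat_diag (psi g) (psi g')) /\ in_Gamma d Sim (Gamma_op g g')).
  { intros g g' Hg Hg'; destruct (Hpsi g Hg) as [V E]; destruct (Hpsi g' Hg') as [V' E'].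
    rewrite <- (Hop g g' Hg Hg'); split; [|apply action_gamma]; apply valid_concat; assumption. }
  exists psi; split; [|split; [|split]].
  - intros g Hg; apply Hpsi, Hg.
  - intros g g' Hg Hg'; destruct (Hpsi g Hg) as [V E]; destruct (Hpsi g' Hg') as [V' E'].
    rewrite (action_eq _ _ V V'), E, E'; reflexivity.
  - intros D V; exists (action D); split; [apply action_gamma, V|].
    destruct (Hpsi _ (action_gamma D V)) as [V' E]; apply action_eq; auto.
    rewrite E; intros z; reflexivity.
  - intros g g' Hg Hg'; destruct (Hcl g g' Hg Hg') as [V Hgg]; destruct (Hpsi _ Hgg) as [V' E].
    apply action_eq; auto; rewrite E, (Hop g g' Hg Hg'); intros z; reflexivity.
Qed.

End Coded.

(** * The space of paths *)

Definition agree (n : nat) (p q : point) : Prop := forall m, m < n -> p m = q m.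

Lemma first_difference (p q : point) : p <> q -> exists n, agree n p q /\ p n <> q n.
Proof.
  intros H; assert (exists n, p n <> q n) as [n Hn].
  { apply NNPP; intros Hno; apply H; extensionality n; apply NNPP; intros Hn; eauto. }
  induction n as [n IH] using Wf_nat.lt_wf_ind.
  destruct (classic (exists m, m < n /\ p m <> q m)) as [(m & H1 & H2)|Hno]; [eauto|].
  exists n; split; [|exact Hn]; intros m Hm; apply NNPP; intros K; apply Hno; eauto.
Qed.

Definition pdist (p q : point) : R :=
  match excluded_middle_informative (p = q) with
  | left _ => 0%R
  | right H => ((/ 2) ^ proj1_sig (constructive_indefinite_description _ (first_difference p q H)))%R
  end.

Lemma half_pow_pos (n : nat) : (0 < (/ 2) ^ n)%R.
Proof. apply pow_lt; lra. Qed.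

Lemma half_pow_le (m n : nat) : ((/ 2) ^ n <= (/ 2) ^ m)%R <-> m <= n.
Proof.
  assert (H : forall k m, ((/ 2) ^ (k + m) <= (/ 2) ^ m)%R).
  { intros k l; induction k as [|k IH]; simpl; [lra|].
    pose proof (half_pow_pos (k + l)); lra. }
  split.
  - intros Hle; destruct (Nat.le_gt_cases m n) as [|Hlt]; [assumption|exfalso].
    specialize (H (m - S n) (S n)); replace (m - S n + S n) with m in H by lia.
    simpl in H; pose proof (half_pow_pos n); lra.
  - intros Hle; specialize (H (n - m) m); replace (n - m + m) with n in H by lia; exact H.
Qed.

Lemma half_pow_small (e : R) : (0 < e)%R -> exists n, ((/ 2) ^ n < e)%R.
Proof.
  intros He; destruct (pow_lt_1_zero (/ 2)) with (y := e) as [n Hn]; [|exact He|].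
  - rewrite Rabs_right; lra.
  - exists n; specialize (Hn n (le_n n)); rewrite Rabs_right in Hn; [exact Hn|].
    left; apply half_pow_pos.
Qed.

Lemma pdist_refl (p : point) : pdist p p = 0%R.
Proof. unfold pdist; destruct excluded_middle_informative; [reflexivity|contradiction]. Qed.

Lemma pdist_first (n : nat) (p q : point) : agree n p q -> p n <> q n -> pdist p q = ((/ 2) ^ n)%R.
Proof.
  intros H1 H2; unfold pdist; destruct excluded_middle_informative as [->|H]; [contradiction|].
  destruct constructive_indefinite_description as (m & H3 & H4); simpl; f_equal.
  destruct (Nat.lt_trichotomy m n) as [K|[K|K]]; [|exact K|]; exfalso; auto.
Qed.

Lemma pdist_cases (p q : point) :
  p = q \/ exists n, agree n p q /\ p n <> q n /\ pdist p q = ((/ 2) ^ n)%R.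
Proof.
  destruct (classic (p = q)) as [|H]; [auto|right].
  destruct (first_difference p q H) as (n & H1 & H2); exists n; auto using pdist_first.
Qed.

Lemma pdist_le (n : nat) (p q : point) : (pdist p q <= (/ 2) ^ n)%R <-> agree n p q.
Proof.
  destruct (pdist_cases p q) as [->|(m & H1 & H2 & ->)].
  - rewrite pdist_refl; pose proof (half_pow_pos n); split; [intros _ m _; reflexivity|lra].
  - rewrite half_pow_le; split.
    + intros H k Hk; apply H1; lia.
    + intros H; destruct (Nat.le_gt_cases n m) as [|K]; [assumption|exfalso; auto].
Qed.

Lemma pdist_nonneg (p q : point) : (0 <= pdist p q)%R.
Proof.
  destruct (pdist_cases p q) as [->|(m & _ & _ & ->)]; [rewrite pdist_refl; lra|].
  left; apply half_pow_pos.
Qed.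

Lemma pdist_zero (p q : point) : pdist p q = 0%R -> p = q.
Proof.
  destruct (pdist_cases p q) as [->|(m & _ & _ & ->)]; [auto|].
  pose proof (half_pow_pos m); lra.
Qed.

Lemma pdist_sym (p q : point) : pdist p q = pdist q p.
Proof.
  destruct (pdist_cases p q) as [->|(m & H1 & H2 & ->)]; [reflexivity|].
  symmetry; apply pdist_first; [intros k Hk; symmetry; auto|auto].
Qed.

Lemma pdist_ultra (p q r : point) : (pdist p r <= Rmax (pdist p q) (pdist q r))%R.
Proof.
  assert (H : forall n, (pdist p q <= (/ 2) ^ n)%R -> (pdist q r <= (/ 2) ^ n)%R ->
              (pdist p r <= (/ 2) ^ n)%R).
  { intros n H1 H2; apply pdist_le in H1, H2; apply pdist_le; intros k Hk.
    rewrite H1, H2 by exact Hk; reflexivity. }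
  destruct (pdist_cases p q) as [->|(m & _ & _ & E)]; [apply Rmax_r|].
  destruct (pdist_cases q r) as [->|(n & _ & _ & F)]; [apply Rmax_l|].
  unfold Rmax; destruct (Rle_dec (pdist p q) (pdist q r)) as [K|K].
  - rewrite F; apply H; rewrite <- F; [exact K|lra].
  - rewrite E; apply H; rewrite <- E; lra.
Qed.

(** The scaling law that makes prefix replacements similarities. *)
Lemma pdist_papp (al : list nat) (p q : point) :
  pdist (papp al p) (papp al q) = ((/ 2) ^ length al * pdist p q)%R.
Proof.
  induction al as [|i al IH]; simpl; [lra|].
  rewrite Rmult_assoc, <- IH.
  destruct (pdist_cases (papp al p) (papp al q)) as [->|(n & H1 & H2 & ->)].
  - rewrite !pdist_refl; lra.
  - rewrite (pdist_first (S n)); [simpl; lra| |exact H2].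
    intros [|k] Hk; [reflexivity|]; apply H1; lia.
Qed.

Lemma agree_papp (al : list nat) (p q : point) :
  agree (length al) (papp al p) q <-> exists s, q = papp al s.
Proof.
  revert q; induction al as [|i al IH]; intros q; simpl.
  - split; [eauto|intros _ m Hm; lia].
  - split.
    + intros H; destruct (proj1 (IH (ptail q))) as [s Hs].
      { intros m Hm; apply (H (S m)); lia. }
      exists s; rewrite <- Hs, <- (pcons_eta q); f_equal; symmetry; apply (H 0); lia.
    + intros [s ->] [|m] Hm; [reflexivity|].
      apply (proj2 (IH (papp al s)) (ex_intro _ s eq_refl)); lia.
Qed.

Definition plt (p q : point) : Prop := exists n, agree n p q /\ p n < q n.

Lemma plt_papp (al : list nat) (p q : point) : plt (papp al p) (papp al q) <-> plt p q.
Proof.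
  induction al as [|i al IH]; simpl; [reflexivity|]; rewrite <- IH; split; intros (n & H1 & H2).
  - destruct n as [|n]; simpl in H2; [lia|].
    exists n; split; [intros m Hm; apply (H1 (S m)); lia|exact H2].
  - exists (S n); split; [|exact H2]; intros [|m] Hm; [reflexivity|]; apply H1; lia.
Qed.

Lemma plt_irrefl (p : point) : ~ plt p p.
Proof. intros (n & _ & H); lia. Qed.

Lemma plt_trans (p q r : point) : plt p q -> plt q r -> plt p r.
Proof.
  intros (n & H1 & H2) (m & H3 & H4); destruct (Nat.lt_trichotomy n m) as [K|[->|K]].
  - exists n; split; [intros k Hk; rewrite H1, H3 by lia; reflexivity|].
    rewrite <- H3 by exact K; exact H2.
  - exists m; split; [intros k Hk; rewrite H1, H3 by lia; reflexivity|lia].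
  - exists m; split; [intros k Hk; rewrite H1, H3 by lia; reflexivity|].
    rewrite H1 by exact K; exact H4.
Qed.

Lemma plt_total (p q : point) : plt p q \/ p = q \/ plt q p.
Proof.
  destruct (classic (p = q)) as [|H]; [auto|].
  destruct (first_difference p q H) as (n & H1 & H2).
  destruct (Nat.lt_trichotomy (p n) (q n)) as [K|[K|K]]; [left|contradiction|right; right]; exists n; auto.
  split; [intros m Hm; symmetry; auto|exact K].
Qed.

(** * Balls, order and similarities of the space of paths *)

Section PathSpace.
Context {Sigma : Type} (Rel : list Sigma -> list Sigma -> Prop) (TL : tree_like Rel) (x : Sigma).

Definition path_space : Type := { p : point | ok Rel x p }.

(** [coded] wants a map defined on all sequences; inadmissible ones go to the zero path. *)
Definition path_of (p : point) : path_space :=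
  match excluded_middle_informative (ok Rel x p) with
  | left H => exist _ p H
  | right _ => exist _ _ (ok_zero Rel TL x)
  end.

Lemma path_of_val (p : point) : ok Rel x p -> proj1_sig (path_of p) = p.
Proof. intros H; unfold path_of; destruct excluded_middle_informative; [reflexivity|contradiction]. Qed.

Lemma path_ext (u v : path_space) : proj1_sig u = proj1_sig v -> u = v.
Proof.
  destruct u, v; apply subset_eq_compat.
Qed.

Lemma path_of_proj (u : path_space) : path_of (proj1_sig u) = u.
Proof. apply path_ext, path_of_val, proj2_sig. Qed.

Definition path_dist (u v : path_space) : R := pdist (proj1_sig u) (proj1_sig v).

Definition path_lt (u v : path_space) : Prop := plt (proj1_sig u) (proj1_sig v).

Definition path_sim (B1 B2 : path_space -> Prop) (f : path_space -> path_space) : Prop :=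
  exists al be a, walk Rel x al a /\ walk Rel x be a /\
    cylinder Rel path_of al a B1 /\ cylinder Rel path_of be a B2 /\
    forall p, ok Rel a p -> f (path_of (papp al p)) = path_of (papp be p).

(** The address may be shorter than [n]: once a terminal letter is reached only one path remains,
    and agreement to any further depth is automatic. *)
Lemma agree_cylinder (n : nat) (p : point) : ok Rel x p -> exists al a r,
  walk Rel x al a /\ p = papp al r /\
  forall q, ok Rel x q -> agree n p q <-> exists s, ok Rel a s /\ q = papp al s.
Proof.
  revert x p; induction n as [|n IH]; intros y p Hp.
  - exists [], y, p; split; [constructor|split; [reflexivity|]]; intros q Hq; split.
    + intros _; exists q; auto.
    + intros _ m Hm; lia.
  - destruct (classic (nonterminal Rel y)) as [[w Hr]|Ht].
    + destruct (ok_inv Rel TL _ _ _ Hr Hp) as (i & b & p' & -> & Hi & Hp').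
      destruct (IH b p' Hp') as (al & a & r & H1 & -> & H2).
      exists (i :: al), a, r; split; [econstructor; eauto|split; [reflexivity|]].
      intros q Hq; destruct (ok_inv Rel TL _ _ _ Hr Hq) as (j & c & q' & -> & Hj & Hq'); split.
      * intros H; assert (i = j) as <- by (apply (H 0); lia).
        assert (b = c) as <- by congruence.
        destruct (proj1 (H2 q' Hq')) as (s & H3 & ->); [|exists s; auto].
        intros m Hm; apply (H (S m)); lia.
      * intros (s & H3 & E); apply pcons_inj in E as [-> ->].
        assert (b = c) as <- by congruence.
        assert (K : agree n (papp al r) (papp al s)) by (apply H2; eauto).
        intros [|m] Hm; [reflexivity|]; apply (K m); lia.
    + exists [], y, p; split; [constructor|split; [reflexivity|]]; intros q Hq; split.
      * intros _; exists q; auto.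
      * intros _; rewrite (ok_terminal Rel _ _ Ht Hp), (ok_terminal Rel _ _ Ht Hq).
        intros m _; reflexivity.
Qed.

Lemma cylinder_val (al : list nat) (a : Sigma) (B : path_space -> Prop) (u : path_space) :
  walk Rel x al a -> cylinder Rel path_of al a B ->
  B u <-> exists p, ok Rel a p /\ proj1_sig u = papp al p.
Proof.
  intros Hw HB; rewrite (HB u); split; intros (p & Hp & E); exists p; split; auto.
  - rewrite <- E; apply path_of_val; eapply ok_papp; eauto.
  - rewrite <- E; apply path_of_proj.
Qed.

Lemma path_ball (B : path_space -> Prop) :
  is_ball path_dist B <-> exists al a, walk Rel x al a /\ cylinder Rel path_of al a B.
Proof.
  split.
  - intros (c & r & Hr & HB).
    (* Non-zero distances are powers of one half, so the ball of radius [r] equals that of the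
       largest such power not above [r]. *)
    assert (exists n, ((/ 2) ^ n <= r)%R /\ forall m, ((/ 2) ^ m <= r)%R -> n <= m) as (n & Hn & Hmin).
    { destruct (half_pow_small r Hr) as [n Hn]; apply Rlt_le in Hn.
      induction n as [n IH] using Wf_nat.lt_wf_ind.
      destruct (classic (exists m, m < n /\ ((/ 2) ^ m <= r)%R)) as [(m & H1 & H2)|Hno]; [eauto|].
      exists n; split; [exact Hn|]; intros m Hm.
      destruct (Nat.le_gt_cases n m); [assumption|exfalso; eauto]. }
    destruct (agree_cylinder n (proj1_sig c) (proj2_sig c)) as (al & a & s & H1 & H2 & H3).
    exists al, a; split; [exact H1|]; intros u.
    assert (E : B u <-> agree n (proj1_sig c) (proj1_sig u)).
    { rewrite HB; unfold path_dist; split.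
      - intros H; destruct (pdist_cases (proj1_sig c) (proj1_sig u)) as [->|(m & K1 & _ & K2)].
        + intros m _; reflexivity.
        + rewrite K2 in H; apply Hmin in H; intros k Hk; apply K1; lia.
      - intros H; apply pdist_le in H; lra. }
    rewrite E, (H3 _ (proj2_sig u)); split; intros (q & Hq & F); exists q; split; auto.
    + rewrite <- F; apply path_of_proj.
    + rewrite <- F; apply path_of_val; eapply ok_papp; eauto.
  - intros (al & a & Hw & HB); pose proof (proj2 (ok_papp Rel TL _ _ _ _ Hw) (ok_zero Rel TL a)) as Z.
    exists (path_of (papp al (fun _ => 0))), ((/ 2) ^ length al)%R; split; [apply half_pow_pos|].
    intros u; rewrite (cylinder_val al a B u Hw HB); unfold path_dist.
    rewrite path_of_val by exact Z; rewrite pdist_le, agree_papp; split.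
    + intros (p & _ & E); eauto.
    + intros [p E]; exists p; split; [|exact E].
      eapply (ok_papp Rel TL); [exact Hw|rewrite <- E; apply proj2_sig].
Qed.

Lemma path_coded : coded Rel x path_dist path_sim path_of.
Proof.
  constructor.
  - intros p q Hp Hq E; rewrite <- (path_of_val p Hp), E; apply path_of_val; exact Hq.
  - intros z; exists (proj1_sig z); split; [apply proj2_sig|apply path_of_proj].
  - exact path_ball.
  - intros; reflexivity.
Qed.

Lemma path_ultrametric : is_ultrametric path_dist.
Proof.
  unfold path_dist; split; [|split; [|split]].
  - intros; apply pdist_nonneg.
  - intros u v; split; [intros H; apply path_ext, pdist_zero, H|intros ->; apply pdist_refl].
  - intros; apply pdist_sym.
  - intros; apply pdist_ultra.
Qed.

(** An address is good if its cylinder lies in one open set of the cover. Good addresses form a bar,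
    and the bar yields the finite subcover. *)
Lemma path_compact : is_compact_space path_dist.
Proof.
  intros U Hopen Hcover.
  pose (good := fun al => exists O, U O /\ forall s, ok Rel x (papp al s) -> O (path_of (papp al s))).
  assert (Hbar : barred Rel good [] x).
  { apply (fan_theorem Rel TL x).
    - intros p Hp; destruct (Hcover (path_of p)) as (O & HO & Hpo).
      destruct (Hopen O HO _ Hpo) as (e & He & Hball).
      destruct (half_pow_small e He) as [n Hn].
      destruct (agree_cylinder n p Hp) as (al & a & r & H1 & H2 & H3).
      exists al, a, r; split; [exact H1|split; [exact H2|]]; exists O; split; [exact HO|].
      intros s Hs; apply Hball; unfold path_dist; rewrite !path_of_val by assumption.
      apply Rle_lt_trans with (2 := Hn); apply pdist_le, H3; [exact Hs|].
      exists s; split; [|reflexivity]; eapply ok_papp; eauto.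
    - intros al be b (O & HO & H) _; exists O; split; [exact HO|].
      intros s Hs; rewrite papp_app in *; auto. }
  pose (P := fun al a (l : list (path_space -> Prop)) => walk Rel x al a ->
    (forall O, In O l -> U O) /\
    forall s, ok Rel a s -> exists O, In O l /\ O (path_of (papp al s))).
  assert (exists l, P [] x l) as (l & Hl).
  { revert Hbar; apply (barred_list Rel good P).
    - intros al a (O & HO & H); exists [O]; intros Hw; split; [intros O' [<-|[]]; exact HO|].
      intros s Hs; exists O; split; [simpl; auto|]; apply H; eapply ok_papp; eauto.
    - intros al a w F Hr IH Hw.
      assert (HF := fun i b Hi => IH i b Hi (walk_snoc _ _ _ _ _ _ _ Hw Hr Hi)); split.
      + intros O HO; apply in_concat_seq in HO as (i & b & Hi & HO); apply (HF i b Hi), HO.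
      + intros s Hs; destruct (ok_inv Rel TL _ _ _ Hr Hs) as (i & b & q & -> & Hi & Hq).
        destruct (proj2 (HF i b Hi) q Hq) as (O & H1 & H2); rewrite papp_snoc in H2.
        exists O; split; [apply in_concat_seq; eauto|exact H2]. }
  destruct Hl as [H1 H2]; [constructor|].
  exists l; split; [exact H1|]; intros u; destruct (H2 (proj1_sig u) (proj2_sig u)) as (O & H3 & H4).
  simpl in H4; rewrite path_of_proj in H4; eauto.
Qed.

Lemma path_order_balls (B1 B2 : path_space -> Prop) :
  is_ball path_dist B1 -> is_ball path_dist B2 -> disjoint B1 B2 ->
  (exists u v, B1 u /\ B2 v /\ path_lt u v) ->
  forall u v, B1 u -> B2 v -> path_lt u v.
Proof.
  intros (c1 & r1 & _ & H1) (c2 & r2 & _ & H2) Hdis (u0 & v0 & Hu0 & Hv0 & n & Hag & Hlt) u v Hu Hv.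
  destruct path_ultrametric as (_ & _ & Hsym & Hult).
  pose proof (pdist_first n _ _ Hag ltac:(lia)) as Hd.
  change (path_dist u0 v0 = (/ 2) ^ n)%R in Hd.
  (* Two points of one of the balls are closer than [u0] and [v0], hence agree beyond [n]. *)
  assert (Hclose : forall c r (B : path_space -> Prop) s t,
            (forall y, B y <-> (path_dist c y <= r)%R) -> B s -> B t ->
            (r < (/ 2) ^ n)%R -> proj1_sig s n = proj1_sig t n /\ agree n (proj1_sig s) (proj1_sig t)).
  { intros c r B s t HB Hs Ht Hr; apply HB in Hs, Ht.
    assert (Hst : (path_dist s t <= r)%R).
    { apply Rle_trans with (1 := Hult s c t); apply Rmax_lub; [rewrite Hsym|]; assumption. }
    destruct (pdist_cases (proj1_sig s) (proj1_sig t)) as [->|(m & K1 & K2 & K3)].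
    - split; [reflexivity|intros m _; reflexivity].
    - unfold path_dist in Hst; rewrite K3 in Hst.
      assert (n < m).
      { destruct (Nat.le_gt_cases m n) as [K|]; [exfalso|assumption].
        apply half_pow_le in K; lra. }
      split; [apply K1; assumption|intros k Hk; apply K1; lia]. }
  (* A ball around one of [u0], [v0] with radius at least their distance would contain the other,
     against disjointness. *)
  assert (Hr1 : (r1 < (/ 2) ^ n)%R).
  { apply Rnot_le_lt; intros K; apply (Hdis v0); [|exact Hv0]; apply H1.
    apply Rle_trans with (1 := Hult c1 u0 v0); apply Rmax_lub; [apply H1, Hu0|lra]. }
  assert (Hr2 : (r2 < (/ 2) ^ n)%R).
  { apply Rnot_le_lt; intros K; apply (Hdis u0); [exact Hu0|]; apply H2.
    apply Rle_trans with (1 := Hult c2 v0 u0); apply Rmax_lub; [apply H2, Hv0|rewrite Hsym; lra]. }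
  destruct (Hclose c1 r1 B1 u u0 H1 Hu Hu0 Hr1) as [E1 A1].
  destruct (Hclose c2 r2 B2 v0 v H2 Hv0 Hv Hr2) as [E2 A2].
  exists n; split; [|rewrite E1, <- E2; exact Hlt].
  intros k Hk; rewrite A1, Hag, A2 by exact Hk; reflexivity.
Qed.

Lemma path_lin_ord_cpt : lin_ord_cpt_ultrametric path_dist path_lt.
Proof.
  split; [exact path_ultrametric|split; [exact path_compact|split; [|exact path_order_balls]]].
  split; [|split].
  - intros u; apply plt_irrefl.
  - intros u v w; apply plt_trans.
  - intros u v; destruct (plt_total (proj1_sig u) (proj1_sig v)) as [H|[H|H]]; auto.
    right; left; apply path_ext, H.
Qed.

(** A ball has only one address, hence there is at most one prefix replacement between two balls:
    this is what makes the structure small. *)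
Lemma path_cylinder_inj (al be : list nat) (a b : Sigma) (B : path_space -> Prop) :
  walk Rel x al a -> walk Rel x be b -> cylinder Rel path_of al a B -> cylinder Rel path_of be b B ->
  al = be /\ a = b.
Proof.
  intros Wa Wb Ha Hb.
  assert (H : forall al a p, walk Rel x al a -> cylinder Rel path_of al a B -> ok Rel a p ->
            B (path_of (papp al p)) /\ proj1_sig (path_of (papp al p)) = papp al p).
  { intros ga c p W HB Hp; split; [apply HB; eauto|].
    apply path_of_val; eapply ok_papp; eauto. }
  assert (E : al = be); [|subst be; split; [reflexivity|eapply (walk_det Rel TL); eauto]].
  apply (cylinder_inj Rel TL x a b); auto.
  - intros p Hp; destruct (H _ _ _ Wa Ha Hp) as [K1 K2].
    apply (cylinder_val _ _ _ _ Wb Hb) in K1 as (q & _ & E); exists q; congruence.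
  - intros p Hp; destruct (H _ _ _ Wb Hb Hp) as [K1 K2].
    apply (cylinder_val _ _ _ _ Wa Ha) in K1 as (q & _ & E); exists q; congruence.
Qed.

Lemma path_sim_unique (B1 B2 : path_space -> Prop) (f g : path_space -> path_space) :
  path_sim B1 B2 f -> path_sim B1 B2 g -> agree_on B1 f g.
Proof.
  intros (al & be & a & H1 & H2 & H3 & H4 & H5) (al' & be' & a' & K1 & K2 & K3 & K4 & K5) u Hu.
  destruct (path_cylinder_inj _ _ _ _ _ H1 K1 H3 K3) as [<- <-].
  destruct (path_cylinder_inj _ _ _ _ _ H2 K2 H4 K4) as [<- _].
  apply H3 in Hu as (p & Hp & <-); rewrite H5, K5 by exact Hp; reflexivity.
Qed.

Lemma path_sim_similarity (B1 B2 : path_space -> Prop) (f : path_space -> path_space) :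
  path_sim B1 B2 f -> is_similarity path_dist B1 B2 f.
Proof.
  intros (al & be & a & W1 & W2 & H1 & H2 & Hf); split; [|split].
  - intros u Hu; apply H1 in Hu as (p & Hp & <-); rewrite Hf by exact Hp; apply H2; eauto.
  - intros v Hv; apply H2 in Hv as (p & Hp & <-); exists (path_of (papp al p)).
    split; [apply H1; eauto|auto].
  - exists ((/ 2) ^ length be / (/ 2) ^ length al)%R; split.
    + apply Rdiv_lt_0_compat; apply half_pow_pos.
    + intros u v Hu Hv; apply H1 in Hu as (p & Hp & <-); apply H1 in Hv as (q & Hq & <-).
      rewrite !Hf by assumption; unfold path_dist.
      rewrite !path_of_val by (eapply ok_papp; eauto); rewrite !pdist_papp.
      field; apply Rgt_not_eq, half_pow_pos.
Qed.

Lemma path_finite_sim : finite_sim_structure path_dist path_sim.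
Proof.
  split; [|split; [|split; [|split; [|split; [|split]]]]].
  - intros B1 B2 f H; pose proof (path_sim_similarity _ _ _ H) as Hs.
    destruct H as (al & be & a & W1 & W2 & H1 & H2 & _).
    split; [apply path_ball; eauto|split; [apply path_ball; eauto|exact Hs]].
  - intros B1 B2 f g (al & be & a & W1 & W2 & H1 & H2 & Hf) E.
    exists al, be, a; repeat (split; [assumption|]); intros p Hp.
    rewrite <- E; [auto|apply H1; eauto].
  - intros B1 B2; destruct (classic (exists f, path_sim B1 B2 f)) as [[f Hf]|Hno].
    + exists [f]; intros g Hg; exists f; split; [simpl; auto|].
      apply (path_sim_unique B1 B2); assumption.
    + exists []; intros f Hf; exfalso; eauto.
  - intros B HB; apply path_ball in HB as (al & a & Hw & HB); exists al, al, a; auto.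
  - intros B1 B2 f (al & be & a & W1 & W2 & H1 & H2 & Hf).
    (* The inverse must be a total map; it is chosen from the reversed replacement, and its values
       outside the second ball are arbitrary. *)
    pose (P := fun v u => exists p, ok Rel a p /\ v = path_of (papp be p) /\ u = path_of (papp al p)).
    pose (g := fun v => epsilon (inhabits v) (P v)).
    assert (Hg : forall p, ok Rel a p -> g (path_of (papp be p)) = path_of (papp al p)).
    { intros p Hp; destruct (epsilon_spec (inhabits (path_of (papp be p))) (P (path_of (papp be p))))
        as (q & Hq & E1 & E2); [exists (path_of (papp al p)), p; auto|].
      unfold g; rewrite E2; do 2 f_equal.
      apply (f_equal (@proj1_sig _ _)) in E1.
      rewrite !path_of_val in E1 by (eapply ok_papp; eauto); apply papp_inj in E1; auto. }
    exists g; split; [exists be, al, a; auto|].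
    intros u Hu; apply H1 in Hu as (p & Hp & <-); rewrite Hf, Hg by exact Hp; reflexivity.
  - intros B1 B2 B3 f g (al & be & a & W1 & W2 & H1 & H2 & Hf) (be' & ga & a' & W3 & W4 & H3 & H4 & Hg).
    destruct (path_cylinder_inj _ _ _ _ _ W2 W3 H2 H3) as [<- <-].
    exists al, ga, a; repeat (split; [assumption|]); intros p Hp.
    rewrite Hf, Hg by exact Hp; reflexivity.
  - intros B1 B2 f B (al & be & a & W1 & W2 & H1 & H2 & Hf) HB Hsub.
    apply path_ball in HB as (ga & c & W3 & H3).
    destruct (cylinder_subset Rel TL x c a ga al W3 W1) as [de ->].
    { intros p Hp; assert (K : B (path_of (papp ga p))) by (apply H3; eauto).
      apply Hsub, (cylinder_val _ _ _ _ W1 H1) in K as (q & _ & E); exists q.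
      rewrite <- E; symmetry; apply path_of_val; eapply ok_papp; eauto. }
    pose proof W3 as W4; apply walk_app_inv in W4 as (a' & W5 & W6).
    rewrite (walk_det Rel TL _ _ _ _ W5 W1) in W6.
    pose proof (walk_app Rel _ _ _ _ _ W2 W6) as W7.
    assert (Hf' : forall p, ok Rel c p -> f (path_of (papp (al ++ de) p)) = path_of (papp (be ++ de) p)).
    { intros p Hp; rewrite !papp_app; apply Hf; eapply ok_papp; eauto. }
    assert (H5 : cylinder Rel path_of (be ++ de) c (image f B)).
    { intros v; split.
      - intros (u & Hu & <-); apply H3 in Hu as (p & Hp & <-); exists p; split; [exact Hp|].
        symmetry; auto.
      - intros (p & Hp & <-); exists (path_of (papp (al ++ de) p)); split; [apply H3; eauto|auto]. }
    split; [apply path_ball; eauto|]; exists (al ++ de), (be ++ de), c; auto.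
Qed.

Lemma path_small_sim : small_sim_structure path_dist path_lt path_sim.
Proof.
  split; [exact path_finite_sim|split; [exact path_sim_unique|]].
  intros B1 B2 f (al & be & a & W1 & W2 & H1 & H2 & Hf) u v Hu Hv.
  apply H1 in Hu as (p & Hp & <-); apply H1 in Hv as (q & Hq & <-).
  rewrite !Hf by assumption; unfold path_lt.
  rewrite !path_of_val by (eapply ok_papp; eauto); rewrite !plt_papp; auto.
Qed.

End PathSpace.

(** * Balls of a compact ultrametric space *)

Lemma StronglySorted_nth {T : Type} (P : T -> T -> Prop) (l : list T) :
  StronglySorted P l <->
  (forall i j, i < j < length l -> forall b, P (nth i l b) (nth j l b)).
Proof.
  induction l as [|a l IH].
  - split; [intros _ i j H; simpl in H; lia|constructor].
  - split.
    + intros H; apply StronglySorted_inv in H as [H1 H2]; rewrite Forall_forall in H2.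
      intros [|i] [|j] Hij b; simpl in *; try lia.
      * apply H2, nth_In; lia.
      * apply IH; [exact H1|lia].
    + intros H; constructor.
      * apply IH; intros i j Hij b; apply (H (S i) (S j)); simpl; lia.
      * apply Forall_forall; intros c Hc; apply (In_nth _ _ a) in Hc as (n & Hn & <-).
        apply (H 0 (S n)); simpl; lia.
Qed.

(** Asymmetry also rules out repeated entries, so comparing members suffices. *)
Lemma sorted_unique {T : Type} (P : T -> T -> Prop) (l l' : list T) :
  (forall a b, In a l -> In b l -> P a b -> P b a -> False) ->
  StronglySorted P l -> StronglySorted P l' -> (forall a, In a l <-> In a l') -> l = l'.
Proof.
  revert l'; induction l as [|a l IH]; intros l' Has H H' Hin.
  - destruct l' as [|b l']; [reflexivity|]; destruct (proj2 (Hin b)); simpl; auto.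
  - destruct l' as [|b l']; [destruct (proj1 (Hin a)); simpl; auto|].
    apply StronglySorted_inv in H as [H1 H2]; apply StronglySorted_inv in H' as [H3 H4].
    rewrite Forall_forall in H2, H4.
    assert (E : a = b).
    { destruct (proj1 (Hin a)) as [E|Ha]; [simpl; auto|auto|].
      destruct (proj2 (Hin b)) as [E|Hb]; [simpl; auto|auto|].
      exfalso; apply (Has a b); simpl; auto. }
    subst b; f_equal; apply IH; auto.
    + intros; apply (Has a0 b); simpl; auto.
    + assert (Ha : ~ P a a) by (intros K; apply (Has a a); simpl; auto).
      intros c; split; intros Hc.
      * destruct (proj1 (Hin c)) as [<-|K]; simpl; auto; exfalso; auto.
      * destruct (proj2 (Hin c)) as [<-|K]; simpl; auto; exfalso; auto.
Qed.

(** Insertion sort that drops an element already present, since the relation is to be strict. *)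
Lemma sort_exists {T : Type} (P : T -> T -> Prop) (l : list T) :
  (forall a b c, P a b -> P b c -> P a c) ->
  (forall a b, In a l -> In b l -> P a b \/ a = b \/ P b a) ->
  exists l', (forall a, In a l' <-> In a l) /\ StronglySorted P l'.
Proof.
  intros Htr; induction l as [|a l IH]; intros Htot.
  - exists []; split; [reflexivity|constructor].
  - destruct IH as (l' & Hin & Hs); [intros; apply Htot; simpl; auto|].
    assert (Hta : forall b, In b l' -> P a b \/ a = b \/ P b a).
    { intros b Hb; apply Htot; simpl; auto; right; apply Hin, Hb. }
    cut (exists l'', (forall b, In b l'' <-> a = b \/ In b l') /\ StronglySorted P l'').
    { intros (l'' & H1 & H2); exists l''; split; [|exact H2].
      intros b; rewrite H1; simpl; rewrite Hin; reflexivity. }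
    clear Hin Htot; induction Hs as [|b l' Hs IH' Hb].
    + exists [a]; split; [simpl; tauto|repeat constructor].
    + pose proof Hb as Hb'; rewrite Forall_forall in Hb'.
      destruct (Hta b) as [K|[->|K]]; [simpl; auto| | |].
      * exists (a :: b :: l'); split; [simpl; tauto|].
        constructor; [constructor; assumption|]; apply Forall_forall.
        intros c [<-|Hc]; eauto.
      * exists (b :: l'); split; [simpl; tauto|constructor; assumption].
      * destruct IH' as (l'' & H1 & H2); [intros; apply Hta; simpl; auto|].
        exists (b :: l''); split; [simpl; intros c; rewrite H1; tauto|].
        constructor; [exact H2|]; apply Forall_forall; intros c Hc.
        apply H1 in Hc as [<-|Hc]; auto.
Qed.

Lemma finite_max (P : R -> Prop) (l : list R) :
  (forall v, P v -> In v l) -> (exists v, P v) ->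
  exists m, P m /\ forall v, P v -> (v <= m)%R.
Proof.
  intros Hl [v0 H0].
  assert (H : forall l', (exists m, P m /\ forall v, In v l' -> P v -> (v <= m)%R)).
  { induction l' as [|a l' (m & Hm & Hmax)]; [exists v0; split; [exact H0|intros v []]|].
    destruct (classic (P a /\ (m <= a)%R)) as [[Ha Hma]|Hn].
    - exists a; split; [exact Ha|]; intros v [<-|Hv] Hp; [lra|specialize (Hmax v Hv Hp); lra].
    - exists m; split; [exact Hm|]; intros v [<-|Hv] Hp; [|auto].
      apply Rnot_lt_le; intros K; apply Hn; split; [exact Hp|lra]. }
  destruct (H l) as (m & Hm & Hmax); exists m; auto.
Qed.

Section Ultrametric.
Context {X : Type} (d : X -> X -> R) (HU : is_ultrametric d) (HK : is_compact_space d).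

Lemma d_pos (y z : X) : y <> z -> (0 < d y z)%R.
Proof.
  destruct HU as (H1 & H2 & _); intros H; destruct (H1 y z) as [|E]; [assumption|].
  symmetry in E; apply H2 in E; contradiction.
Qed.

Lemma d_self (z : X) : d z z = 0%R.
Proof. apply HU; reflexivity. Qed.

Lemma d_sym (y z : X) : d y z = d z y.
Proof. apply HU. Qed.

Lemma d_ultra_le (y z w : X) (r : R) : (d y z <= r)%R -> (d z w <= r)%R -> (d y w <= r)%R.
Proof.
  destruct HU as (_ & _ & _ & H); intros H1 H2.
  apply Rle_trans with (1 := H y z w); apply Rmax_lub; assumption.
Qed.

Lemma d_ultra_lt (y z w : X) (r : R) : (d y z < r)%R -> (d z w < r)%R -> (d y w < r)%R.
Proof.
  destruct HU as (_ & _ & _ & H); intros H1 H2.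
  apply Rle_lt_trans with (1 := H y z w); apply Rmax_lub_lt; assumption.
Qed.

Lemma d_isosceles (y z w : X) : (d y z < d z w)%R -> d y w = d z w.
Proof.
  intros H; apply Rle_antisym; [apply d_ultra_le with z; lra|].
  apply Rnot_lt_le; intros K.
  assert (d z w < d z w)%R; [|lra]; apply d_ultra_lt with y; [rewrite d_sym|]; assumption.
Qed.

Lemma finite_net (r : R) : (0 < r)%R -> exists l : list X, forall y, exists c, In c l /\ (d c y < r)%R.
Proof.
  intros Hr; destruct (HK (fun O => exists c, O = (fun y => (d c y < r)%R))) as (l & H1 & H2).
  - intros O (c & ->) y Hy; exists r; split; [exact Hr|]; intros z Hz; apply d_ultra_lt with y; auto.
  - intros y; exists (fun z => (d y z < r)%R); split; [eauto|rewrite d_self; exact Hr].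
  - assert (exists cs : list X, forall O, In O l -> exists c, In c cs /\ O = (fun y => (d c y < r)%R))
      as (cs & Hcs).
    { clear H2; induction l as [|O l IH]; [exists []; intros O []|].
      destruct IH as (cs & Hcs); [intros; apply H1; simpl; auto|].
      destruct (H1 O) as (c & Hc); [simpl; auto|]; exists (c :: cs).
      intros O' [<-|HO]; [exists c; simpl; auto|].
      destruct (Hcs O' HO) as (c' & K1 & K2); exists c'; simpl; auto. }
    exists cs; intros y; destruct (H2 y) as (O & HO & Hy).
    destruct (Hcs O HO) as (c & Hc & ->); eauto.
Qed.

(** The discreteness on which all of the ball structure rests. Moving each endpoint by less than
    [r], to a centre of a finite net, does not change a distance above [r], by the isosceles
    property. *)
Lemma finite_distances (r : R) : (0 < r)%R -> exists l : list R, forall y z, (r < d y z)%R -> In (d y z) l.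
Proof.
  intros Hr; destruct (finite_net r Hr) as (cs & Hcs).
  exists (flat_map (fun c => map (d c) cs) cs); intros y z Hyz.
  destruct (Hcs y) as (c & Hc & Hy); destruct (Hcs z) as (c' & Hc' & Hz).
  apply in_flat_map; exists c; split; [exact Hc|]; apply in_map_iff; exists c'; split; [|exact Hc'].
  assert (E : d c z = d y z) by (apply d_isosceles; lra).
  rewrite (d_sym c c'), <- E, (d_sym c z); apply d_isosceles.
  rewrite (d_sym z c), E; lra.
Qed.

Lemma ball_recenter (B : X -> Prop) (z : X) : is_ball d B -> B z ->
  exists r, (0 < r)%R /\ forall y, B y <-> (d z y <= r)%R.
Proof.
  intros (c & r & Hr & HB) Hz; exists r; split; [exact Hr|]; intros y; apply HB in Hz.
  rewrite HB; split; intros H; eapply d_ultra_le; eauto; rewrite d_sym; exact Hz.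
Qed.

Lemma ball_inhabited (B : X -> Prop) : is_ball d B -> exists z, B z.
Proof. intros (c & r & Hr & HB); exists c; apply HB; rewrite d_self; lra. Qed.

Lemma set_ext (A B : X -> Prop) : subset A B -> subset B A -> A = B.
Proof. intros H1 H2; extensionality z; apply propositional_extensionality; split; auto. Qed.

Lemma ball_eq (A B : Ball d) : proj1_sig A = proj1_sig B -> A = B.
Proof. destruct A, B; apply subset_eq_compat. Qed.

Lemma ball_nested (A B : X -> Prop) (z : X) : is_ball d A -> is_ball d B -> A z -> B z ->
  subset A B \/ subset B A.
Proof.
  intros HA HB Az Bz; destruct (ball_recenter A z HA Az) as (r & _ & Hr).
  destruct (ball_recenter B z HB Bz) as (s & _ & Hs).
  destruct (Rle_lt_dec r s); [left|right]; intros y Hy; [apply Hs; apply Hr in Hy|apply Hr; apply Hs in Hy]; lra.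
Qed.

(** The given radius of a ball need not be a distance. Finiteness of the distances above [s] lets it
    be replaced by the largest one occurring in the ball. *)
Lemma ball_radius_attained (B : X -> Prop) (z : X) (s : R) : is_ball d B -> B z -> (0 < s)%R ->
  (exists y, B y /\ (s < d z y)%R) ->
  exists v, (s < v)%R /\ (exists y, B y /\ d z y = v) /\ forall y, B y <-> (d z y <= v)%R.
Proof.
  intros HB Bz Hs (y0 & By0 & Hy0); destruct (finite_distances s Hs) as (l & Hl).
  destruct (finite_max (fun v => exists y, B y /\ v = d z y /\ (s < v)%R) l)
    as (v & (y1 & By1 & -> & Hv) & Hmax).
  - intros v (y & _ & -> & H); auto.
  - exists (d z y0), y0; auto.
  - exists (d z y1); split; [exact Hv|split; [eauto|]]; intros y; split; intros Hy.
    + destruct (Rle_lt_dec (d z y) s) as [K|K]; [lra|apply Hmax; eauto].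
    + destruct (ball_recenter B z HB Bz) as (r & _ & Hr); apply Hr; apply Hr in By1; lra.
Qed.

(** A ball around [z] is determined by its attained radius, and only finitely many values exceed
    [s]. *)
Lemma finite_large_balls (z : X) (s : R) : (0 < s)%R ->
  exists l : list (X -> Prop), forall B, is_ball d B -> B z ->
    ~ subset B (fun y => (d z y <= s)%R) -> In B l.
Proof.
  intros Hs; destruct (finite_distances s Hs) as (l & Hl).
  exists (map (fun v y => (d z y <= v)%R) l); intros B HB Bz Hn.
  destruct (ball_radius_attained B z s HB Bz Hs) as (v & Hv & (y & By & E) & Hball).
  - apply NNPP; intros K; apply Hn; intros y By; apply Rnot_lt_le; intros Hlt; eauto.
  - apply in_map_iff; exists v; split; [|rewrite <- E; apply Hl; lra].
    apply set_ext; intros w Hw; apply Hball; exact Hw.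
Qed.

(* An open ball is a closed ball: the distances between half the radius and the radius
   are finitely many. *)
Lemma open_ball_is_ball (z : X) (v : R) : (0 < v)%R -> is_ball d (fun y => (d z y < v)%R).
Proof.
  intros Hv; destruct (finite_distances (v / 2)) as (l & Hl); [lra|].
  destruct (finite_max (fun s => s = (v / 2)%R \/ exists y, s = d z y /\ (v / 2 < s < v)%R) ((v / 2)%R :: l))
    as (r & Hr & Hmax).
  - intros s [->|(y & -> & H)]; [simpl; auto|right; apply Hl; lra].
  - exists (v / 2)%R; auto.
  - assert (0 < r < v)%R as [Hr1 Hr2] by (destruct Hr as [->|(y & _ & H)]; lra).
    exists z, r; split; [exact Hr1|]; intros y; split; intros Hy; [|lra].
    destruct (Rle_lt_dec (d z y) (v / 2)) as [K|K].
    + specialize (Hmax (v / 2)%R (or_introl eq_refl)); lra.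
    + apply Hmax; right; exists y; lra.
Qed.

(** With [v] the attained radius of [B] about a point [z] of [E], the open ball of radius [v] about
    [z] is maximal: a ball around [z] either has radius at least [v] and contains [B], or lies
    inside the open ball. *)
Lemma proper_subball_in_maximal (B E : X -> Prop) : is_ball d B -> proper_subball d E B ->
  exists C, maximal_proper_subball d C B /\ subset E C.
Proof.
  intros HB (HE & Hsub & Hn); destruct (ball_inhabited E HE) as [z Ez].
  destruct (ball_recenter E z HE Ez) as (r & Hr & HEr).
  destruct (ball_radius_attained B z r HB (Hsub z Ez) Hr) as (v & Hv & (y & By & Ey) & HBv).
  { apply NNPP; intros K; apply Hn; intros y By; apply HEr, Rnot_lt_le; intros Hlt; eauto. }
  assert (HC : is_ball d (fun w => (d z w < v)%R)) by (apply open_ball_is_ball; lra).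
  exists (fun w => (d z w < v)%R); split; [split|].
  - split; [exact HC|split].
    + intros w Hw; apply HBv; lra.
    + intros K; apply K in By; lra.
  - intros (C & (_ & Hs1 & Hn1) & (HC' & Hs2 & Hn2)).
    assert (Cz : C z) by (apply Hs1; rewrite d_self; lra).
    destruct (ball_recenter C z HC' Cz) as (s & _ & Hsr).
    destruct (Rle_lt_dec v s).
    + apply Hn2; intros w Bw; apply Hsr; apply HBv in Bw; lra.
    + apply Hn1; intros w Cw; apply Hsr in Cw; lra.
  - intros w Hw; apply HEr in Hw; lra.
Qed.

Lemma maximal_disjoint (A B C : X -> Prop) (z : X) :
  maximal_proper_subball d A C -> maximal_proper_subball d B C -> A z -> B z -> A = B.
Proof.
  assert (H : forall A B, maximal_proper_subball d A C -> maximal_proper_subball d B C ->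
            subset A B -> A = B).
  { intros A' B' [HA HA'] [HB _] Hs; apply set_ext; [exact Hs|].
    apply NNPP; intros K; apply HA'; exists B'; split; [|exact HB].
    split; [apply HA|auto]. }
  intros HA HB Az Bz; destruct (ball_nested A B z) as [K|K]; auto; try apply HA; try apply HB.
  symmetry; auto.
Qed.

Lemma nontrivial_maximal (B : X -> Prop) (y z : X) : is_ball d B -> B y -> B z -> y <> z ->
  exists C, maximal_proper_subball d C B /\ C z.
Proof.
  intros HB By Bz Hyz; pose proof (d_pos z y ltac:(auto)) as Hd.
  destruct (proper_subball_in_maximal B (fun w => (d z w < d z y)%R) HB) as (C & HC & Hs).
  - destruct (ball_recenter B z HB Bz) as (r & _ & Hr).
    split; [apply open_ball_is_ball; exact Hd|split].
    + intros w Hw; apply Hr; apply Hr in By; lra.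
    + intros K; apply K in By; lra.
  - exists C; split; [exact HC|apply Hs; rewrite d_self; exact Hd].
Qed.

Lemma finite_maximal (B : X -> Prop) : is_ball d B ->
  exists l : list (Ball d), forall C, maximal_proper_subball d C B <-> exists D, In D l /\ proj1_sig D = C.
Proof.
  intros HB.
  assert (exists l : list (X -> Prop), forall C, maximal_proper_subball d C B -> In C l) as [l Hl].
  { destruct (classic (exists y z, B y /\ B z /\ y <> z)) as [(y & z & By & Bz & Hyz)|Hno].
    - (* The maximal proper sub-balls and the complement of [B] form an open cover. *)
      destruct (HK (fun O => O = (fun w => ~ B w) \/ maximal_proper_subball d O B)) as (l & H1 & H2).
      + intros O [->|HO] w Hw.
        * destruct HB as (c & r & Hr & HB); exists r; split; [exact Hr|]; intros t Ht Bt.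
          apply Hw, HB; apply HB in Bt; apply d_ultra_le with t; [exact Bt|rewrite d_sym; lra].
        * destruct (ball_recenter O w (proj1 (proj1 HO)) Hw) as (r & Hr & HOr).
          exists r; split; [exact Hr|]; intros t Ht; apply HOr; lra.
      + intros w; destruct (classic (B w)) as [Bw|Bw]; [|exists (fun w => ~ B w); auto].
        assert (exists t, B t /\ t <> w) as (t & Bt & Ht).
        { destruct (classic (y = w)) as [<-|K]; [exists z; auto|exists y; auto]. }
        destruct (nontrivial_maximal B t w HB Bt Bw Ht) as (C & HC & Cw); eauto.
      + exists l; intros C HC; destruct (ball_inhabited C (proj1 (proj1 HC))) as [w Cw].
        destruct (H2 w) as (O & HO & Ow); destruct (H1 O HO) as [->|HO'].
        * exfalso; apply Ow, HC, Cw.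
        * rewrite (maximal_disjoint C O B w HC HO' Cw Ow); exact HO.
    - exists []; intros C [(HC & Hs & Hn) _]; destruct (ball_inhabited C HC) as [w Cw]; apply Hn.
      intros t Bt; destruct (classic (t = w)) as [->|Ht]; [exact Cw|exfalso; apply Hno; exists t, w; repeat split; [exact Bt|exact (Hs w Cw)|exact Ht]]. }
  (* The subcover also contains the complement of [B], so the members that are maximal sub-balls are
     filtered out and paired with their proofs. *)
  assert (H : exists l' : list (Ball d), forall D, In D l' <-> In (proj1_sig D) l /\ maximal_proper_subball d (proj1_sig D) B).
  { clear Hl; induction l as [|C l IH]; [exists []; simpl; tauto|].
    destruct IH as [l' Hl']; destruct (classic (maximal_proper_subball d C B)) as [HC|HC].
    - exists (exist _ C (proj1 (proj1 HC)) :: l'); intros D; simpl; rewrite Hl'; split.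
      + intros [<-|[H1 H2]]; simpl; auto.
      + intros [[E|H1] H2]; [left; apply ball_eq; exact E|auto].
    - exists l'; intros D; rewrite Hl'; simpl; split; [tauto|].
      intros [[<-|H1] H2]; [contradiction|auto]. }
  destruct H as [l' Hl']; exists l'; intros C; split.
  - intros HC; exists (exist _ C (proj1 (proj1 HC))); split; [apply Hl'; simpl; auto|reflexivity].
  - intros (D & HD & <-); apply Hl', HD.
Qed.

End Ultrametric.

(** * Spaces with a small similarity structure *)

Section SmallSimilarity.
Context {X : Type} (d : X -> X -> R) (lt : X -> X -> Prop)
  (Sim : (X -> Prop) -> (X -> Prop) -> (X -> X) -> Prop)
  (HL : lin_ord_cpt_ultrametric d lt) (HS : small_sim_structure d lt Sim).

Let HU : is_ultrametric d := proj1 HL.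
Let HK : is_compact_space d := proj1 (proj2 HL).

Lemma sim_balls (B1 B2 : X -> Prop) (f : X -> X) :
  Sim B1 B2 f -> is_ball d B1 /\ is_ball d B2 /\ is_similarity d B1 B2 f.
Proof. apply HS. Qed.

Lemma sim_inj (B1 B2 : X -> Prop) (f : X -> X) (y z : X) :
  Sim B1 B2 f -> B1 y -> B1 z -> f y = f z -> y = z.
Proof.
  intros H Hy Hz E; destruct (sim_balls _ _ _ H) as (_ & _ & _ & _ & lam & Hlam & Hd).
  apply HU; specialize (Hd y z Hy Hz); rewrite E, (d_self d HU) in Hd.
  symmetry in Hd; apply Rmult_integral in Hd as [Hd|Hd]; [lra|exact Hd].
Qed.

Lemma sim_image (B1 B2 : X -> Prop) (f : X -> X) : Sim B1 B2 f -> image f B1 = B2.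
Proof.
  intros H; destruct (sim_balls _ _ _ H) as (_ & _ & H1 & H2 & _).
  apply set_ext; [intros y (z & Hz & <-); auto|exact H2].
Qed.

Lemma sim_restrict (B1 B2 B : X -> Prop) (f : X -> X) :
  Sim B1 B2 f -> is_ball d B -> subset B B1 -> is_ball d (image f B) /\ Sim B (image f B) f.
Proof. apply HS. Qed.

Lemma sim_inverse (B1 B2 : X -> Prop) (f : X -> X) : Sim B1 B2 f ->
  exists g, Sim B2 B1 g /\ (forall z, B1 z -> g (f z) = z) /\ (forall z, B2 z -> f (g z) = z).
Proof.
  intros H; pose proof HS as ((_ & _ & _ & _ & Hinv & _) & _).
  destruct (Hinv _ _ _ H) as (g & Hg & Hgf); exists g; split; [exact Hg|split; [exact Hgf|]].
  intros z Hz; rewrite <- (sim_image _ _ _ H) in Hz; destruct Hz as (y & Hy & <-).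
  rewrite Hgf by exact Hy; reflexivity.
Qed.

Lemma sim_image_maximal (B1 B2 C : X -> Prop) (f : X -> X) : Sim B1 B2 f ->
  maximal_proper_subball d C B1 -> maximal_proper_subball d (image f C) B2.
Proof.
  assert (Hproper : forall B1 B2 C f, Sim B1 B2 f -> proper_subball d C B1 ->
            proper_subball d (image f C) B2).
  { intros A1 A2 E g H (HE & Hs & Hn); split; [apply (sim_restrict _ _ _ _ H HE Hs)|split].
    - intros y (z & Hz & <-); apply (sim_balls _ _ _ H); auto.
    - intros K; apply Hn; intros z Hz.
      destruct (K (g z)) as (y & Hy & Ey); [apply (sim_balls _ _ _ H), Hz|].
      rewrite <- (sim_inj _ _ _ _ _ H (Hs y Hy) Hz Ey); exact Hy. }
  intros H [HC Hmax]; split; [eapply Hproper; eauto|].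
  (* A ball strictly between the image of [C] and [B2] is pulled back by the inverse similarity to
     one strictly between [C] and [B1]. *)
  intros (D & HD1 & HD2); apply Hmax.
  destruct (sim_inverse _ _ _ H) as (g & Hg & Hgf & Hfg).
  exists (image g D); split; [|eapply Hproper; eauto].
  assert (E : image g (image f C) = C).
  { apply set_ext.
    - intros y (z & (w & Hw & <-) & <-); rewrite Hgf; [exact Hw|apply HC; exact Hw].
    - intros y Hy; exists (f y); split; [exists y; auto|apply Hgf, HC, Hy]. }
  rewrite <- E; apply (Hproper D (image g D) _ g); [|exact HD1].
  apply (sim_restrict _ _ _ _ Hg); apply HD2.
Qed.

Lemma set_lt_trans (A B C : X -> Prop) : is_ball d B ->
  set_lt lt A B -> set_lt lt B C -> set_lt lt A C.
Proof.
  intros HB H1 H2 y z Hy Hz; destruct (ball_inhabited d HU B HB) as [w Hw].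
  pose proof HL as (_ & _ & (_ & Htr & _) & _); eauto.
Qed.

Lemma set_lt_asym (A B : X -> Prop) : is_ball d A -> is_ball d B ->
  set_lt lt A B -> set_lt lt B A -> False.
Proof.
  intros HA HB H1 H2; destruct (ball_inhabited d HU A HA) as [y Hy], (ball_inhabited d HU B HB) as [z Hz].
  pose proof HL as (_ & _ & (Hirr & Htr & _) & _).
  exact (Hirr y (Htr _ _ _ (H1 y z Hy Hz) (H2 z y Hz Hy))).
Qed.

Definition ball_lt (A B : Ball d) : Prop := set_lt lt (proj1_sig A) (proj1_sig B).

(** The list is empty when [B] is a single point; such a ball gives a terminal letter, because
    [RelSim] demands a non-empty list. *)
Definition is_kids (B : Ball d) (L : list (Ball d)) : Prop :=
  (forall C, maximal_proper_subball d C (proj1_sig B) <-> exists D, In D L /\ proj1_sig D = C) /\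
  StronglySorted ball_lt L.

Lemma kids_exist (B : Ball d) : exists L, is_kids B L.
Proof.
  destruct (finite_maximal d HU HK (proj1_sig B) (proj2_sig B)) as (l & Hl).
  destruct (sort_exists ball_lt l) as (L & HLl & Hs).
  - intros C1 C2 C3; apply set_lt_trans, proj2_sig.
  - intros C1 C2 H1 H2; destruct (classic (C1 = C2)) as [|Hne]; [auto|].
    assert (M1 : maximal_proper_subball d (proj1_sig C1) (proj1_sig B)) by (apply Hl; eauto).
    assert (M2 : maximal_proper_subball d (proj1_sig C2) (proj1_sig B)) by (apply Hl; eauto).
    assert (Hdis : forall z, proj1_sig C1 z -> proj1_sig C2 z -> False).
    { intros z K1 K2; apply Hne, ball_eq; eapply (maximal_disjoint d HU); eauto. }
    destruct (ball_inhabited d HU _ (proj2_sig C1)) as [y Hy].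
    destruct (ball_inhabited d HU _ (proj2_sig C2)) as [z Hz].
    pose proof HL as (_ & _ & (_ & _ & Htot) & Hconv).
    destruct (Htot y z) as [K|[->|K]]; [left| |right; right].
    + intros u v Hu Hv; apply (Hconv _ _ (proj2_sig C1) (proj2_sig C2)); auto.
      exists y, z; auto.
    + exfalso; eauto.
    + intros u v Hu Hv; apply (Hconv _ _ (proj2_sig C2) (proj2_sig C1)); auto.
      * intros w Hw Hw'; eauto.
      * exists z, y; auto.
  - exists L; split; [|exact Hs]; intros C; rewrite Hl; split; intros (D & H1 & H2);
      exists D; split; auto; apply HLl; exact H1.
Qed.

Definition kids (B : Ball d) : list (Ball d) := epsilon (inhabits []) (is_kids B).

Lemma kids_spec (B : Ball d) : is_kids B (kids B).
Proof. unfold kids; apply epsilon_spec, kids_exist. Qed.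

Lemma kids_maximal (B C : Ball d) : In C (kids B) -> maximal_proper_subball d (proj1_sig C) (proj1_sig B).
Proof. intros H; apply (kids_spec B); eauto. Qed.

Lemma kids_sub (B C : Ball d) (i : nat) : nth_error (kids B) i = Some C ->
  proper_subball d (proj1_sig C) (proj1_sig B).
Proof. intros H; apply nth_error_In in H; apply (kids_maximal B C H). Qed.

Lemma kids_containing (B : Ball d) (E : X -> Prop) : proper_subball d E (proj1_sig B) ->
  exists i C, nth_error (kids B) i = Some C /\ subset E (proj1_sig C).
Proof.
  intros H; destruct (proper_subball_in_maximal d HU HK _ E (proj2_sig B) H) as (C & HC & Hs).
  apply (kids_spec B) in HC as (D & HD & <-); apply In_nth_error in HD as [i Hi]; eauto.
Qed.

Lemma kids_cover (B : Ball d) (y z : X) : proj1_sig B y -> proj1_sig B z -> y <> z ->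
  exists i C, nth_error (kids B) i = Some C /\ proj1_sig C z.
Proof.
  intros Hy Hz Hne; destruct (nontrivial_maximal d HU HK _ y z (proj2_sig B) Hy Hz Hne) as (C & HC & Cz).
  apply (kids_spec B) in HC as (D & HD & <-); apply In_nth_error in HD as [i Hi]; eauto.
Qed.

Lemma kids_cover_of_kid (B C : Ball d) (z : X) : In C (kids B) -> proj1_sig B z ->
  exists i C, nth_error (kids B) i = Some C /\ proj1_sig C z.
Proof.
  intros HC Hz; destruct (proj1 (kids_maximal B C HC)) as (HCb & Hs & Hn).
  destruct (classic (proj1_sig C z)) as [K|K].
  - apply In_nth_error in HC as [i Hi]; eauto.
  - destruct (ball_inhabited d HU _ HCb) as [y Hy]; apply (kids_cover B y z); auto.
    intros ->; contradiction.
Qed.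

Lemma kids_disjoint (B C C' : Ball d) (i j : nat) (z : X) :
  nth_error (kids B) i = Some C -> nth_error (kids B) j = Some C' ->
  proj1_sig C z -> proj1_sig C' z -> i = j.
Proof.
  assert (H : forall i j C C', i < j -> nth_error (kids B) i = Some C -> nth_error (kids B) j = Some C' ->
             proj1_sig C z -> proj1_sig C' z -> False).
  { intros i' j' D D' Hij Hi Hj Hz Hz'.
    pose proof (proj1 (StronglySorted_nth _ _) (proj2 (kids_spec B)) i' j') as Hs.
    assert (j' < length (kids B)) by (apply nth_error_Some; congruence).
    specialize (Hs ltac:(lia) D); rewrite (nth_error_nth _ _ _ Hi), (nth_error_nth _ _ _ Hj) in Hs.
    pose proof HL as (_ & _ & (Hirr & _) & _); apply (Hirr z), Hs; assumption. }
  intros Hi Hj Hz Hz'; destruct (Nat.lt_trichotomy i j) as [K|[K|K]]; [exfalso; eauto|exact K|exfalso; eauto].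
Qed.

Lemma sorted_map_proj (L : list (Ball d)) :
  StronglySorted ball_lt L -> StronglySorted (set_lt lt) (map (fun C : Ball d => proj1_sig C) L).
Proof.
  induction 1 as [|B L Hs IH HB]; simpl; constructor; [exact IH|].
  rewrite Forall_forall in *; intros C HC; apply in_map_iff in HC as (D & <- & HD); apply HB, HD.
Qed.

(** A similarity permutes maximal sub-balls, and being order-preserving it keeps their sorted list
    sorted; a strictly sorted list is determined by its members. *)
Lemma sim_kids (B1 B2 : Ball d) (f : X -> X) : Sim (proj1_sig B1) (proj1_sig B2) f ->
  map (fun C : Ball d => image f (proj1_sig C)) (kids B1) = map (fun C : Ball d => proj1_sig C) (kids B2).
Proof.
  intros H; destruct (kids_spec B1) as [M1 S1]; destruct (kids_spec B2) as [M2 S2].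
  assert (Hsub : forall C, In C (kids B1) -> maximal_proper_subball d (proj1_sig C) (proj1_sig B1))
    by (intros; apply M1; eauto).
  assert (Hin : forall A, In A (map (fun C : Ball d => image f (proj1_sig C)) (kids B1)) <->
                          maximal_proper_subball d A (proj1_sig B2)).
  { intros A; rewrite in_map_iff; split.
    - intros (C & <- & HC); eapply sim_image_maximal; eauto.
    - intros HA; destruct (sim_inverse _ _ _ H) as (g & Hg & Hgf & Hfg).
      pose proof (sim_image_maximal _ _ _ _ Hg HA) as HgA.
      apply M1 in HgA as (C & HC & E); exists C; split; [|exact HC]; rewrite E.
      apply set_ext.
      + intros y (z & (w & Hw & <-) & <-); rewrite Hfg; [exact Hw|apply HA, Hw].
      + intros y Hy; exists (g y); split; [exists y; auto|apply Hfg, HA, Hy]. }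
  apply (sorted_unique (set_lt lt)).
  - intros A A' HA HA'; apply Hin in HA, HA'; apply set_lt_asym; [apply HA|apply HA'].
  - clear Hin M1 M2 S2; induction S1 as [|C L S1 IH HC]; simpl; constructor.
    + apply IH; intros; apply Hsub; simpl; auto.
    + rewrite Forall_forall in *; intros A HA; apply in_map_iff in HA as (D & <- & HD).
      intros y z (u & Hu & <-) (v & Hv & <-); pose proof HS as (_ & _ & Hord).
      apply (Hord _ _ _ H).
      * apply (Hsub C); simpl; auto.
      * apply (Hsub D); simpl; auto.
      * apply (HC D HD); assumption.
  - apply sorted_map_proj, S2.
  - intros A; rewrite Hin, M2, in_map_iff; split; intros (D & K1 & K2); eauto.
Qed.

Notation label := (cls d Sim).

Lemma label_eq (B1 B2 : Ball d) : label B1 = label B2 <-> exists f, Sim (proj1_sig B1) (proj1_sig B2) f.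
Proof.
  pose proof HS as ((_ & _ & _ & Hid & _ & Hcomp & _) & _); unfold cls; split.
  - intros E; apply (f_equal (@proj1_sig _ _)) in E; simpl in E.
    change (sim_equiv Sim (proj1_sig B1) (proj1_sig B2)).
    rewrite <- (f_equal (fun C => C (proj1_sig B1)) E); exists (fun z => z); apply Hid, proj2_sig.
  - intros [f Hf]; destruct (sim_inverse _ _ _ Hf) as (g & Hg & _ & _).
    assert (E : (fun A => sim_equiv Sim A (proj1_sig B1)) = (fun A => sim_equiv Sim A (proj1_sig B2))).
    { extensionality A; apply propositional_extensionality; split; intros [k Hk]; eexists; eauto. }
    apply subset_eq_compat, E.
Qed.

Lemma sim_kid (B1 B2 C : Ball d) (f : X -> X) (i : nat) :
  Sim (proj1_sig B1) (proj1_sig B2) f -> nth_error (kids B1) i = Some C ->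
  exists D, nth_error (kids B2) i = Some D /\ proj1_sig D = image f (proj1_sig C) /\
    Sim (proj1_sig C) (proj1_sig D) f.
Proof.
  intros H Hi; pose proof (sim_kids _ _ _ H) as E.
  apply (f_equal (fun l => nth_error l i)) in E; cbv beta in E.
  rewrite !nth_error_map, Hi in E; simpl in E.
  destruct (nth_error (kids B2) i) as [D|]; [|discriminate]; injection E as E.
  exists D; split; [reflexivity|split; [auto|]]; rewrite <- E.
  destruct (kids_sub B1 C i Hi) as (HC & Hs & _); apply (sim_restrict _ _ _ _ H HC Hs).
Qed.

Lemma sim_kids_labels (B1 B2 : Ball d) : label B1 = label B2 -> map label (kids B1) = map label (kids B2).
Proof.
  intros E; apply label_eq in E as [f Hf].
  apply nth_error_ext; intros i; rewrite !nth_error_map.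
  destruct (nth_error (kids B1) i) as [C|] eqn:E1; simpl.
  - destruct (sim_kid _ _ _ _ _ Hf E1) as (D & -> & _ & HD); simpl; f_equal; apply label_eq; eauto.
  - pose proof (f_equal (@length _) (sim_kids _ _ _ Hf)) as L; rewrite !length_map in L.
    apply nth_error_None in E1; rewrite L in E1; apply nth_error_None in E1; rewrite E1; reflexivity.
Qed.

(** The relation may be witnessed by another ball of the same class; by [sim_kids_labels] its
    children carry the same labels. *)
Lemma relsim_kids (B : Ball d) (v : list (Cls d Sim)) :
  RelSim d lt Sim [label B] v <-> kids B <> [] /\ v = map label (kids B).
Proof.
  split.
  - intros (B0 & L & Hne & Hmax & Hord & E & ->); apply (f_equal (hd (label B))) in E; cbn [hd] in E.
    assert (HLk : L = kids B0).
    { assert (Hs : StronglySorted ball_lt L) by (apply StronglySorted_nth; intros; apply Hord; assumption).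
      apply (sorted_unique ball_lt); auto.
      - intros A C _ _; apply set_lt_asym; apply proj2_sig.
      - apply (kids_spec B0).
      - intros C; split; intros HC.
        + destruct (proj1 (proj1 (kids_spec B0) (proj1_sig C))) as (D & HD & K); [apply Hmax; eauto|].
          apply ball_eq in K as ->; exact HD.
        + destruct (proj1 (Hmax (proj1_sig C))) as (D & HD & K); [apply (kids_spec B0); eauto|].
          apply ball_eq in K as ->; exact HD. }
    subst L; apply sim_kids_labels in E; rewrite E; split; [|reflexivity].
    intros K; rewrite K in E; destruct (kids B0); [auto|discriminate].
  - intros [Hne ->]; exists B, (kids B); split; [exact Hne|split; [apply (kids_spec B)|split; [|auto]]].
    intros i j Hij b; apply (proj1 (StronglySorted_nth _ _) (proj2 (kids_spec B))); exact Hij.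
Qed.

(** A single child would cover the whole ball and so not be proper; hence right-hand sides have at
    least two letters. *)
Lemma relsim_tree_like : tree_like (RelSim d lt Sim).
Proof.
  split.
  - intros w1 w2 H; pose proof H as (B & L & _ & _ & _ & -> & _); split; [reflexivity|].
    apply relsim_kids in H as [Hne ->]; rewrite length_map.
    destruct (kids B) as [|C l] eqn:E; [contradiction|]; destruct l as [|C' l]; [exfalso|simpl; lia].
    assert (HC : In C (kids B)) by (rewrite E; simpl; auto).
    destruct (kids_maximal B C HC) as [(HCb & Hs & Hn) _]; apply Hn; intros z Hz.
    destruct (kids_cover_of_kid B C z HC Hz) as (i & D & Hi & Dz); rewrite E in Hi.
    destruct i as [|[|i]]; try discriminate; injection Hi as ->; exact Dz.
  - intros a w1 w2 H1 H2; pose proof H1 as (B & L & _ & _ & _ & E & _); injection E as ->.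
    apply relsim_kids in H1 as [_ ->], H2 as [_ ->]; reflexivity.
Qed.

(** * Coding of points and balls by paths *)

Notation TL := relsim_tree_like.
Notation Rel := (RelSim d lt Sim).

(** The lift of [walk] from classes to balls. Once the starting ball is fixed, an address determines
    the ball reached. *)
Inductive descend : Ball d -> list nat -> Ball d -> Prop :=
| descend_nil B : descend B [] B
| descend_cons B C E i al :
    nth_error (kids B) i = Some C -> descend C al E -> descend B (i :: al) E.

Lemma descend_cons_inv (B E : Ball d) (i : nat) (al : list nat) :
  descend B (i :: al) E -> exists C, nth_error (kids B) i = Some C /\ descend C al E.
Proof. inversion 1; eauto. Qed.

Lemma descend_nil_inv (B E : Ball d) : descend B [] E -> B = E.
Proof. inversion 1; reflexivity. Qed.

Lemma descend_det (B C C' : Ball d) (al : list nat) : descend B al C -> descend B al C' -> C = C'.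
Proof.
  intros H; revert C'; induction H as [B|B C E i al H1 _ IH]; intros C' H'.
  - apply descend_nil_inv; exact H'.
  - apply descend_cons_inv in H' as (D & H3 & H4); apply IH; congruence.
Qed.

Lemma descend_app (B C E : Ball d) (al be : list nat) :
  descend B al C -> descend C be E -> descend B (al ++ be) E.
Proof. induction 1; simpl; intros; [assumption|econstructor; eauto]. Qed.

Lemma descend_app_inv (B E : Ball d) (al be : list nat) :
  descend B (al ++ be) E -> exists C, descend B al C /\ descend C be E.
Proof.
  revert B; induction al as [|i al IH]; intros B H; [exists B; split; [constructor|exact H]|].
  apply descend_cons_inv in H as (C & H1 & H2); destruct (IH C H2) as (C' & H3 & H4).
  exists C'; split; [econstructor; eauto|exact H4].
Qed.

Lemma descend_sub (B C : Ball d) (al : list nat) : descend B al C -> subset (proj1_sig C) (proj1_sig B).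
Proof.
  induction 1 as [B|B C E i al H1 _ IH]; intros z Hz; [exact Hz|].
  apply (kids_sub B C i H1), IH, Hz.
Qed.

Lemma descend_walk (B C : Ball d) (al : list nat) : descend B al C -> walk Rel (label B) al (label C).
Proof.
  induction 1 as [B|B C E i al H1 _ IH]; [constructor|].
  apply (walk_cons _ _ (map label (kids B)) i (label C)); [| |exact IH].
  - apply relsim_kids; split; [|reflexivity]; intros K; rewrite K in H1; destruct i; discriminate.
  - rewrite nth_error_map, H1; reflexivity.
Qed.

Lemma walk_descend (B : Ball d) (al : list nat) (a : Cls d Sim) :
  walk Rel (label B) al a -> exists C, descend B al C /\ label C = a.
Proof.
  revert B; induction al as [|i al IH]; intros B H.
  - apply walk_nil_inv in H; exists B; split; [constructor|exact H].
  - apply walk_cons_inv in H as (w & b & H1 & H2 & H3); apply relsim_kids in H1 as [_ ->].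
    rewrite nth_error_map in H2; destruct (nth_error (kids B) i) as [C|] eqn:E; [|discriminate].
    injection H2 as <-; destruct (IH C H3) as (D & H4 & H5); exists D; split; [|exact H5].
    econstructor; eauto.
Qed.

Lemma ok_kids_inv (B : Ball d) (p : point) : kids B <> [] -> ok Rel (label B) p ->
  exists i C q, p = pcons i q /\ nth_error (kids B) i = Some C /\ ok Rel (label C) q.
Proof.
  intros Hne Hp; destruct (ok_inv Rel TL (label B) (map label (kids B)) p) as (i & b & q & E & Hi & Hq); auto.
  - apply relsim_kids; auto.
  - rewrite nth_error_map in Hi; destruct (nth_error (kids B) i) as [C|] eqn:F; [|discriminate].
    injection Hi as <-; exists i, C, q; auto.
Qed.

(** The point coded by a path is the common point of the balls along it. Addresses continued by
    padding beyond a one-point ball impose no condition, since [descend] stops there. *)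
Definition hits (B : Ball d) (p : point) (z : X) : Prop :=
  forall al r C, p = papp al r -> descend B al C -> proj1_sig C z.

Lemma hits_tail (B C : Ball d) (i : nat) (p : point) (z : X) :
  nth_error (kids B) i = Some C -> hits B (pcons i p) z -> hits C p z.
Proof.
  intros Hi H al r D -> Hd; apply (H (i :: al) r); [reflexivity|econstructor; eauto].
Qed.

Lemma hits_papp (B C : Ball d) (al : list nat) (p : point) (z : X) :
  descend B al C -> hits C p z -> hits B (papp al p) z.
Proof.
  intros Hd H be r E Heq HE.
  destruct (papp_comparable _ _ _ _ Heq) as [ga [[-> F]|[-> F]]].
  - apply descend_app_inv in Hd as (E' & H1 & H2); rewrite (descend_det _ _ _ _ H1 HE) in H2.
    apply (descend_sub _ _ _ H2), (H [] p C); [reflexivity|constructor].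
  - apply descend_app_inv in HE as (C' & H1 & H2); rewrite (descend_det _ _ _ _ H1 Hd) in H2.
    apply (H ga r); assumption.
Qed.

(* The addresses of the balls missing [z] cannot form a bar: by bar induction every
   ball would miss [z]. *)
Lemma point_code (B : Ball d) (z : X) : proj1_sig B z -> exists p, ok Rel (label B) p /\ hits B p z.
Proof.
  intros Bz; apply NNPP; intros Hno.
  pose (good := fun al => exists C, descend B al C /\ ~ proj1_sig C z).
  assert (Hbar : barred Rel good [] (label B)).
  { apply (fan_theorem Rel TL).
    - intros p Hp; apply NNPP; intros K; apply Hno; exists p; split; [exact Hp|].
      intros al r C E Hd; apply NNPP; intros HC; apply K.
      exists al, (label C), r; split; [apply descend_walk, Hd|split; [exact E|exists C; auto]].
    - intros al be b (C & HC & Hz) Hw.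
      destruct (walk_descend _ _ _ Hw) as (D & HD & _); exists D; split; [exact HD|].
      apply descend_app_inv in HD as (C' & H1 & H2); rewrite (descend_det _ _ _ _ H1 HC) in H2.
      intros K; apply Hz, (descend_sub _ _ _ H2), K. }
  assert (H : forall al a, barred Rel good al a ->
            forall C, descend B al C -> a = label C -> ~ proj1_sig C z).
  { induction 1 as [al a (C & HC & Hz)|al a w Hr Hb IH]; intros D HD Ea.
    - rewrite (descend_det _ _ _ _ HD HC); exact Hz.
    - intros Dz; subst a; apply relsim_kids in Hr as [Hne ->].
      destruct (kids D) as [|E0 l] eqn:EL; [contradiction|].
      destruct (kids_cover_of_kid D E0 z) as (i & E & Hi & Ez); [rewrite EL; simpl; auto|exact Dz|].
      rewrite EL in Hi; apply (IH i (label E)) with (C := E); auto.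
      + rewrite nth_error_map, Hi; reflexivity.
      + eapply descend_app; [exact HD|econstructor; [rewrite EL; exact Hi|constructor]]. }
  exact (H _ _ Hbar B (descend_nil B) eq_refl Bz).
Qed.

Lemma kids_nonempty (B : Ball d) (y z : X) : proj1_sig B y -> proj1_sig B z -> y <> z -> kids B <> [].
Proof.
  intros Hy Hz Hne; destruct (kids_cover B y z Hy Hz Hne) as (i & C & Hi & _).
  intros K; rewrite K in Hi; destruct i; discriminate.
Qed.

(* Along a path the balls strictly decrease, and only finitely many balls around [z]
   stick out of a given one. *)
Lemma path_enters_ball (B : Ball d) (p : point) (z : X) (s : R) :
  ok Rel (label B) p -> hits B p z -> (0 < s)%R ->
  exists al r C, p = papp al r /\ descend B al C /\ subset (proj1_sig C) (fun y => (d z y <= s)%R).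
Proof.
  intros Hp Hh Hs; apply NNPP; intros Hno.
  assert (Hbig : forall al r C, p = papp al r -> descend B al C ->
            ~ subset (proj1_sig C) (fun y => (d z y <= s)%R)).
  { intros al r C H1 H2 H3; apply Hno; exists al, r, C; auto. }
  destruct (finite_large_balls d HU HK z s Hs) as (l & Hl).
  (* [Ls] collects the balls left behind. They are distinct and all belong to [l], so taking more
     than [length l] of them is impossible. *)
  assert (H : forall n, exists al r C Ls, p = papp al r /\ descend B al C /\ ok Rel (label C) r /\
     length Ls = n /\ NoDup Ls /\ incl Ls l /\ (forall S, In S Ls -> ~ subset S (proj1_sig C))).
  { induction n as [|n (al & r & C & Ls & H1 & H2 & H3 & H4 & H5 & H6 & H7)].
    - exists [], p, B, []; repeat split; auto using NoDup_nil; [constructor|intros a []].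
    - assert (Cz : proj1_sig C z) by (eapply Hh; eauto).
      assert (Hne : kids C <> []).
      { intros K; apply (Hbig al r C H1 H2); intros y Hy.
        destruct (classic (y = z)) as [->|Hyz]; [rewrite (d_self d HU); lra|].
        exfalso; exact (kids_nonempty C y z Hy Cz Hyz K). }
      destruct (ok_kids_inv C r Hne H3) as (i & D & q & -> & Hi & Hq).
      destruct (kids_sub C D i Hi) as (_ & Hs1 & Hn1).
      exists (al ++ [i]), q, D, (proj1_sig C :: Ls); split; [rewrite papp_snoc; exact H1|].
      split; [eapply descend_app; [exact H2|econstructor; [exact Hi|constructor]]|].
      split; [exact Hq|split; [simpl; congruence|split; [|split]]].
      + constructor; [|exact H5]; intros K; apply (H7 _ K); intros y Hy; exact Hy.
      + apply incl_cons; [|exact H6]; apply Hl; [apply proj2_sig|exact Cz|eapply Hbig; eauto].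
      + intros S [<-|HT]; [exact Hn1|]; intros K; apply (H7 S HT); intros y Hy; apply Hs1, K, Hy. }
  destruct (H (S (length l))) as (al & r & C & Ls & _ & _ & _ & H4 & H5 & H6 & _).
  pose proof (NoDup_incl_length H5 H6); lia.
Qed.

Lemma hits_unique (B : Ball d) (p : point) (y z : X) :
  ok Rel (label B) p -> hits B p y -> hits B p z -> y = z.
Proof.
  intros Hp Hy Hz; apply NNPP; intros Hne.
  pose proof (d_pos d HU z y ltac:(auto)) as Hd.
  destruct (path_enters_ball B p z (d z y / 2) Hp Hz) as (al & r & C & H1 & H2 & H3); [lra|].
  pose proof (H3 y (Hy al r C H1 H2)) as K; simpl in K; lra.
Qed.

(** Siblings are disjoint, so [z] forces the same index in both paths at every level; below a
    one-point ball only the zero path is left. *)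
Lemma code_unique (B : Ball d) (p q : point) (z : X) :
  ok Rel (label B) p -> ok Rel (label B) q -> hits B p z -> hits B q z -> p = q.
Proof.
  intros Hp Hq Hpz Hqz; extensionality n; revert B p q Hp Hq Hpz Hqz.
  assert (Hlab : forall B, kids B = [] -> ~ nonterminal Rel (label B)).
  { intros B K [w Hw]; apply relsim_kids in Hw as [Hw _]; contradiction. }
  assert (Hstep : forall B p q, ok Rel (label B) p -> ok Rel (label B) q -> hits B p z -> hits B q z ->
     p = q \/ exists i C p' q', p = pcons i p' /\ q = pcons i q' /\ ok Rel (label C) p' /\
       ok Rel (label C) q' /\ hits C p' z /\ hits C q' z).
  { intros B p q Hp Hq Hpz Hqz; destruct (classic (kids B = [])) as [K|K].
    - left; rewrite (ok_terminal Rel _ _ (Hlab B K) Hp), (ok_terminal Rel _ _ (Hlab B K) Hq); reflexivity.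
    - right; destruct (ok_kids_inv B p K Hp) as (i & C & p' & -> & Hi & Hp').
      destruct (ok_kids_inv B q K Hq) as (j & C' & q' & -> & Hj & Hq').
      pose proof (hits_tail _ _ _ _ _ Hi Hpz) as K1; pose proof (hits_tail _ _ _ _ _ Hj Hqz) as K2.
      assert (i = j) as <-.
      { apply (kids_disjoint B C C' i j z Hi Hj).
        - apply (K1 [] p' C); [reflexivity|constructor].
        - apply (K2 [] q' C'); [reflexivity|constructor]. }
      assert (C = C') as <- by congruence; exists i, C, p', q'; auto 7. }
  induction n as [|n IH]; intros B p q Hp Hq Hpz Hqz;
    destruct (Hstep B p q Hp Hq Hpz Hqz) as [->|(i & C & p' & q' & -> & -> & H1 & H2 & H3 & H4)]; auto.
  exact (IH C p' q' H1 H2 H3 H4).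
Qed.

(** Otherwise the complements of the balls along [p] cover the space. A finite subcover misses the
    smallest of its finitely many balls, which is non-empty. *)
Lemma hits_exists (B : Ball d) (p : point) : ok Rel (label B) p -> exists z, hits B p z.
Proof.
  intros Hp; apply NNPP; intros Hno.
  destruct (HK (fun O => exists al r C, p = papp al r /\ descend B al C /\ O = (fun z => ~ proj1_sig C z)))
    as (l & H1 & H2).
  - intros O (al & r & C & _ & _ & ->) y Hy.
    destruct (proj2_sig C) as (c & s & Hs & HC); exists s; split; [exact Hs|].
    intros w Hw Cw; apply Hy, HC; apply HC in Cw.
    apply (d_ultra_le d HU) with w; [exact Cw|rewrite (d_sym d HU); lra].
  - intros z; apply NNPP; intros K; apply Hno; exists z; intros al r C E Hd.
    apply NNPP; intros HC; apply K; exists (fun z => ~ proj1_sig C z); split; [eauto 7|exact HC].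
  - assert (H : exists al r C, p = papp al r /\ descend B al C /\
                 forall O, In O l -> forall z, proj1_sig C z -> ~ O z).
    { clear H2; induction l as [|O l IH].
      - exists [], p, B; split; [reflexivity|split; [constructor|intros O []]].
      - destruct IH as (al & r & C & E & Hd & HO); [intros; apply H1; simpl; auto|].
        destruct (H1 O) as (be & r' & C' & E' & Hd' & ->); [simpl; auto|].
        destruct (papp_comparable al be r r') as [ga [[-> F]|[-> F]]]; [congruence| |].
        + exists (be ++ ga), r, C; split; [exact E|split; [exact Hd|]].
          intros O [<-|Hin] z Cz; [|auto]; intros K; apply K.
          apply descend_app_inv in Hd as (C2 & K1 & K2); rewrite (descend_det _ _ _ _ K1 Hd') in K2.
          apply (descend_sub _ _ _ K2), Cz.
        + exists (al ++ ga), r', C'; split; [exact E'|split; [exact Hd'|]].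
          intros O [<-|Hin] z Cz; [intros K; apply K, Cz|]; apply (HO O Hin).
          apply descend_app_inv in Hd' as (C2 & K1 & K2); rewrite (descend_det _ _ _ _ K1 Hd) in K2.
          apply (descend_sub _ _ _ K2), Cz. }
    destruct H as (al & r & C & _ & _ & HO).
    destruct (ball_inhabited d HU _ (proj2_sig C)) as [z Cz]; destruct (H2 z) as (O & Hin & Oz).
    exact (HO O Hin z Cz Oz).
Qed.

Lemma sim_descend (B1 B2 C : Ball d) (f : X -> X) (al : list nat) :
  Sim (proj1_sig B1) (proj1_sig B2) f -> descend B1 al C ->
  exists D, descend B2 al D /\ proj1_sig D = image f (proj1_sig C).
Proof.
  intros H Hd; revert B2 H; induction Hd as [B|B C E i al Hi _ IH]; intros B2 H.
  - exists B2; split; [constructor|symmetry; apply (sim_image _ _ _ H)].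
  - destruct (sim_kid _ _ _ _ _ H Hi) as (C' & Hi' & _ & HC).
    destruct (IH C' HC) as (D & HD & ED); exists D; split; [econstructor; eauto|exact ED].
Qed.

(** A similarity in [Sim] carries the ball at each address to the ball at the same address, so it
    preserves codes. *)
Lemma sim_hits (B1 B2 : Ball d) (f : X -> X) (p : point) (z : X) :
  Sim (proj1_sig B1) (proj1_sig B2) f -> hits B1 p z -> hits B2 p (f z).
Proof.
  intros H Hh al r D E Hd.
  assert (Hlab : label B1 = label B2) by (apply label_eq; eauto).
  pose proof (descend_walk _ _ _ Hd) as Hw; rewrite <- Hlab in Hw.
  destruct (walk_descend _ _ _ Hw) as (C & HC & _).
  destruct (sim_descend _ _ _ _ _ H HC) as (D' & HD' & ED).
  rewrite (descend_det _ _ _ _ Hd HD'), ED; exists z; split; [|reflexivity].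
  apply (Hh al r C E HC).
Qed.

Section Whole.
Context (XB : Ball d) (HX : forall z, proj1_sig XB z).

Definition point_at (p : point) : X := epsilon (inhabits (proj1_sig (constructive_indefinite_description _
  (ball_inhabited d HU _ (proj2_sig XB))))) (hits XB p).

Lemma point_at_hits (p : point) : ok Rel (label XB) p -> hits XB p (point_at p).
Proof. intros Hp; unfold point_at; apply epsilon_spec, hits_exists, Hp. Qed.

Lemma point_at_eq (p : point) (z : X) : ok Rel (label XB) p -> hits XB p z -> point_at p = z.
Proof. intros Hp Hz; apply (hits_unique XB p); auto; apply point_at_hits, Hp. Qed.

Lemma descend_cylinder (al : list nat) (C : Ball d) : descend XB al C ->
  cylinder Rel point_at al (label C) (proj1_sig C).
Proof.
  intros Hd z; pose proof (descend_walk _ _ _ Hd) as Hw; split.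
  - intros Cz; destruct (point_code C z Cz) as (p & Hp & Hz); exists p; split; [exact Hp|].
    apply point_at_eq; [apply (ok_papp Rel TL _ _ _ _ Hw), Hp|eapply hits_papp; eauto].
  - intros (p & Hp & <-); apply (proj2 (ok_papp Rel TL _ _ _ p Hw)), point_at_hits in Hp.
    apply (Hp al p C); [reflexivity|exact Hd].
Qed.

Lemma cylinder_set_ext (al : list nat) (a : Cls d Sim) (B C : X -> Prop) :
  cylinder Rel point_at al a B -> cylinder Rel point_at al a C -> B = C.
Proof. intros H1 H2; apply set_ext; intros z Hz; [apply H2, H1, Hz|apply H1, H2, Hz]. Qed.

(** The balls along the code of a point of [E] are followed. If none equals [E], then each contains
    [E] strictly, yet by [path_enters_ball] one of them lies inside [E]. *)
Lemma ball_descend (E : Ball d) : exists al, descend XB al E.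
Proof.
  destruct (ball_inhabited d HU _ (proj2_sig E)) as [z Ez].
  destruct (ball_recenter d HU _ z (proj2_sig E) Ez) as (s & Hs & HE).
  destruct (point_code XB z (HX z)) as (p & Hp & Hz).
  apply NNPP; intros Hno.
  assert (H : forall al r C, p = papp al r -> descend XB al C ->
            subset (proj1_sig E) (proj1_sig C) /\ ~ subset (proj1_sig C) (proj1_sig E)).
  { assert (Hstrict : forall al C, descend XB al C -> subset (proj1_sig E) (proj1_sig C) ->
              ~ subset (proj1_sig C) (proj1_sig E)).
    { intros al C Hd H1 H2; apply Hno; exists al.
      rewrite (ball_eq d E C (set_ext _ _ H1 H2)); exact Hd. }
    induction al as [|i al IH] using rev_ind; intros r C Ep Hd.
    - apply descend_nil_inv in Hd as <-.
      assert (K : subset (proj1_sig E) (proj1_sig XB)) by (intros y _; apply HX).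
      split; [exact K|apply (Hstrict [] XB); [constructor|exact K]].
    - pose proof Hd as Hd'; apply descend_app_inv in Hd as (D & H1 & H2).
      apply descend_cons_inv in H2 as (C' & Hi & H2); apply descend_nil_inv in H2 as ->.
      rewrite papp_snoc in Ep; destruct (IH _ _ Ep H1) as [H3 H4].
      destruct (kids_containing D (proj1_sig E)) as (j & C' & Hj & HC').
      { split; [apply proj2_sig|auto]. }
      assert (Cz : proj1_sig C z) by (apply (Hz (al ++ [i]) r); [rewrite papp_snoc; exact Ep|exact Hd']).
      assert (i = j) as <- by (apply (kids_disjoint D C C' i j z Hi Hj Cz), HC', Ez).
      assert (C = C') as <- by congruence.
      split; [exact HC'|apply (Hstrict _ _ Hd' HC')]. }
  destruct (path_enters_ball XB p z s Hp Hz Hs) as (al & r & C & Ep & Hd & Hsub).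
  apply (proj2 (H al r C Ep Hd)); intros y Hy; apply HE, Hsub, Hy.
Qed.

Lemma point_at_sim (al be : list nat) (C1 C2 : Ball d) (f : X -> X) (p : point) :
  descend XB al C1 -> descend XB be C2 -> Sim (proj1_sig C1) (proj1_sig C2) f ->
  ok Rel (label C1) p -> f (point_at (papp al p)) = point_at (papp be p).
Proof.
  intros H1 H2 Hf Hp; pose proof (descend_walk _ _ _ H1) as W1; pose proof (descend_walk _ _ _ H2) as W2.
  assert (Hlab : label C1 = label C2) by (apply label_eq; eauto).
  symmetry; apply point_at_eq.
  - apply (ok_papp Rel TL _ _ _ _ W2); rewrite <- Hlab; exact Hp.
  - apply (hits_papp _ _ _ _ _ H2), (sim_hits _ _ _ _ _ Hf).
    pose proof (point_at_hits _ (proj2 (ok_papp Rel TL _ _ _ _ W1) Hp)) as Hh.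
    intros ga r E -> Hd; apply (Hh (al ++ ga) r); [symmetry; apply papp_app|].
    eapply descend_app; eauto.
Qed.

Lemma small_coded : coded Rel (label XB) d Sim point_at.
Proof.
  constructor.
  - intros p q Hp Hq E; apply (code_unique XB p q (point_at p)); auto.
    + apply point_at_hits, Hp.
    + rewrite E; apply point_at_hits, Hq.
  - intros z; destruct (point_code XB z (HX z)) as (p & Hp & Hz); exists p; split; [exact Hp|].
    apply point_at_eq; assumption.
  - intros B; split.
    + intros HB; destruct (ball_descend (exist _ B HB)) as [al Hal].
      exists al, (label (exist _ B HB)); split; [apply descend_walk, Hal|].
      apply (descend_cylinder _ _ Hal).
    + intros (al & a & Hw & HB); destruct (walk_descend _ _ _ Hw) as (C & HC & <-).
      rewrite (cylinder_set_ext _ _ _ _ HB (descend_cylinder _ _ HC)); apply proj2_sig.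
  - intros B1 B2 f; split.
    + intros Hf; destruct (sim_balls _ _ _ Hf) as (HB1 & HB2 & _).
      destruct (ball_descend (exist _ B1 HB1)) as [al Hal].
      destruct (ball_descend (exist _ B2 HB2)) as [be Hbe].
      assert (Hlab : label (exist _ B1 HB1) = label (exist _ B2 HB2)) by (apply label_eq; eauto).
      exists al, be, (label (exist _ B1 HB1)); split; [apply descend_walk, Hal|].
      split; [rewrite Hlab; apply descend_walk, Hbe|].
      split; [apply (descend_cylinder _ _ Hal)|split; [rewrite Hlab; apply (descend_cylinder _ _ Hbe)|]].
      intros p; exact (point_at_sim _ _ _ _ f p Hal Hbe Hf).
    + intros (al & be & a & W1 & W2 & H1 & H2 & Hf).
      destruct (walk_descend _ _ _ W1) as (C1 & K1 & E1); destruct (walk_descend _ _ _ W2) as (C2 & K2 & E2).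
      subst a; rewrite (cylinder_set_ext _ _ _ _ H1 (descend_cylinder _ _ K1)).
      rewrite <- E2 in H2; rewrite (cylinder_set_ext _ _ _ _ H2 (descend_cylinder _ _ K2)).
      (* Equal letters provide some similarity [f0] in [Sim]. It acts by the same prefix replacement
         as [f], hence agrees with [f] on the ball, and [Sim] is closed under such agreement. *)
      destruct (proj1 (label_eq C1 C2) (eq_sym E2)) as [f0 Hf0].
      pose proof HS as ((_ & Hext & _) & _); apply (Hext _ _ f0); [exact Hf0|].
      intros z Hz; apply (descend_cylinder _ _ K1) in Hz as (p & Hp & <-).
      rewrite Hf by exact Hp; apply (point_at_sim _ _ _ _ f0 p K1 K2 Hf0 Hp).
Qed.

End Whole.

End SmallSimilarity.

Theorem theorem9p13 :
  (forall (X : Type) (d : X -> X -> R) (lt : X -> X -> Prop)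
          (Sim : (X -> Prop) -> (X -> Prop) -> (X -> X) -> Prop),
      inhabited X ->
      lin_ord_cpt_ultrametric d lt ->
      small_sim_structure d lt Sim ->
      forall XB : Ball d, (forall x, proj1_sig XB x) ->
      group_iso
        (in_Gamma d Sim) Gamma_eq Gamma_op
        (valid (RelSim d lt Sim) [cls d Sim XB] [cls d Sim XB])
        (deq (RelSim d lt Sim) [cls d Sim XB]) concat_diag)
  /\
  (forall (Sigma : Type) (Rel : list Sigma -> list Sigma -> Prop) (x : Sigma),
      tree_like Rel ->
      exists (X : Type) (d : X -> X -> R) (lt : X -> X -> Prop)
             (Sim : (X -> Prop) -> (X -> Prop) -> (X -> X) -> Prop),
        inhabited X /\
        lin_ord_cpt_ultrametric d lt /\
        small_sim_structure d lt Sim /\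
        group_iso
          (valid Rel [x] [x]) (deq Rel [x]) concat_diag
          (in_Gamma d Sim) Gamma_eq Gamma_op).
Proof.
  split.
  - intros X d lt Sim _ HL HS XB HX.
    exact (coded_iso_inverse _ _ d Sim _ (relsim_tree_like d lt Sim HL HS)
             (small_coded d lt Sim HL HS XB HX) (proj1 HS) (proj1 HL)).
  - intros Sigma Rel x TL.
    exists (path_space Rel x), (path_dist Rel x), (path_lt Rel x), (path_sim Rel TL x).
    split; [exact (inhabits (path_of Rel TL x (fun _ => 0)))|].
    split; [apply path_lin_ord_cpt; exact TL|split; [apply path_small_sim|]].
    exact (coded_iso _ _ _ _ _ TL (path_coded Rel TL x) (path_finite_sim Rel TL x)
             (path_ultrametric Rel x)).
Qed.
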